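(* Let $m\in\mathbb N$ and let $(a_{\gamma,\delta})_{|\gamma|+|\delta|=m}$ be complex numbers such that for all $\epsilon>0$ the difference operator $\mathcal L_\epsilon:=\sum_{|\gamma|+|\delta|=m}a_{\gamma,\delta}D_\epsilon^\gamma\overline D{}_\epsilon^\delta$ is discretely elliptic on $\Lambda_\epsilon$. Suppose $0<\alpha<\eta<m$ with $\alpha,\eta\notin\mathbb N$. There exists a constant $C>0$ such that for all $\epsilon>0$ and all germs $U$ over $\Lambda_\epsilon$ that are centered to order $\eta$ and satisfy $\|U\|_{G^\eta(\Lambda_\epsilon)}<\infty$ it holds $$\|U\|_{G^\eta(\Lambda_\epsilon)}\le C\big([\mathcal L_\epsilon U]_{G^{\eta-m}(\Lambda_\epsilon)}+[U]_{G^{\eta,\alpha}(\Lambda_\epsilon)}\big).$$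
   Context: Fix a scaling $\mathfrak s\in\mathbb N^d$; for $\beta\in\mathbb N_0^d$, $|\beta|:=\sum_i\mathfrak s_i\beta_i$; $d(x,y):=\sum_i|x_i-y_i|^{1/\mathfrak s_i}$, $B_R(x)$ the open ball for $d$, $\mathcal P_k$ the polynomials $\sum_{|\beta|\le k}c_\beta z^\beta$ on $\mathbb R^d$. $\Lambda_\epsilon:=\epsilon^{\mathfrak s_1}\mathbb Z\times\cdots\times\epsilon^{\mathfrak s_d}\mathbb Z$. Forward/backward differences: $D_{\epsilon,j}u(k):=\epsilon^{-\mathfrak s_j}(u(k+\epsilon^{\mathfrak s_j}\mathbf e_j)-u(k))$, $\overline D_{\epsilon,j}u(k):=\epsilon^{-\mathfrak s_j}(u(k)-u(k-\epsilon^{\mathfrak s_j}\mathbf e_j))$, $D_\epsilon^\gamma:=D_{\epsilon,1}^{\gamma_1}\cdots D_{\epsilon,d}^{\gamma_d}$, similarly $\overline D{}_\epsilon^\delta$. Let $\widehat\Lambda_\epsilon:=\prod_{j=1}^d\mathbb R/(2\pi\epsilon^{-\mathfrak s_j}\mathbb Z)$, $\xi^\epsilon_{\theta,j}:=i\epsilon^{-\mathfrak s_j}(1-e^{i\epsilon^{\mathfrak s_j}\theta_j})$, $(\xi^\epsilon_\theta)^\gamma:=\prod_j(\xi^\epsilon_{\theta,j})^{\gamma_j}$. $\mathcal L_\epsilon$ is discretely elliptic on $\Lambda_\epsilon$ if $\hat{\mathcal L}_\epsilon(\theta):=\sum_{|\gamma|+|\delta|=m}a_{\gamma,\delta}(i\xi^\epsilon_\theta)^\gamma(i\overline{\xi^\epsilon_\theta})^\delta\ne0$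 for all $\theta\in\widehat\Lambda_\epsilon\setminus\{0\}$ and $\hat{\mathcal L}(\xi):=\sum_{|\gamma|+|\delta|=m}a_{\gamma,\delta}(i\xi)^{\gamma+\delta}\ne0$ for all $\xi\in\mathbb R^d\setminus\{0\}$. A germ over $\Lambda_\epsilon$ is a family $U=(U_x)_{x\in\Lambda_\epsilon}$ of functions $U_x:\Lambda_\epsilon\to\mathbb C$. $\|U\|_{G^\eta(\Lambda_\epsilon)}$ is the infimum of $M>0$ with $|U_x(y)|\le M\,d(x,y)^\eta$ for all $x,y\in\Lambda_\epsilon$; $[U]_{G^{\eta,\alpha}(\Lambda_\epsilon)}$ is the infimum of $M>0$ such that for all $x,y\in\Lambda_\epsilon$ there is $P\in\mathcal P_{\lfloor\eta\rfloor}$ with $|(U_x-U_y-P)(z)|\le M\,d(y,z)^\alpha(d(x,y)+d(y,z))^{\eta-\alpha}$ for all $z\in\Lambda_\epsilon$. $U$ is centered to order $\eta$ if $D^\gamma_\epsilon U_x(x)=0$ for all $x\in\Lambda_\epsilon$ and all $|\gamma|\le\eta$. For $\gamma<0$, with $k:=\lceil|\gamma|\rceil$, $\mathcal B$ is the set of $\varphi\in C^\infty_c(\mathbb R^d)$ supported in $B_1(0)$ with $\sup_{|\beta|\le k}\sup|\partial^\beta\varphi|\le1$, $\varphi_x^\lambda(y):=\lambda^{-\sum_i\mathfrak s_i}\varphi(\lambda^{-\mathfrak s_1}(y_1-x_1),\dots,\lambda^{-\mathfrak s_d}(y_d-x_d))$; with $\langle f,g\rangle_\epsilon:=\epsilon^{\sum_j\mathfrak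 s_j}\sum_{x\in\Lambda_\epsilon}f(x)g(x)$, for a family $V=(V_x)_x$ of functions on $\Lambda_\epsilon$, $[V]_{G^\gamma(\Lambda_\epsilon)}:=\sup_{\varphi\in\mathcal B}\sup_{x\in\Lambda_\epsilon,\lambda\ge\epsilon}\lambda^{-\gamma}|\langle V_x,\varphi^\lambda_x\rangle_\epsilon|$. $\mathcal L_\epsilon U:=(\mathcal L_\epsilon U_x)_x$. *)

(* Defs.v *)
From HB Require Import structures.
From mathcomp Require Import all_boot all_order all_algebra.
From mathcomp Require Import all_classical all_reals all_analysis.
From mathcomp Require Import complex.

Set Implicit Arguments.
Unset Strict Implicit.
Unset Printing Implicit Defensive.

Import Order.TTheory GRing.Theory Num.Theory.
Import numFieldNormedType.Exports.

Local Open Scope ring_scope.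
Local Open Scope classical_set_scope.
Local Open Scope complex_scope.

Section Defs.
Variables (R : realType) (d : nat) (s : 'I_d -> nat).

Definition wt (b : 'I_d -> nat) : nat := (\sum_(i < d) s i * b i)%N.

Definition ssum : nat := (\sum_(i < d) s i)%N.

(* points of Lambda_eps are encoded by k in Z^d, position (eps^{s_i} k_i)_i *)
Definition pt := {ffun 'I_d -> int}.

Definition pos (eps : R) (k : pt) : 'I_d -> R :=
  fun i => eps ^+ s i * (k i)%:~R.

Definition sdist (x y : 'I_d -> R) : R :=
  \sum_(i < d) powR `|x i - y i| ((s i)%:R)^-1.

Definition ldist (eps : R) (k l : pt) : R := sdist (pos eps k) (pos eps l).

(* k + n e_j (in lattice coordinates, i.e. the point + n eps^{s_j} e_j) *)
Definition shift (k : pt) (j : 'I_d) (n : int) : pt :=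
  [ffun i => k i + (if i == j then n else 0)].

Definition fwd (eps : R) (j : 'I_d) (u : pt -> R[i]) : pt -> R[i] :=
  fun k => ((eps ^+ s j)^-1)%:C * (u (shift k j 1) - u k).

Definition bwd (eps : R) (j : 'I_d) (u : pt -> R[i]) : pt -> R[i] :=
  fun k => ((eps ^+ s j)^-1)%:C * (u k - u (shift k j (-1))).

Definition Dmulti (op : 'I_d -> (pt -> R[i]) -> (pt -> R[i]))
  (g : 'I_d -> nat) (u : pt -> R[i]) : pt -> R[i] :=
  foldr (fun j v => iter (g j) (op j) v) u (enum 'I_d).

Definition mi (m : nat) (g : {ffun 'I_d -> 'I_m.+1}) : 'I_d -> nat :=
  fun i => nat_of_ord (g i).

(* L_eps u = sum_{|gamma|+|delta| = m} a_{gamma,delta} D^gamma Dbar^delta u.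
   Since s_i >= 1, every multi-index with |gamma| <= m has entries <= m,
   so enumerating {ffun 'I_d -> 'I_m.+1} covers all of them exactly once. *)
Definition Lop (a : ('I_d -> nat) -> ('I_d -> nat) -> R[i]) (m : nat) (eps : R)
  (u : pt -> R[i]) : pt -> R[i] :=
  fun k => \sum_(g : {ffun 'I_d -> 'I_m.+1})
             \sum_(h : {ffun 'I_d -> 'I_m.+1} | (wt (mi g) + wt (mi h) == m)%N)
               a (mi g) (mi h) * Dmulti (fwd eps) (mi g) (Dmulti (bwd eps) (mi h) u) k.

Definition expi (t : R) : R[i] := (cos t +i* sin t)%C.

Definition xi (eps : R) (th : 'I_d -> R) (j : 'I_d) : R[i] :=
  'i%C * ((eps ^+ s j)^-1)%:C * (1 - expi (eps ^+ s j * th j)).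

Definition cpow (z : 'I_d -> R[i]) (g : 'I_d -> nat) : R[i] :=
  \prod_(j < d) z j ^+ g j.

Definition disc_symbol (a : ('I_d -> nat) -> ('I_d -> nat) -> R[i]) (m : nat)
  (eps : R) (th : 'I_d -> R) : R[i] :=
  \sum_(g : {ffun 'I_d -> 'I_m.+1})
    \sum_(h : {ffun 'I_d -> 'I_m.+1} | (wt (mi g) + wt (mi h) == m)%N)
      a (mi g) (mi h) * cpow (fun j => 'i%C * xi eps th j) (mi g)
                      * cpow (fun j => 'i%C * (xi eps th j)^*%C) (mi h).

Definition cont_symbol (a : ('I_d -> nat) -> ('I_d -> nat) -> R[i]) (m : nat)
  (xv : 'I_d -> R) : R[i] :=
  \sum_(g : {ffun 'I_d -> 'I_m.+1})
    \sum_(h : {ffun 'I_d -> 'I_m.+1} | (wt (mi g) + wt (mi h) == m)%N)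
      a (mi g) (mi h) * cpow (fun j => 'i%C * (xv j)%:C) (fun j => mi g j + mi h j)%N.

(* theta is nonzero in the torus prod_j R/(2 pi eps^{-s_j} Z) *)
Definition torus_nonzero (eps : R) (th : 'I_d -> R) : Prop :=
  ~ (forall j, exists n : int, th j = 2 * pi * n%:~R * (eps ^+ s j)^-1).

Definition discretely_elliptic (a : ('I_d -> nat) -> ('I_d -> nat) -> R[i])
  (m : nat) (eps : R) : Prop :=
  (forall th, torus_nonzero eps th -> disc_symbol a m eps th != 0) /\
  (forall xv : 'I_d -> R, (exists j, xv j != 0) -> cont_symbol a m xv != 0).

(* germs over Lambda_eps: U x = U_x *)
Definition germ := pt -> pt -> R[i].

Definition Lgerm (a : ('I_d -> nat) -> ('I_d -> nat) -> R[i]) (m : nat) (eps : R)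
  (U : germ) : germ := fun x => Lop a m eps (U x).

Definition Gnorm (eps eta : R) (U : germ) : \bar R :=
  ereal_inf ((fun M : R => M%:E) @`
    [set M : R | 0 < M /\ forall x y : pt,
       Normc.normc (U x y) <= M * powR (ldist eps x y) eta]).

(* P is in P_k: P(z) = sum_{|beta| <= k} c_beta z^beta (entries beta_i <= k
   automatically since s_i >= 1) *)
Definition is_poly (k : nat) (P : ('I_d -> R) -> R[i]) : Prop :=
  exists c : {ffun 'I_d -> 'I_k.+1} -> R[i], forall z : 'I_d -> R,
    P z = \sum_(b : {ffun 'I_d -> 'I_k.+1} | (wt (mi b) <= k)%N)
            c b * (\prod_(i < d) z i ^+ mi b i)%:C.

Definition holder (eps eta alpha : R) (U : germ) : \bar R :=
  ereal_inf ((fun M : R => M%:E) @`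
    [set M : R | 0 < M /\ forall x y : pt, exists P, is_poly (Num.truncn eta) P /\
       forall z : pt, Normc.normc (U x z - U y z - P (pos eps z))
          <= M * powR (ldist eps y z) alpha
               * powR (ldist eps x y + ldist eps y z) (eta - alpha)]).

Definition centered (eps eta : R) (U : germ) : Prop :=
  forall (x : pt) (g : 'I_d -> nat), (wt g)%:R <= eta -> Dmulti (fwd eps) g (U x) x = 0.

Definition partial (j : 'I_d) (f : 'rV[R]_d -> R) : 'rV[R]_d -> R :=
  fun x => derive f x (delta_mx 0 j).

Definition iterp (js : seq 'I_d) (f : 'rV[R]_d -> R) := foldr partial f js.

Definition smooth (f : 'rV[R]_d -> R) : Prop :=
  forall (js : seq 'I_d) (x : 'rV[R]_d), differentiable (iterp js f) x.

Definition multipartial (b : 'I_d -> nat) (f : 'rV[R]_d -> R) : 'rV[R]_d -> R :=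
  foldr (fun j g => iter (b j) (partial j) g) f (enum 'I_d).

Definition rowfun (y : 'rV[R]_d) : 'I_d -> R := fun i => y 0 i.

Definition testB (k : nat) (phi : 'rV[R]_d -> R) : Prop :=
  smooth phi /\
  (exists r : R, r < 1 /\ forall y, r <= sdist (rowfun y) (fun _ => 0) -> phi y = 0) /\
  (forall b : 'I_d -> nat, (wt b <= k)%N -> forall y, `|multipartial b phi y| <= 1).

Definition rescaled (phi : 'rV[R]_d -> R) (lam : R) (x : 'I_d -> R)
  (y : 'I_d -> R) : R :=
  (lam ^+ ssum)^-1 * phi (\row_i ((lam ^+ s i)^-1 * (y i - x i))).

(* <f, g>_eps = eps^{sum s} sum_{y in Lambda_eps} f(y) g(y)
   (finitely supported sum; g below is always compactly supported) *)
Definition pairing (eps : R) (f : pt -> R[i]) (g : ('I_d -> R) -> R) : R[i] :=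
  ((eps ^+ ssum)%:C * \sum_(y \in [set: pt]) (f y * (g (pos eps y))%:C))%R.

Definition negnorm (eps gam : R) (V : germ) : \bar R :=
  ereal_sup ((fun r : R => r%:E) @`
    [set r : R | exists phi (x : pt) (lam : R),
       testB `|Num.ceil `|gam| |%N phi /\ eps <= lam /\
       r = powR lam (- gam) * Normc.normc (pairing eps (V x) (rescaled phi lam (pos eps x)))]).

End Defs.

(* Main.v *)
(* Rescaling turns eps into 1, so everything happens on Z^d. Let u = U_x, let N be
   the best constant in |u(y)| <= N d(x,y)^eta, and fix y at distance r from x.
   Let g = 1 - L^*L / Lam, with symbol in [1/2, 1]. By ellipticity 1 - g dominates
   the 2m-th power of the anisotropic size of the frequency, so the discrete heat
   kernel g^n regularises at scale H = (n+1)^(1/2m): differences of order w of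
   g^n f gain a factor H^-w. The identity
     f = g^n f + (\sum_(l < n) g^l L^* / Lam) L f
   is applied to f = A u, where A averages at scale h = kappa r and reproduces
   polynomials of degree <= eta. The error u - A u is bounded at y by
   kappa^eta N r^eta plus the three-point seminorm. The second summand depends on
   L u only and is bounded by testing. The first one is expanded around x: for
   H >= r / kappa its differences of order > eta are small multiples of N, and so
   are those of order <= eta at x, because up to terms in L u they can be computed
   at scale h instead of H (at h = 1 they vanish by centering). For small kappa
   all multiples of N add up to N / 2, which is absorbed since N is finite. *)

Require Import Defs.
From HB Require Import structures.
From mathcomp Require Import all_boot all_order all_algebra.
From mathcomp Require Import all_classical all_reals all_analysis.
From mathcomp Require Import complex.
From mathcomp Require Import ring lra zify.

Import Order.TTheory GRing.Theory Num.Theory.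
Import numFieldNormedType.Exports.
Local Open Scope ring_scope.
Set Implicit Arguments.
Unset Strict Implicit.
Unset Printing Implicit Defensive.

(** The seminorm of L U sees L u only through test functions centred at x. At another point z it
    controls L u only after averaging at some scale h, by reading this average as a test function
    centred at x of scale lam about rho z + h, at the cost of a fixed power of lam / h. This is why
    the averaging A precedes the heat flow, and why h, r and H are kept comparable: the cost is then
    a constant depending on kappa times a polynomial in the distance, which the decay of the kernel
    absorbs. The order of choices matters: the constants in front of N do not depend on kappa, those
    in front of L u do, so kappa is fixed by the former. Kernel bounds are read off the symbol: its
    theta-derivatives are moments of the kernel, and integrals over the torus become exact averages
    over a finite grid because all kernels have finite support. Since eta is not an integer, eta -
    floor eta and floor eta + 1 - eta are positive; these are the exponents of kappa that make the
    multiples of N small. *)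

Notation nrm := Normc.normc.

(** * Complex modulus and trigonometric polynomials *)

Section ComplexModulus.
Variable R : realType.
Implicit Types x y z : R[i].

Lemma nrmE z : `|z| = (nrm z)%:C%C.
Proof. by rewrite normc_def; case: z. Qed.

Lemma nrm_ge0 z : 0 <= nrm z.
Proof. by case: z => a b /=; rewrite sqrtr_ge0. Qed.

Lemma nrmD x y : nrm (x + y) <= nrm x + nrm y.
Proof. exact: le_normcD. Qed.

Lemma nrmB x y : nrm (x - y) <= nrm x + nrm y.
Proof. by apply: le_trans (nrmD _ _) _; rewrite normcN. Qed.

Lemma nrm_real (t : R) : nrm t%:C%C = `|t|.
Proof. by rewrite /= expr0n /= addr0 sqrtr_sqr. Qed.

Lemma nrm_int (n : int) : nrm (n%:~R : R[i]) = `|n%:~R|.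
Proof. by rewrite -(rmorph_int (real_complex R)) nrm_real. Qed.

Lemma nrmX z n : nrm (z ^+ n) = nrm z ^+ n.
Proof.
elim: n => [|n IH]; first by rewrite !expr0 Normc.normc1.
by rewrite !exprS Normc.normcM IH.
Qed.

Lemma nrm_sum I (r : seq I) (P : pred I) (F : I -> R[i]) :
  nrm (\sum_(i <- r | P i) F i) <= \sum_(i <- r | P i) nrm (F i).
Proof.
elim/big_rec2: _ => [|i y1 y2 _ H]; first by rewrite Normc.normc0.
by apply: le_trans (nrmD _ _) _; rewrite lerD2l.
Qed.

Lemma sqr_nrm z : nrm z ^+ 2 = complex.Re z ^+ 2 + complex.Im z ^+ 2.
Proof. by case: z => a b /=; rewrite sqr_sqrtr // addr_ge0 ?sqr_ge0. Qed.

Lemma mulJ_nrm z : z * z^*%C = (nrm z ^+ 2)%:C%C.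
Proof. by rewrite -sqr_normc nrmE rmorphXn. Qed.

Lemma expiD (a b : R) : expi (a + b) = expi a * expi b.
Proof. by rewrite /expi cosD sinD; congr Complex; ring. Qed.

Lemma expi0 : expi (0 : R) = 1.
Proof. by rewrite /expi cos0 sin0. Qed.

Lemma nrm_expi (t : R) : nrm (expi t) = 1.
Proof. by rewrite /= cos2Dsin2 sqrtr1. Qed.

Lemma conj_expi (t : R) : (expi t)^*%C = expi (- t).
Proof. by rewrite /expi cosN sinN. Qed.

Lemma expi_sum I (r : seq I) (P : pred I) (F : I -> R) :
  expi (\sum_(i <- r | P i) F i) = \prod_(i <- r | P i) expi (F i).
Proof.
elim/big_rec2: _ => [|i y1 y2 _ H]; first exact: expi0.
by rewrite expiD H.
Qed.

Lemma expi_natmul (t : R) n : expi (t *+ n) = expi t ^+ n.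
Proof.
by elim: n => [|n IH]; rewrite ?mulr0n ?expi0 // mulrS expiD IH exprS.
Qed.

Lemma expi2pi : expi (2 * pi : R) = 1.
Proof. by rewrite mulr_natl /expi cos2pi sin2pi. Qed.

Lemma expi_int2pi (n : int) : expi (2 * pi * n%:~R : R) = 1.
Proof.
have H k : expi (2 * pi * k%:R : R) = 1.
  by rewrite mulr_natr expi_natmul expi2pi expr1n.
case: n => k; first exact: H.
by rewrite NegzE mulrNz mulrN -conj_expi H conjc1.
Qed.

End ComplexModulus.

Arguments Normc.normc : simpl never.

(* A finite list of pairs (c, k) stands for the trigonometric polynomial
   \sum c e^{i k.theta}, and for the operator u |-> \sum c u(. + k). *)
Section TrigPoly.
Variables (R : realType) (d : nat).
Local Notation Zd := {ffun 'I_d -> int}.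
Local Notation tp := (seq (R[i] * Zd)).
Implicit Types (p q r : tp) (f u v : Zd -> R[i]).

Definition lin p f : R[i] := \sum_(x <- p) x.1 * f x.2.
Definition act p u : Zd -> R[i] := fun y => lin p (fun k => u (y + k)).
(** Lists that differ by order or by repeated exponents represent the same polynomial; testing
    against all [f] identifies them. *)
Definition eqv p q := forall f, lin p f = lin q f.
Definition tmul p q : tp := [seq (x.1 * y.1, x.2 + y.2) | x <- p, y <- q].
Definition tpow p n : tp := iter n (tmul p) [:: (1, 0)].
Definition tscale (c : R[i]) p : tp := [seq (c * x.1, x.2) | x <- p].
(** The theta_j-derivative of the symbol, up to the factor i. *)
Definition tder (j : 'I_d) p : tp := [seq (x.1 * (x.2 j)%:~R, x.2) | x : R[i] * Zd <- p].
Definition tconj p : tp := [seq (x.1^*%C, - x.2) | x <- p].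
Definition coef p (k : Zd) : R[i] := lin p (fun l => (l == k)%:R).
Definition char (th : 'I_d -> R) (k : Zd) : R[i] :=
  expi (\sum_j (k j)%:~R * th j).
Definition ev p th := lin p (char th).

Lemma eq_lin p f g : f =1 g -> lin p f = lin p g.
Proof. by move=> E; apply: eq_bigr => x _; rewrite E. Qed.

Lemma lin_nil f : lin [::] f = 0. Proof. exact: big_nil. Qed.

Lemma lin1 c k f : lin [:: (c, k)] f = c * f k.
Proof. exact: big_seq1. Qed.

Lemma lin_cat p q f : lin (p ++ q) f = lin p f + lin q f.
Proof. exact: big_cat. Qed.

Lemma lin_scale c p f : lin (tscale c p) f = c * lin p f.
Proof. by rewrite /lin big_map mulr_sumr; apply: eq_bigr => x _; rewrite mulrA. Qed.

Lemma lin_mul p q f : lin (tmul p q) f = lin p (fun k => lin q (fun l => f (k + l))).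
Proof.
rewrite /lin big_allpairs_dep; apply: eq_bigr => x _.
by rewrite mulr_sumr; apply: eq_bigr => y _; rewrite mulrA.
Qed.

Lemma lin_der j p f : lin (tder j p) f = lin p (fun k => (k j)%:~R * f k).
Proof. by rewrite /lin big_map; apply: eq_bigr => x _; rewrite mulrA. Qed.

Lemma lin_conj p f : lin (tconj p) f = (lin p (fun k => (f (- k))^*%C))^*%C.
Proof.
rewrite /lin big_map raddf_sum; apply: eq_bigr => x _.
by rewrite /= [RHS]rmorphM /= conjcK.
Qed.

Lemma lin_addf p f g : lin p (fun k => f k + g k) = lin p f + lin p g.
Proof. by rewrite /lin -big_split; apply: eq_bigr => x _; rewrite mulrDr. Qed.

Lemma lin_mulf p c f : lin p (fun k => c * f k) = c * lin p f.
Proof. by rewrite /lin mulr_sumr; apply: eq_bigr => x _; rewrite mulrCA. Qed.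

Lemma lin_mulfr p c f : lin p (fun k => f k * c) = lin p f * c.
Proof. by rewrite /lin mulr_suml; apply: eq_bigr => x _; rewrite mulrA. Qed.

Lemma lin_exch p q (F : Zd -> Zd -> R[i]) :
  lin p (fun k => lin q (F k)) = lin q (fun l => lin p (F^~ l)).
Proof.
rewrite /lin; under eq_bigr do rewrite mulr_sumr.
rewrite exchange_big; apply: eq_bigr => y _; rewrite mulr_sumr.
by apply: eq_bigr => x _; rewrite mulrCA.
Qed.

Lemma lin_sumf p I (r : seq I) (F : I -> Zd -> R[i]) :
  lin p (fun k => \sum_(i <- r) F i k) = \sum_(i <- r) lin p (F i).
Proof.
by rewrite /lin exchange_big /=; apply: eq_bigr => x _; rewrite mulr_sumr.
Qed.

Lemma eqv_sym p q : eqv p q -> eqv q p.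
Proof. by move=> E f; rewrite E. Qed.

Lemma eqv_trans q p r : eqv p q -> eqv q r -> eqv p r.
Proof. by move=> E F f; rewrite E F. Qed.

Lemma tmulC p q : eqv (tmul p q) (tmul q p).
Proof.
move=> f; rewrite !lin_mul lin_exch.
by apply: eq_lin => k; apply: eq_lin => l; rewrite addrC.
Qed.

Lemma tmulA p q r : eqv (tmul p (tmul q r)) (tmul (tmul p q) r).
Proof.
move=> f; rewrite !lin_mul; apply: eq_lin => k; rewrite lin_mul.
by apply: eq_lin => l; apply: eq_lin => n; rewrite addrA.
Qed.

Lemma eqv_mul p p' q q' : eqv p p' -> eqv q q' -> eqv (tmul p q) (tmul p' q').
Proof.
by move=> E F f; rewrite !lin_mul E; apply: eq_lin => k; exact: F.
Qed.

Lemma eqv_cat p p' q q' : eqv p p' -> eqv q q' -> eqv (p ++ q) (p' ++ q').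
Proof. by move=> E F f; rewrite !lin_cat E F. Qed.

Lemma eqv_der j p p' : eqv p p' -> eqv (tder j p) (tder j p').
Proof. by move=> E f; rewrite !lin_der E. Qed.

Lemma tmul1 p : eqv (tmul p [:: (1, 0)]) p.
Proof.
by move=> f; rewrite lin_mul; apply: eq_lin => k; rewrite lin1 mul1r addr0.
Qed.

Lemma tder_mul j p q :
  eqv (tder j (tmul p q)) (tmul (tder j p) q ++ tmul p (tder j q)).
Proof.
move=> f; rewrite lin_der lin_cat !lin_mul lin_der -lin_addf; apply: eq_lin => k.
rewrite lin_der -lin_mulf -lin_addf; apply: eq_lin => l.
by rewrite ffunE intrD mulrDl.
Qed.

Lemma tder_pow j p n :
  eqv (tder j (tpow p n.+1)) (tscale n.+1%:R (tmul (tder j p) (tpow p n))).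
Proof.
elim: n => [|n IH] f.
  rewrite lin_scale mul1r tder_mul lin_cat addrC !lin_mul.
  rewrite [X in X + _](eq_lin _ (g := fun=> 0)) ?add0r // => [|k].
    by rewrite [X in X + _]big1 ?add0r // => x _; rewrite mulr0.
  by rewrite lin1 ffunE mulr0 mul0r.
rewrite -[tpow p n.+2]/(tmul p (tpow p n.+1)) tder_mul lin_cat lin_scale.
have -> : lin (tmul p (tder j (tpow p n.+1))) f
    = n.+1%:R * lin (tmul (tder j p) (tpow p n.+1)) f.
  rewrite (eqv_mul (fun=> erefl) IH) lin_mul.
  under eq_lin => k do rewrite lin_scale.
  rewrite lin_mulf -lin_mul; congr (_ * _).
  by rewrite tmulA (eqv_mul (tmulC _ _) (fun=> erefl)) -tmulA.
by rewrite [n.+2%:R]mulrS mulrDl mul1r.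
Qed.

Lemma act_mul p q u : act (tmul p q) u =1 act p (act q u).
Proof.
move=> y; rewrite /act lin_mul; apply: eq_lin => k.
by apply: eq_lin => l; rewrite addrA.
Qed.

Lemma act_mulC p q u : act p (act q u) =1 act q (act p u).
Proof. by move=> y; rewrite -!act_mul /act tmulC. Qed.

Lemma eq_act p u v : u =1 v -> act p u =1 act p v.
Proof. by move=> E y; apply: eq_lin => k; exact: E. Qed.

Lemma act_addf p u v : act p (fun y => u y + v y) =1 (fun y => act p u y + act p v y).
Proof. by move=> y; rewrite /act lin_addf. Qed.

Lemma act_mulf p c u : act p (fun y => c * u y) =1 (fun y => c * act p u y).
Proof. by move=> y; rewrite /act lin_mulf. Qed.

Lemma char_add th k l : char th (k + l) = char th k * char th l.
Proof.
rewrite /char -expiD -big_split; congr expi; apply: eq_bigr => j _.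
by rewrite ffunE intrD mulrDl.
Qed.

Lemma char_opp th k : char th (- k) = (char th k)^*%C.
Proof.
rewrite /char conj_expi -sumrN; congr expi; apply: eq_bigr => j _.
by rewrite ffunE mulrNz mulNr.
Qed.

Lemma nrm_char th k : nrm (char th k) = 1.
Proof. exact: nrm_expi. Qed.

Lemma ev_mul p q th : ev (tmul p q) th = ev p th * ev q th.
Proof.
rewrite /ev lin_mul -lin_mulfr; apply: eq_lin => k; rewrite -lin_mulf.
by apply: eq_lin => l; rewrite char_add.
Qed.

Lemma ev_pow p n th : ev (tpow p n) th = ev p th ^+ n.
Proof.
elim: n => [|n IH].
  rewrite /ev lin1 mul1r expr0 /char big1 ?expi0 // => j _.
  by rewrite ffunE mul0r.
by rewrite exprS -IH -ev_mul.
Qed.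

Lemma ev_conj p th : ev (tconj p) th = (ev p th)^*%C.
Proof.
by rewrite /ev lin_conj; congr (_^*%C); apply: eq_lin => k; rewrite char_opp conjcK.
Qed.

Definition l1 p : R := \sum_(x <- p) nrm x.1.

Lemma l1_ge0 p : 0 <= l1 p.
Proof. by apply: sumr_ge0 => x _; exact: nrm_ge0. Qed.

Lemma nrm_lin p f (X : R) : (forall x, x \in p -> nrm (f x.2) <= X) ->
  nrm (lin p f) <= l1 p * X.
Proof.
move=> H; apply: le_trans (nrm_sum _ _ _) _; rewrite mulr_suml.
rewrite big_seq [leRHS]big_seq; apply: ler_sum => x px.
by rewrite Normc.normcM ler_wpM2l ?nrm_ge0 // H.
Qed.

Lemma nrm_ev p th : nrm (ev p th) <= l1 p.
Proof.
by rewrite -[leRHS]mulr1; apply: nrm_lin => x _; rewrite nrm_char.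
Qed.

End TrigPoly.

(** * Fourier inversion on a finite grid *)

Section Grid.
Variable R : realType.

(** The half-angle formula gives cos >= 1/2 on [0, 1], hence sin t >= t / 2 there by the mean value
    theorem; beyond 1 monotonicity suffices, as x < 2. *)
Lemma sin_ge_quarter (x : R) : 0 <= x -> x <= pi / 2 -> x / 4 <= sin x.
Proof.
move=> x0 xp.
have p2 : pi / 2 < 2 :> R by exact: pihalf_lt2.
have p1 : 1 <= pi / 2 :> R by exact: pihalf_ge1.
have cosge (t : R) : 0 <= t -> t <= 1 -> 1 / 2 <= cos t.
  move=> t0 t1.
  have s0 : `|sin (t / 2)| <= t / 2.
    have [->|tn] := eqVneq t 0; first by rewrite mul0r sin0 normr0.
    have tp : 0 < t / 2 by rewrite divr_gt0 // lt_def tn.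
    have D y : y \in `]0, (t / 2)[ -> is_derive y 1 (@sin R) (cos y).
      by move=> _; exact: is_derive_sin.
    have Cc : ({within `[0, (t / 2)], continuous (@sin R)})%classic.
      by apply: continuous_subspaceT; exact: continuous_sin.
    have [c _] := MVT tp D Cc.
    rewrite sin0 !subr0 => ->; rewrite normrM [`|t / 2|]gtr0_norm //.
    by rewrite ler_piMl ?cos_max // ltW.
  have -> : t = (t / 2) *+ 2 by rewrite -mulr_natr; field.
  rewrite cos_mulr2n cos2sin2.
  have : `|sin (t / 2)| ^+ 2 <= (t / 2) ^+ 2.
    by rewrite ler_pXn2r // nnegrE ?divr_ge0.
  rewrite real_normK ?num_real //; nra.
have singe (t : R) : 0 <= t -> t <= 1 -> t / 2 <= sin t.
  move=> t0 t1.
  have [->|tn] := eqVneq t 0; first by rewrite mul0r sin0.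
  have tp : 0 < t by rewrite lt_def tn.
  have D y : y \in `]0, t[ -> is_derive y 1 (@sin R) (cos y).
    by move=> _; exact: is_derive_sin.
  have Cc : ({within `[0, t], continuous (@sin R)})%classic.
    by apply: continuous_subspaceT; exact: continuous_sin.
  have [c] := MVT tp D Cc.
  rewrite in_itv /= => /andP[c0 c1]; rewrite sin0 !subr0 => ->.
  rewrite mulrC ler_pM2r //.
  have := cosge c (ltW c0) (le_trans (ltW c1) t1); lra.
have [x1|x1] := leP x 1.
  by have := singe x x0 x1; lra.
have : sin 1 <= sin x.
  rewrite le_eqVlt; have [->|n1] := eqVneq 1 x; first by rewrite eqxx.
  by apply/orP; right; rewrite ltr_sin // in_itv /=; lra.
have := singe 1 ler01 (lexx 1); lra.
Qed.

Lemma nrm_expi2B1 (x : R) : nrm (expi (x *+ 2) - 1) = 2 * `|sin x|.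
Proof.
rewrite -[RHS]ger0_norm ?mulr_ge0 // -sqrtr_sqr /expi /= cos_mulr2n sin_mulr2n.
congr Num.sqrt; rewrite exprMn -(normrX 2) ger0_norm ?sqr_ge0 //.
rewrite subr0 -(mulr_natr (cos x ^+ 2)) -(mulr_natr (cos x * sin x)).
have -> : cos x ^+ 2 * 2 - 1 - 1 = - 2 * sin x ^+ 2 by have := cos2Dsin2 x; lra.
rewrite -[RHS]mulr1 -(cos2Dsin2 x); ring.
Qed.

Lemma expi_neq1 (x : R) : 0 < `|x| < pi -> expi (x *+ 2) != 1.
Proof.
move=> /andP[x0 xpi]; apply/eqP => E.
have := nrm_expi2B1 x; rewrite E subrr Normc.normc0 => /esym/eqP.
rewrite mulf_eq0 pnatr_eq0 /= normr_eq0 => /eqP s0.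
suff : sin `|x| = 0 by move=> s1; have := sin_gt0_pi; move/(_ R `|x|); rewrite s1 x0 xpi ltxx => /(_ isT).
by have [_|_] := ger0P x; rewrite ?sinN s0 ?oppr0.
Qed.

Lemma sum_inv_sqr (c : R) n : 0 < c -> c <= 1 ->
  \sum_(0 <= t < n) (1 + c * t%:R) ^- 2 <= 2 / c.
Proof.
move=> c0 c1.
have P t : 0 < 1 + c * t%:R by rewrite ltr_pwDl // mulr_ge0 // ltW.
(* The subtracted term makes the induction close: it telescopes like the integral of (1 + c
   t)^-2. *)
have H k : \sum_(0 <= t < k.+1) (1 + c * t%:R) ^- 2 <= 1 + c^-1 - c^-1 / (1 + c * k%:R).
  elim: k => [|k IH].
    by rewrite big_nat1 mulr0 addr0 expr1n invr1 mulr1 addrK.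
  rewrite big_nat_recr //=; apply: le_trans (lerD IH (lexx _)) _.
  have -> : 1 + c * k.+1%:R = 1 + c * k%:R + c by rewrite -natr1; ring.
  set a := 1 + c * k%:R; have a0 : 0 < a by exact: P.
  have ac0 : 0 < a + c by rewrite addr_gt0.
  rewrite -subr_ge0.
  have -> : 1 + c^-1 - c^-1 / (a + c) - (1 + c^-1 - c^-1 / a + (a + c) ^- 2)
     = c / (a * (a + c) ^+ 2).
    by field; rewrite ?gt_eqF.
  by rewrite divr_ge0 ?mulr_ge0 ?sqr_ge0 // ltW.
case: n => [|n]; first by rewrite big_geq // divr_ge0 ?(ltW c0).
apply: le_trans (H n) _.
have : 0 <= c^-1 / (1 + c * n%:R) by rewrite divr_ge0 ?invr_ge0 ?(ltW c0) ?(ltW (P n)).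
have : 1 <= c^-1 by rewrite invf_ge1.
lra.
Qed.

(** A Riemann sum of (1 + b |theta|)^-2 over the circle. The angle of index t is at distance
    comparable to min(t, M - t) / M from 0, so each term is dominated by one of two inverse squares;
    b <= M says that the grid resolves the scale 1 / b. *)
Lemma grid_sum1 (b : R) (M : nat) : 1 <= b -> b <= M%:R ->
  \sum_(t < M) (1 + b * nrm (expi (2 * pi * t%:R / M%:R) - 1)) ^- 2 <= 4 / b * M%:R.
Proof.
move=> b1 bM.
have M0 : 0 < M%:R :> R by apply: lt_le_trans bM; apply: lt_le_trans b1.
have b0 : 0 < b by apply: lt_le_trans b1.
pose c := b / M%:R.
have c0 : 0 < c by rewrite divr_gt0.
have c1 : c <= 1 by rewrite ler_pdivrMr // mul1r.
pose f (t : nat) := (1 + c * t%:R) ^- 2.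
have f0 t : 0 <= f t by rewrite invr_ge0 sqr_ge0.
have P (t : nat) : 0 < 1 + c * t%:R by rewrite ltr_pwDl // mulr_ge0 // ltW.
have key (t : 'I_M) :
    (1 + b * nrm (expi (2 * pi * t%:R / M%:R) - 1)) ^- 2 <= f t + f (M - t)%N.
  have comp (k : nat) (S : R) : k%:R / M%:R <= S -> (1 + b * S) ^- 2 <= f k.
    move=> kS; rewrite /f lef_pV2 ?posrE ?exprn_gt0 //; last first.
      by rewrite ltr_pwDl // mulr_ge0 ?(ltW b0) // (le_trans _ kS) // divr_ge0 // ltW.
    have le : 1 + c * k%:R <= 1 + b * S.
      by rewrite lerD2l /c -mulrA [_^-1 * _]mulrC ler_pM2l.
    by rewrite ler_pXn2r // nnegrE ltW // (lt_le_trans (P k)).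
  have -> : 2 * pi * t%:R / M%:R = (pi * t%:R / M%:R : R) *+ 2 by rewrite -mulr_natr; ring.
  rewrite nrm_expi2B1; set x := pi * t%:R / M%:R.
  have tM : t%:R / M%:R < 1 :> R by rewrite ltr_pdivrMr // mul1r ltr_nat.
  have t0 : 0 <= t%:R / M%:R :> R by rewrite divr_ge0 // ltW.
  have xE : x = pi * (t%:R / M%:R) by rewrite /x mulrA.
  have pi2 : 2 <= pi :> R by exact: pi_ge2.
  have x0 : 0 <= x by rewrite xE mulr_ge0 // pi_ge0.
  have [xh|xh] := leP x (pi / 2).
    apply: le_trans (comp t _ _) _; last by rewrite lerDl.
    have := sin_ge_quarter x0 xh => sx.
    rewrite ger0_norm; last by apply: le_trans sx; rewrite divr_ge0.
    by move: sx; rewrite xE => sx; nra.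
  apply: le_trans (comp (M - t)%N _ _) _; last by rewrite lerDr.
  have xpi : x <= pi by rewrite xE ler_piMr ?pi_ge0 // ltW.
  have sx : (pi - x) / 4 <= sin x.
    have -> : sin x = sin (pi - x) by rewrite sinB sinpi cospi mul0r mulN1r sub0r opprK.
    by apply: sin_ge_quarter; lra.
  rewrite ger0_norm; last by apply: le_trans sx; rewrite divr_ge0 // subr_ge0.
  rewrite natrB 1?ltnW // mulrBl divff ?gt_eqF //.
  by move: sx; rewrite xE => sx; nra.
apply: le_trans (ler_sum _ (fun t _ => key t)) _; rewrite big_split /=.
have E : \sum_(t < M) f (M - t)%N <= \sum_(0 <= t < M.+1) f t.
  rewrite -(big_mkord xpredT (fun t => f (M - t)%N)) big_nat_rev /= add0n.
  rewrite big_nat_recl // -[leLHS]add0r lerD ?f0 //.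
  rewrite big_nat [leRHS]big_nat; apply: ler_sum => t /andP[_ tM].
  by rewrite subKn.
have -> : 4 / b * M%:R = 2 / c + 2 / c.
  by rewrite /c; field; rewrite ?gt_eqF.
apply: lerD; last by apply: le_trans E _; exact: sum_inv_sqr.
by rewrite -(big_mkord xpredT f); exact: sum_inv_sqr.
Qed.

End Grid.

Section GridFourier.
Variables (R : realType) (d : nat).
Local Notation Zd := {ffun 'I_d -> int}.
Local Notation tp := (seq (R[i] * Zd)).
Implicit Types (p : tp) (f : Zd -> R[i]).

Definition bx B (t : {ffun 'I_d -> 'I_(B.*2.+1)}) : Zd := [ffun j => (t j)%:Z - B%:Z].

Definition inbox (B : nat) (k : Zd) := [forall j, (`|k j| <= B)%N].

Definition supp B p := all (fun x => inbox B x.2) p.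

Lemma inboxP B k : inbox B k -> exists t : {ffun 'I_d -> 'I_(B.*2.+1)}, k = bx t.
Proof.
move=> /forallP kB; exists [ffun j => inord (absz (k j + B%:Z))].
apply/ffunP => j; have kj := kB j; rewrite !ffunE inordK ?gez0_abs ?addrK //; lia.
Qed.

Lemma bx_inj B : injective (@bx B).
Proof.
move=> t t' /ffunP E; apply/ffunP => j; apply/val_inj => /=.
by have := E j; rewrite !ffunE; lia.
Qed.

Lemma suppW B B' p : (B <= B')%N -> supp B p -> supp B' p.
Proof.
move=> BB; apply: sub_all => x /forallP H; apply/forallP => j.
exact: leq_trans (H j) BB.
Qed.

Lemma supp_ex p : exists B, supp B p.
Proof.
elim: p => [|x p [B HB]]; first by exists 0%N.
exists (maxn B (\max_j `|x.2 j|%N)) => /=; apply/andP; split.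
  by apply/forallP => j; rewrite leq_max (leq_bigmax (F := fun j => `|x.2 j|%N)) orbT.
by apply: suppW HB; rewrite leq_maxl.
Qed.

(** A list may repeat an exponent; [coef] collects the repetitions, which lets the sum run over the
    box. *)
Lemma lin_box B p f : supp B p ->
  lin p f = \sum_(t : {ffun 'I_d -> 'I_(B.*2.+1)}) coef p (bx t) * f (bx t).
Proof.
move=> /allP H.
under [RHS]eq_bigr do rewrite /coef /lin mulr_suml.
rewrite exchange_big /= /lin big_seq [RHS]big_seq; apply: eq_bigr => x px.
have [t E] := inboxP (H x px).
rewrite (bigD1 t) //= big1 => [|t' tt'].
  by rewrite addr0 E eqxx mulr1.
by rewrite E (inj_eq (@bx_inj B)) eq_sym (negbTE tt') mulr0 mul0r.
Qed.

Definition grid M (t : {ffun 'I_d -> 'I_M}) : 'I_d -> R := fun j => 2 * pi * (t j)%:R / M%:R.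

Lemma grid_orth M (k : Zd) : (0 < M)%N -> (forall j, (`|k j| < M)%N) ->
  \sum_(t : {ffun 'I_d -> 'I_M}) char (grid t) k = (M ^ d)%:R * (k == 0)%:R.
Proof.
move=> M0 kM.
have M0R : 0 < M%:R :> R by rewrite ltr0n.
have -> : \sum_(t : {ffun 'I_d -> 'I_M}) char (grid t) k
    = \prod_(j < d) \sum_(t < M) expi ((k j)%:~R * (2 * pi * t%:R / M%:R) : R).
  by rewrite bigA_distr_bigA; apply: eq_bigr => t _; rewrite /char expi_sum.
have [->|k0] := eqVneq k 0.
  rewrite mulr1 natrX.
  under eq_bigr => j _ do under eq_bigr => t _ do rewrite ffunE mul0r expi0.
  under eq_bigr => j _ do rewrite sumr_const card_ord.
  by rewrite prodr_const card_ord.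
have [j kj] : exists j, k j != 0.
  apply/existsP; rewrite -negb_forall; apply: contra k0 => /forallP H.
  by apply/eqP/ffunP => j; rewrite ffunE; exact/eqP/H.
rewrite mulr0 (bigD1 j) //=; set S := (X in X * _).
suff -> : S = 0 by rewrite mul0r.
pose z : R[i] := expi (2 * pi * (k j)%:~R / M%:R).
have SE : S = \sum_(t < M) z ^+ t.
  apply: eq_bigr => t _; rewrite -expi_natmul; congr expi.
  by rewrite -mulr_natr; field; rewrite gt_eqF.
have zM : z ^+ M = 1.
  rewrite -expi_natmul -[RHS](expi_int2pi R (k j)); congr expi.
  by rewrite -mulr_natr; field; rewrite gt_eqF.
have zn1 : z - 1 != 0.
  rewrite subr_eq0 /z; have -> : 2 * pi * (k j)%:~R / M%:R = (pi * (k j)%:~R / M%:R : R) *+ 2.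
    by rewrite -mulr_natr; ring.
  apply: expi_neq1; rewrite !normrM normfV [`|pi|]gtr0_norm ?pi_gt0 // [`|M%:R|]gtr0_norm //.
  rewrite divr_gt0 ?mulr_gt0 ?pi_gt0 ?normr_gt0 ?intr_eq0 //=.
  rewrite ltr_pdivrMr // ltr_pM2l ?pi_gt0 //.
  by rewrite -intr_norm -[M%:R](mulrz_nat) ltr_int; have := kM j; lia.
by apply: (mulfI zn1); rewrite SE -subrX1 zM subrr mulr0.
Qed.

(** Exponents in the box differ by at most 2B in each entry, so a grid with more than 2B points per
    direction shows no aliasing and inverts exactly. *)
Lemma coef_grid B M p k : supp B p -> inbox B k -> (B.*2 < M)%N ->
  (M ^ d)%:R * coef p k = \sum_(t : {ffun 'I_d -> 'I_M}) ev p (grid t) * char (grid t) (- k).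
Proof.
move=> /allP H /forallP kB BM.
under eq_bigr do rewrite /ev -lin_mulfr.
rewrite /coef -lin_mulf -lin_sumf /lin big_seq [RHS]big_seq.
apply: eq_bigr => x px; congr (_ * _); have /forallP xB := H x px.
under eq_bigr do rewrite -char_add.
rewrite grid_orth ?subr_eq0 //; first by lia.
move=> j; rewrite !ffunE; apply: leq_ltn_trans (leqD_dist _ 0 _) _.
rewrite subr0 sub0r abszN; apply: leq_ltn_trans (leq_add (xB j) (kB j)) _.
by rewrite addnn.
Qed.

(** The bound of a Fourier coefficient by the L1 norm of the symbol. The grid is chosen fine enough
    for [p] (no aliasing) and for every [b j] (so that [grid_sum1] applies); its cardinality
    cancels. *)
Lemma coef_bound p (b : 'I_d -> R) (X : R) k : 0 <= X -> (forall j, 1 <= b j) ->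
  (forall th, nrm (ev p th) <= X * \prod_j (1 + b j * nrm (expi (th j) - 1)) ^- 2) ->
  nrm (coef p k) <= X * \prod_j (4 / b j).
Proof.
move=> X0 b1 H.
have [B0 HB0] := supp_ex p.
have [B1 HB1] := supp_ex [:: (1 : R[i], k)].
pose B := maxn B0 B1.
have HB : supp B p by apply: suppW HB0; rewrite leq_maxl.
have kB : inbox B k.
  by have := suppW (leq_maxr B0 B1) HB1; rewrite /= andbT.
have [N bN] : exists N : nat, forall j, b j <= N%:R.
  exists (\max_j (Num.truncn (b j)).+1)%N => j.
  apply: le_trans (_ : (Num.truncn (b j)).+1%:R <= _).
    by apply: ltW; exact: truncnS_gt.
  by rewrite ler_nat (leq_bigmax (F := fun j => (Num.truncn (b j)).+1)).
pose M := maxn B.*2.+1 N.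
have BM : (B.*2 < M)%N by rewrite leq_maxl.
have M0 : 0 < M%:R :> R by rewrite ltr0n; apply: leq_trans BM.
have bM j : b j <= M%:R by apply: le_trans (bN j) _; rewrite ler_nat leq_maxr.
have MdR : 0 < (M ^ d)%:R :> R by rewrite natrX exprn_gt0.
rewrite -(ler_pM2l MdR).
have -> : (M ^ d)%:R * nrm (coef p k) = nrm ((M ^ d)%:R * coef p k).
  by rewrite Normc.normcM -(rmorph_nat (real_complex R)) nrm_real gtr0_norm.
rewrite (coef_grid HB kB BM); apply: le_trans (nrm_sum _ _ _) _.
apply: le_trans (_ : \sum_(t : {ffun 'I_d -> 'I_M})
    X * \prod_j (1 + b j * nrm (expi (grid t j) - 1)) ^- 2 <= _).
  by apply: ler_sum => t _; rewrite Normc.normcM nrm_char mulr1.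
rewrite -mulr_sumr mulrCA ler_wpM2l //.
rewrite -(bigA_distr_bigA (fun j (t : 'I_M) =>
   (1 + b j * nrm (expi (2 * pi * t%:R / M%:R) - 1)) ^- 2)).
rewrite natrX -[X in M%:R ^+ X](card_ord d) -prodr_const -big_split /=.
apply: ler_prod => j _; apply/andP; split.
  by apply: sumr_ge0 => t _; rewrite invr_ge0 sqr_ge0.
by rewrite [leRHS]mulrC; exact: grid_sum1.
Qed.

End GridFourier.

(** * Kernel estimates from symbol estimates *)

Lemma exp_beats_power1 (R : realType) (c : R) E : 0 < c -> exists2 C : R, 0 <= C &
  forall x, 0 <= x -> (1 + x) ^+ E * expR (- (c * x)) <= C.
Proof.
(* With this [K], 1 + x <= K (1 + c x / (E + 1)), and the (E + 1)-st power of the last bracket is at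
   most e^(c x). Using E + 1 in place of E keeps the division legal for E = 0. *)
move=> c0; pose K := 1 + E.+1%:R / c.
have K1 : 1 <= K by rewrite lerDl divr_ge0 // ltW.
have K0 : 0 <= K by apply: le_trans K1.
exists (K ^+ E.+1) => [|x x0]; first by rewrite exprn_ge0.
apply: le_trans (_ : (1 + x) ^+ E.+1 * expR (- (c * x)) <= _).
  by rewrite ler_wpM2r ?expR_ge0 // ler_weXn2l // lerDl.
rewrite expRN ler_pdivrMr ?expR_gt0 //.
have -> : c * x = E.+1%:R * (c * x / E.+1%:R) by rewrite [RHS]mulrC divfK // pnatr_eq0.
rewrite expRM_natl -exprMn lerXn2r ?nnegrE ?addr_ge0 ?mulr_ge0 ?expR_ge0 //.
apply: le_trans (_ : K * (1 + c * x / E.+1%:R) <= _); last first.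
  by rewrite ler_wpM2l // expR_ge1Dx.
have e0 : (E.+1%:R : R) != 0 by rewrite pnatr_eq0.
rewrite /K mulrDl mul1r mulrDr mulr1.
have -> : E.+1%:R / c * (c * x / E.+1%:R) = x.
  by move: (E.+1%:R : R) e0 => e e0; field; rewrite e0 gt_eqF.
have : 0 <= c * x / E.+1%:R by rewrite divr_ge0 // mulr_ge0 // ltW.
have : 0 <= E.+1%:R / c by rewrite divr_ge0 // ltW.
move: (E.+1%:R / c) (c * x / E.+1%:R) => u v; lra.
Qed.

(** * Anisotropic vanishing order of symbols *)

Section Order.
Variables (R : realType) (d : nat) (s : 'I_d -> nat).
Local Notation Zd := {ffun 'I_d -> int}.
Local Notation tp := (seq (R[i] * Zd)).
Implicit Types (p q : tp) (f : Zd -> R[i]).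

Definition unitv (j : 'I_d) : Zd := [ffun i => (i == j)%:R].
Definition tD (j : 'I_d) : tp := [:: (1, unitv j); (-1, 0)].

(* [ord r p]: the symbol [ev p] vanishes at 0 to anisotropic order at least r. *)
Inductive ord : nat -> tp -> Prop :=
| ord_any p : ord 0 p
| ord_nil r : ord r [::]
| ord_D r j p : ord r p -> ord (s j + r) (tmul (tD j) p)
| ord_cat r p q : ord r p -> ord r q -> ord r (p ++ q)
| ord_eqv r p q : eqv p q -> ord r p -> ord r q
| ord_weak r r' p : (r' <= r)%N -> ord r p -> ord r' p.

Lemma tmul_cat p p' q : eqv (tmul (p ++ p') q) (tmul p q ++ tmul p' q).
Proof. by move=> f; rewrite lin_cat !lin_mul lin_cat. Qed.

Lemma ord_mul r r' p q : ord r p -> ord r' q -> ord (r + r') (tmul p q).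
Proof.
elim=> {r p} [p|r|r j p _ IH|r p p' _ IH _ IH'|r p p' E _ IH|r r'' p le _ IH] Hq.
- elim: Hq => {r' q} [q|r|r j q _ IH|r q q' _ IH _ IH'|r q q' E _ IH|r r'' q le _ IH].
  + exact: ord_any.
  + apply: ord_eqv (ord_nil _) => f; rewrite lin_nil lin_mul [RHS]big1 // => x _.
    by rewrite lin_nil mulr0.
  + rewrite addnCA; apply: ord_eqv (ord_D j IH).
    apply: eqv_trans (tmulA _ _ _) _; apply: eqv_trans _ (eqv_sym (tmulA _ _ _)).
    by apply: eqv_mul => //; exact: tmulC.
  + apply: ord_eqv (ord_cat IH IH'); apply: eqv_trans _ (tmulC _ _).
    apply: eqv_trans (eqv_cat (tmulC _ _) (tmulC _ _)) _.
    exact/eqv_sym/tmul_cat.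
  + by apply: ord_eqv IH; exact: eqv_mul.
  + by apply: ord_weak IH; rewrite leq_add2l.
- by apply: ord_eqv (ord_nil _) => f; rewrite lin_mul !lin_nil.
- by rewrite -addnA; apply: ord_eqv (ord_D j (IH Hq)); exact: tmulA.
- by apply: ord_eqv (ord_cat (IH Hq) (IH' Hq)); exact/eqv_sym/tmul_cat.
- by apply: ord_eqv (IH Hq); exact: eqv_mul.
- by apply: ord_weak (IH Hq); rewrite leq_add2r.
Qed.

Lemma ord_scale r c p : ord r p -> ord r (tscale c p).
Proof.
move=> H; apply: ord_eqv (ord_mul (ord_any [:: (c, 0)]) H) => f.
by rewrite lin_scale lin_mul lin1; congr (_ * _); apply: eq_lin => k; rewrite add0r.
Qed.

(** By the product rule a derivative spares the factor [tD i] or hits it. In the second case it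
    vanishes for i <> j, and for i = j one difference, that is order s j, is lost. Truncated
    subtraction makes the claim void below order s j. *)
Lemma ord_der r j p : ord r p -> ord (r - s j) (tder j p).
Proof.
elim=> {r p} [p|r|r i p Hp IH|r p p' _ IH _ IH'|r p p' E _ IH|r r'' p le _ IH].
- exact: ord_any.
- exact: ord_nil.
- apply: (ord_eqv (eqv_sym (tder_mul j _ _))); apply: ord_cat; last first.
    by apply: ord_weak (ord_D i IH); lia.
  have [<-|ij] := eqVneq j i.
    by rewrite addKn; rewrite -[r]add0n; apply: ord_mul => //; exact: ord_any.
  apply: ord_weak (ord_mul (ord_eqv _ (ord_nil (s i))) Hp); first lia.
  move=> f; rewrite lin_der /lin big_cons big_seq1 big_nil /= !ffunE (negbTE ij).
  by rewrite !mul0r !mulr0 addr0.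
- apply: ord_eqv (ord_cat IH IH') => f.
  by rewrite lin_cat !lin_der lin_cat.
- by apply: ord_eqv IH; exact: eqv_der.
- by apply: ord_weak IH; rewrite leq_sub2r.
Qed.

Definition sg (th : 'I_d -> R) j : R := nrm (expi (th j) - 1).

(* [dom t th]: the torus point th has anisotropic size at most t. *)
Definition dom (t : R) (th : 'I_d -> R) := 0 <= t <= 4 /\ forall j, sg th j <= t ^+ s j.

Lemma char_unitv (th : 'I_d -> R) j : char th (unitv j) = expi (th j).
Proof.
rewrite /char (bigD1 j) //= big1 ?addr0 => [|i ij].
  by rewrite ffunE eqxx mul1r.
by rewrite ffunE (negbTE ij) mul0r.
Qed.

Lemma char0 (th : 'I_d -> R) : char th 0 = 1.
Proof. by rewrite /char big1 ?expi0 // => j _; rewrite ffunE mul0r. Qed.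

Lemma ev_D (th : 'I_d -> R) j : ev (tD j) th = expi (th j) - 1.
Proof.
by rewrite /ev /lin big_cons big_seq1 /= char_unitv char0 mul1r mulr1.
Qed.

Lemma ord_bound r p : ord r p -> exists2 C : R, 0 <= C &
  forall t th, dom t th -> nrm (ev p th) <= C * t ^+ r.
Proof.
elim=> {r p} [p|r|r j p _ [C C0 H]|r p p' _ [C C0 H] _ [C' C0' H']|r p p' E _ [C C0 H]
  |r r'' p le _ [C C0 H]].
- exists (l1 p) => [|t th _]; first exact: l1_ge0.
  by rewrite expr0 mulr1; exact: nrm_ev.
- exists 0 => // t th _; by rewrite /ev lin_nil Normc.normc0 mul0r.
- exists C => // t th D; rewrite ev_mul Normc.normcM ev_D exprD mulrCA.
  by apply: ler_pM; rewrite ?nrm_ge0 ?H //; case: D => _; apply.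
- exists (C + C'); first exact: addr_ge0.
  move=> t th D; rewrite /ev lin_cat; apply: le_trans (nrmD _ _) _.
  by rewrite mulrDl lerD ?H ?H'.
- by exists C => // t th D; rewrite /ev -E; exact: H.
- exists (C * 4 ^+ (r - r'')); first by rewrite mulr_ge0 ?exprn_ge0.
  (* Here the bound t <= 4 in [dom] matters: a high power of t is traded for a lower one. *)
  move=> t th D; apply: le_trans (H t th D) _.
  case: D => /andP[t0 t4] _; rewrite -mulrA ler_wpM2l // -{1}(subnK le) exprD.
  by rewrite ler_wpM2r ?exprn_ge0 // lerXn2r // nnegrE.
Qed.

Lemma lin_iter_der (q : nat) j p f :
  lin (iter q (tder j) p) f = lin p (fun k => (k j)%:~R ^+ q * f k).
Proof.
elim: q p f => [|q IH] p f; first by apply: eq_lin => k; rewrite expr0 mul1r.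
by rewrite iterSr IH lin_der; apply: eq_lin => k; rewrite exprS mulrA.
Qed.

(** * Decay of the kernel of p g^n, read off the symbols *)

Section Heat.
Variables (m : nat) (g : tp).
Hypothesis m_gt0 : (0 < m)%N.
Hypothesis s_gt0 : forall j, (0 < s j)%N.
Hypothesis ord_g : forall j, ord (2 * m - s j) (tder j g).
Hypothesis g_ge : forall th, 1 / 2 <= nrm (ev g th).

(** Each theta_j-derivative falls on [p], lowering its order by s j, or on one of the n factors [g],
    which becomes a symbol of order 2m - s j at the price n <= H^(2m). Either way the bound grows by
    H^(s j). The induction ranges over all [p] because the product of [p] with the derivative of [g]
    becomes the next [p]. *)
Lemma sym_bound j (q : nat) r p : ord r p -> exists C E, 0 <= C /\
  forall (H : R) n t th, 1 <= H -> n%:R <= H ^+ (2 * m) -> dom t th ->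
  nrm (ev (iter q (tder j) (tmul p (tpow g n))) th)
    <= C * (H ^+ (q * s j) / H ^+ r) * (1 + H * t) ^+ E * nrm (ev g th) ^+ n.
Proof.
(* The exponents of H are compared by inequalities only, because the orders are truncated
   differences. *)
have ar1 b c e : (b * e + c <= b.+1 * e + (c - e))%N by lia.
have ar2 b c e : (2 * m + b * e + c <= b.+1 * e + (c + (2 * m - e)))%N by lia.
elim: q r p => [|q IH] r p Hp.
  have [C C0 HC] := ord_bound Hp; exists C, r; split => // H n t th H1 nH D.
  rewrite /= ev_mul ev_pow Normc.normcM nrmX ler_wpM2r ?exprn_ge0 ?nrm_ge0 //.
  apply: le_trans (HC t th D) _; rewrite mul0n expr0 -!mulrA ler_wpM2l //.
  have H0 : 0 < H by apply: lt_le_trans H1.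
  rewrite mul1r mulrC ler_pdivlMr ?exprn_gt0 // -exprMn mulrC.
  case: D => /andP[t0 _] _.
  by rewrite lerXn2r ?nnegrE ?addr_ge0 ?mulr_ge0 ?(ltW H0) // lerDr.
have [C1 [E1 [C10 H1]]] := IH _ _ (ord_der j Hp).
have [C2 [E2 [C20 H2]]] := IH _ _ (ord_mul Hp (ord_g j)).
have [K2 K2E] : {K | K = 2 * C2} by exists (2 * C2).
have K20 : 0 <= K2 by rewrite K2E mulr_ge0.
exists (C1 + K2), (maxn E1 E2); split; first by rewrite addr_ge0.
move=> H n t th H_1 nH D.
have H0 : 0 < H by apply: lt_le_trans H_1.
have t0 : 0 <= t by case: D => /andP[].
have b1 : 1 <= 1 + H * t by rewrite lerDl mulr_ge0 // ltW.
have b0 : 0 <= 1 + H * t by apply: le_trans b1.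
have g0 : 0 <= nrm (ev g th) by exact: nrm_ge0.
have Xr (a : nat) : 0 < H ^+ a by exact: exprn_gt0.
have XE (a b : nat) : (a <= b)%N -> (1 + H * t) ^+ a <= (1 + H * t) ^+ b.
  by move=> ab; rewrite ler_weXn2l.
have E : ev (iter q.+1 (tder j) (tmul p (tpow g n))) th
  = ev (iter q (tder j) (tmul (tder j p) (tpow g n))) th
    + n%:R * ev (iter q (tder j) (tmul (tmul p (tder j g)) (tpow g n.-1))) th.
  rewrite iterSr /ev lin_iter_der tder_mul lin_cat -!lin_iter_der; congr (_ + _).
  rewrite !lin_iter_der.
  move: (fun k : Zd => (k j)%:~R ^+ q * char th k) => f; case: n {nH} => [|n].
    rewrite mul0r lin_mul [LHS]big1 // => x _.
    by rewrite lin_der lin1 ffunE mul0r mulr0 mulr0.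
  rewrite (eqv_mul (fun=> erefl) (tder_pow _ _ _)) lin_mul.
  under eq_lin => k do rewrite lin_scale.
  by rewrite lin_mulf -lin_mul tmulA.
rewrite E; apply: le_trans (nrmD _ _) _; rewrite !mulrDl; apply: lerD.
  apply: le_trans (H1 H n t th H_1 nH D) _.
  rewrite ler_wpM2r ?exprn_ge0 // ler_pM ?exprn_ge0 ?mulr_ge0 ?invr_ge0 ?(ltW (Xr _)) //.
    rewrite ler_wpM2l // ler_pdivlMr // mulrAC ler_pdivrMr // -!exprD.
    exact: (ler_weXn2l H_1 (ar1 q r (s j))).
  by apply: XE; rewrite leq_maxl.
rewrite Normc.normcM -(rmorph_nat (real_complex R)) nrm_real normr_nat.
case: n nH {E} => [|n] nH.
  by rewrite mul0r !mulr_ge0 ?invr_ge0 ?exprn_ge0 ?(ltW H0).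
have nH' : n%:R <= H ^+ (2 * m) by apply: le_trans nH; rewrite ler_nat.
apply: le_trans (ler_pM _ _ nH (H2 H n t th H_1 nH' D)) _ => //.
  exact: nrm_ge0.
(* Differentiating a power consumes one factor [g]; the lower bound 1/2 on its symbol restores it at
   the cost of the 2 in [K2]. *)
have gn : nrm (ev g th) ^+ n <= 2 * nrm (ev g th) ^+ n.+1.
  rewrite exprS mulrA ler_peMl ?exprn_ge0 //.
  by have := g_ge th; lra.
apply: le_trans (_ : H ^+ (2 * m) * (C2 * (H ^+ (q * s j) / H ^+ (r + (2 * m - s j)))
   * (1 + H * t) ^+ maxn E1 E2 * (2 * nrm (ev g th) ^+ n.+1)) <= _).
  rewrite ler_wpM2l ?(ltW (Xr _)) // ler_pM ?exprn_ge0 ?mulr_ge0 ?invr_ge0 ?(ltW (Xr _)) ?exprn_ge0 //.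
  rewrite ler_wpM2l //; last by apply: XE; rewrite leq_maxr.
  by rewrite !mulr_ge0 ?invr_ge0 ?(ltW (Xr _)).
set G := _ ^+ n.+1; set B := _ ^+ maxn _ _.
rewrite [leLHS](_ : _ = K2 * (H ^+ (2 * m) * H ^+ (q * s j) / H ^+ (r + (2 * m - s j))) * B * G); last by rewrite K2E; ring.
rewrite !ler_wpM2r ?exprn_ge0 // ler_wpM2l //.
rewrite ler_pdivlMr // mulrAC ler_pdivrMr // -!exprD.
exact: (ler_weXn2l H_1 (ar2 q r (s j))).
Qed.

Lemma exp_beats_power (c : R) E : 0 < c -> exists2 C : R, 0 <= C &
  forall x, 0 <= x -> (1 + x) ^+ E * expR (- (c * x ^+ (2 * m))) <= C.
Proof.
move=> c0; have [C C0 HC] := exp_beats_power1 E c0.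
exists (C * expR c) => [|x x0]; first by rewrite mulr_ge0 ?expR_ge0.
have x2m : x - 1 <= x ^+ (2 * m).
  have [x1|x1] := leP x 1; first by apply: le_trans (exprn_ge0 _ x0); lra.
  apply: le_trans (_ : x <= _); first lra.
  by rewrite -[leLHS]expr1 ler_weXn2l // ?ltW //; lia.
apply: le_trans (_ : (1 + x) ^+ E * (expR c * expR (- (c * x))) <= _).
  apply: ler_pM; rewrite ?exprn_ge0 ?expR_ge0 ?addr_ge0 //.
  by rewrite -expRD ler_expR; nra.
by rewrite mulrCA mulrC ler_wpM2r ?expR_ge0 ?HC.
Qed.

Hypothesis g_le : exists2 c : R, 0 < c & forall th, exists2 t, dom t th &
  nrm (ev g th) <= 1 - c * t ^+ (2 * m).

(** As 1 - c t^(2m) <= exp(- c t^(2m)), the power g^(n+1) is at most exp(- c (H t)^(2m)) and absorbs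
    any power of 1 + H t. The additional exponent \sum_j (s j * 2) pays for the product on the
    right, which is the weight that [coef_bound] integrates. *)
Lemma heat_decay E : exists2 C : R, 0 <= C & forall (H : R) n th, 1 <= H ->
  H ^+ (2 * m) = n.+1%:R -> exists2 t, dom t th &
  (1 + H * t) ^+ E * nrm (ev g th) ^+ n <= C * \prod_j (1 + H ^+ s j * sg th j) ^- 2.
Proof.
have [c c0 gle] := g_le.
have [C C0 HC] := exp_beats_power (E + \sum_j (s j * 2)) c0.
exists (2 * C) => [|H n th H1 Hn]; first by rewrite mulr_ge0.
have [t D gt] := gle th; exists t => //.
have H0 : 0 < H by apply: lt_le_trans H1.
case: D => /andP[t0 _] sgt.
have x0 : 0 <= H * t by rewrite mulr_ge0 // ltW.
have sg0 j : 0 <= sg th j by exact: nrm_ge0.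
have P j : 0 < 1 + H ^+ s j * sg th j.
  by rewrite ltr_pwDl // mulr_ge0 // exprn_ge0 // ltW.
have -> : \prod_j (1 + H ^+ s j * sg th j) ^- 2 = (\prod_j (1 + H ^+ s j * sg th j) ^+ 2)^-1.
  by rewrite prodfV.
rewrite ler_pdivlMr; last by rewrite prodr_gt0 // => j _; rewrite exprn_gt0.
have gn : nrm (ev g th) ^+ n <= 2 * expR (- (c * (H * t) ^+ (2 * m))).
  apply: le_trans (_ : 2 * nrm (ev g th) ^+ n.+1 <= _).
    rewrite exprS mulrA ler_peMl ?exprn_ge0 ?nrm_ge0 //.
    by have := g_ge th; lra.
  rewrite ler_wpM2l // exprMn Hn.
  rewrite (_ : - _ = n.+1%:R * (- (c * t ^+ (2 * m)))); last by ring.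
  rewrite expRM_natl lerXn2r ?nnegrE ?nrm_ge0 ?expR_ge0 //.
  by apply: le_trans gt _; exact: expR_ge1Dx.
have pr : \prod_j (1 + H ^+ s j * sg th j) ^+ 2 <= (1 + H * t) ^+ (\sum_j (s j * 2)).
  rewrite expr_sum; apply: ler_prod => j _; rewrite exprM exprn_ge0 ?(ltW (P j)) //=.
  rewrite lerXn2r ?nnegrE ?(ltW (P j)) ?exprn_ge0 ?addr_ge0 //.
  apply: le_trans (_ : 1 + (H * t) ^+ s j <= _).
    by rewrite lerD2l exprMn ler_pM2l ?exprn_gt0.
  have := s_gt0 j; case: (s j) => // k _.
  rewrite [leRHS]exprS mulrDl mul1r; apply: lerD; first by rewrite exprn_ege1 // lerDl.
  by rewrite exprS ler_wpM2l // lerXn2r ?nnegrE ?addr_ge0 // lerDr.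
have xb : 0 <= 1 + H * t by rewrite addr_ge0.
rewrite mulrAC.
apply: le_trans (_ : (1 + H * t) ^+ E * (1 + H * t) ^+ (\sum_j s j * 2)
   * (2 * expR (- (c * (H * t) ^+ (2 * m)))) <= _).
  apply: ler_pM; rewrite ?exprn_ge0 ?nrm_ge0 ?mulr_ge0 ?exprn_ge0 ?prodr_ge0 //.
    by move=> j _; rewrite exprn_ge0 // ltW.
  by rewrite ler_wpM2l ?exprn_ge0.
rewrite -exprD mulrCA ler_wpM2l //; exact: HC.
Qed.

(* Multiplying the kernel by [k j] differentiates its symbol. *)
Lemma heat_coef (q : nat) r p : ord r p -> exists2 C : R, 0 <= C &
  forall (H : R) n k, 1 <= H -> H ^+ (2 * m) = n.+1%:R -> forall j,
  nrm (coef (tmul p (tpow g n)) k) * `|(k j)%:~R| ^+ q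
    <= C * H ^+ (q * s j) / H ^+ r * \prod_i (H ^+ s i)^-1.
Proof.
move=> Hp.
have /choice[C HC] j : exists C : R, 0 <= C /\
  forall (H : R) n k, 1 <= H -> H ^+ (2 * m) = n.+1%:R ->
  nrm (coef (tmul p (tpow g n)) k) * `|(k j)%:~R| ^+ q
    <= C * H ^+ (q * s j) / H ^+ r * \prod_i (H ^+ s i)^-1.
  have [C [E [C0 HC]]] := sym_bound j q Hp.
  have [C' C'0 HC'] := heat_decay E.
  exists (C * C' * 4 ^+ d); split; first by rewrite !mulr_ge0 // exprn_ge0.
  move=> H n k H1 Hn.
  have H0 : 0 < H by apply: lt_le_trans H1.
  have -> : nrm (coef (tmul p (tpow g n)) k) * `|(k j)%:~R| ^+ q
    = nrm (coef (iter q (tder j) (tmul p (tpow g n))) k).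
    rewrite /coef lin_iter_der -nrm_int -nrmX -Normc.normcM mulrC -lin_mulf.
    by congr nrm; apply: eq_lin => l; case: eqP => [->|]; rewrite ?mulr0.
  apply: le_trans (@coef_bound R d _ (fun i => H ^+ s i)
     (C * (H ^+ (q * s j) / H ^+ r) * C') k _ _ _) _.
  - by rewrite !mulr_ge0 ?invr_ge0 ?exprn_ge0 // ltW.
  - by move=> i; rewrite exprn_ege1.
  - move=> th; have [t D HH] := HC' H n th H1 Hn.
    have nH : n%:R <= H ^+ (2 * m) by rewrite Hn ler_nat.
    apply: le_trans (HC H n t th H1 nH D) _.
    rewrite -mulrA -[leRHS]mulrA ler_wpM2l //.
    by rewrite !mulr_ge0 ?invr_ge0 ?exprn_ge0 // ltW.
  rewrite big_split /= prodr_const card_ord.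
  by rewrite le_eqVlt; apply/orP; left; apply/eqP; ring.
exists (\sum_j C j) => [|H n k H1 Hn j].
  by apply: sumr_ge0 => j _; case: (HC j).
have H0 : 0 < H by apply: lt_le_trans H1.
apply: le_trans ((HC j).2 H n k H1 Hn) _.
rewrite -!mulrA ler_wpM2r //.
  rewrite !mulr_ge0 ?invr_ge0 ?exprn_ge0 ?prodr_ge0 ?(ltW H0) // => i _.
  by rewrite invr_ge0 exprn_ge0 // ltW.
rewrite (bigD1 j) //= lerDl; apply: sumr_ge0 => i _; by case: (HC i).
Qed.

(** Linear in the |k j|, so that its powers are controlled by the coordinate moments of [heat_coef];
    up to a factor d it dominates [rho] / H, see [rho_sz]. *)
Definition sz (H : R) (k : Zd) : R := 1 + \sum_j `|(k j)%:~R| / H ^+ s j.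

(** If the largest x j exceeds 1, it controls the whole left side; otherwise the left side is at
    most (1 + d)^Q. *)
Lemma sum_exp_le (x : 'I_d -> R) Q : (forall j, 0 <= x j) ->
  (1 + \sum_j x j) ^+ Q <= (1 + d%:R) ^+ Q * (1 + \sum_j x j ^+ Q).
Proof.
move=> x0.
have S0 : 0 <= \sum_j x j by exact: sumr_ge0.
have SQ0 : 0 <= \sum_j x j ^+ Q by apply: sumr_ge0 => j _; rewrite exprn_ge0.
have [j jx|nx] := pickP (fun j => (1 < x j) && [forall i, x i <= x j]).
  case/andP: jx => j1 /forallP jm.
  have h : 1 + \sum_i x i <= (1 + d%:R) * x j.
    rewrite mulrDl mul1r lerD // ?(ltW j1) // -[d in d%:R]card_ord mulr_natl -sumr_const.
    exact: ler_sum.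
  apply: le_trans (_ : ((1 + d%:R) * x j) ^+ Q <= _).
    by rewrite lerXn2r ?nnegrE ?addr_ge0 // ?mulr_ge0 ?addr_ge0.
  rewrite exprMn ler_wpM2l ?exprn_ge0 ?addr_ge0 //.
  rewrite (bigD1 j) //= addrCA lerDl addr_ge0 //.
  by apply: sumr_ge0 => i _; rewrite exprn_ge0.
have x1 j : x j <= 1.
  rewrite leNgt; apply/negP => xj.
  have [i _ im] := @arg_maxP _ _ _ j xpredT x isT.
  have := nx i; rewrite (lt_le_trans xj (im j isT)) /= => /negP; apply.
  by apply/forallP => l; exact: im.
have h : 1 + \sum_i x i <= 1 + d%:R.
  rewrite lerD2l -[d in d%:R]card_ord -[leRHS]mulr1 mulr_natl -sumr_const.
  by apply: ler_sum.
apply: le_trans (_ : (1 + d%:R) ^+ Q <= _).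
  by rewrite lerXn2r ?nnegrE ?addr_ge0.
by rewrite ler_peMr ?exprn_ge0 ?addr_ge0 // lerDl.
Qed.

Lemma box_sum1 (b : R) B : 1 <= b ->
  \sum_(t < B.*2.+1) b^-1 * (1 + `|((t : nat)%:Z - B%:Z)%:~R| / b) ^- 2 <= 4.
Proof.
move=> b1; have b0 : 0 < b by apply: lt_le_trans b1.
have c0 : 0 < b^-1 by rewrite invr_gt0.
have c1 : b^-1 <= 1 by rewrite invf_le1.
have -> : B.*2.+1 = (B + B.+1)%N by lia.
rewrite big_split_ord /= -!mulr_sumr -mulrDr mulrC ler_pdivrMr //.
pose f (t : nat) := (1 + b^-1 * t%:R) ^- 2.
have E1 : \sum_(i < B) (1 + `|((i : nat)%:Z - B%:Z)%:~R| / b) ^- 2 <= 2 / b^-1.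
  apply: le_trans (_ : \sum_(0 <= t < B.+1) f t <= _); last exact: sum_inv_sqr.
  rewrite big_nat_recl // -[leLHS]add0r lerD ?invr_ge0 ?sqr_ge0 //.
  rewrite -(big_mkord xpredT (fun i => (1 + `|(i%:Z - B%:Z)%:~R| / b) ^- 2)) big_nat_rev /= add0n.
  rewrite big_nat [leRHS]big_nat; apply: ler_sum => t /andP[_ tB].
  rewrite /f mulrC -intr_norm (_ : `|_| = t.+1%:Z) //.
  by lia.
have E2 : \sum_(i < B.+1) (1 + `|((B + i)%N%:Z - B%:Z)%:~R| / b) ^- 2 <= 2 / b^-1.
  apply: le_trans (_ : \sum_(0 <= t < B.+1) f t <= _); last exact: sum_inv_sqr.
  rewrite big_mkord; apply: ler_sum => t _.
  by rewrite /f mulrC -intr_norm (_ : `|_| = (t : nat)%:Z) //; lia.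
apply: le_trans (lerD E1 E2) _; rewrite invrK; lra.
Qed.

(** The moments of order 0 and Q give kernel decay of order Q in [sz]. Of Q = a + 2d, the part a
    absorbs the growth allowed to [f], and 2d leaves a product of inverse squares, whose lattice sum
    normalised by the H^(s j) is bounded uniformly in H. *)
Lemma heat_act (j0 : 'I_d) a r p : ord r p -> exists2 C : R, 0 <= C &
  forall (H : R) n f y X, 1 <= H -> H ^+ (2 * m) = n.+1%:R -> 0 <= X ->
  (forall k, nrm (f (y + k)) <= X * sz H k ^+ a) ->
  nrm (act (tmul p (tpow g n)) f y) <= C * X / H ^+ r.
Proof.
move=> Hp.
pose Q := (a + d * 2)%N.
have [C1 C10 HC1] := heat_coef 0 Hp.
have [C2 C20 HC2] := heat_coef Q Hp.
pose K := (1 + d%:R) ^+ Q * (C1 + d%:R * C2).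
have K0 : 0 <= K by rewrite mulr_ge0 ?exprn_ge0 ?addr_ge0 ?mulr_ge0.
exists (K * 4 ^+ d) => [|H n f y X H1 Hn X0 Hf]; first by rewrite mulr_ge0 ?exprn_ge0.
have H0 : 0 < H by apply: lt_le_trans H1.
have Hs j : 0 < H ^+ s j by rewrite exprn_gt0.
set P := tmul p (tpow g n).
pose x (k : Zd) j : R := `|(k j)%:~R| / H ^+ s j.
have x0 k j : 0 <= x k j by rewrite divr_ge0 // ltW.
pose W : R := \prod_i (H ^+ s i)^-1.
have W0 : 0 <= W by rewrite prodr_ge0 // => i _; rewrite invr_ge0 ltW.
have key k : nrm (coef P k) * sz H k ^+ a
   <= K / H ^+ r * \prod_j ((H ^+ s j)^-1 * (1 + x k j) ^- 2).
  rewrite big_split /= -/W prodfV mulrA.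
  have P1 j : 0 < 1 + x k j by rewrite ltr_pwDl.
  rewrite ler_pdivlMr; last by rewrite prodr_gt0 // => j _; rewrite exprn_gt0.
  have le1 : \prod_j (1 + x k j) ^+ 2 <= sz H k ^+ (d * 2).
    rewrite mulnC exprM -[d in _ ^+ d]card_ord -prodr_const; apply: ler_prod => j _.
    rewrite exprn_ge0 ?(ltW (P1 j)) //= lerXn2r ?nnegrE ?(ltW (P1 j)) //.
      by rewrite addr_ge0 // sumr_ge0 // => i _; exact: x0.
    by rewrite lerD2l (bigD1 j) //= lerDl sumr_ge0 // => i _; exact: x0.
  have sz0 : 0 <= sz H k by rewrite addr_ge0 // sumr_ge0 // => i _; exact: x0.
  apply: le_trans (_ : nrm (coef P k) * sz H k ^+ Q <= _).
    by rewrite exprD mulrA ler_wpM2l // mulr_ge0 ?nrm_ge0 ?exprn_ge0.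
  apply: le_trans (_ : nrm (coef P k) * ((1 + d%:R) ^+ Q * (1 + \sum_j x k j ^+ Q)) <= _).
    by rewrite ler_wpM2l ?nrm_ge0 //; apply: sum_exp_le; exact: x0.
  rewrite mulrCA /K -!mulrA ler_wpM2l ?exprn_ge0 ?addr_ge0 //.
  rewrite mulrDr mulr1 mulr_sumr mulrDl; apply: lerD.
    by have := HC1 H n k H1 Hn j0; rewrite expr0 mul0n expr0 !mulr1 -/P -/W mulrA.
  rewrite -mulrA -[d in d%:R]card_ord mulr_natl -sumr_const.
  apply: ler_sum => j _.
  rewrite /x expr_div_n [leLHS]mulrA ler_pdivrMr ?exprn_gt0 //.
  apply: le_trans (HC2 H n k H1 Hn j) _.
  by rewrite -exprM mulnC le_eqVlt; apply/orP; left; apply/eqP; rewrite -/W; ring.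
have [B HB] := supp_ex P.
rewrite /act (lin_box _ HB); apply: le_trans (nrm_sum _ _ _) _.
apply: le_trans (_ : \sum_(t : {ffun 'I_d -> 'I_(B.*2.+1)})
   X * (K / H ^+ r * \prod_j ((H ^+ s j)^-1 * (1 + x (bx t) j) ^- 2)) <= _).
  apply: ler_sum => t _; rewrite Normc.normcM.
  apply: le_trans (_ : nrm (coef P (bx t)) * (X * sz H (bx t) ^+ a) <= _).
    by rewrite ler_wpM2l ?nrm_ge0.
  by rewrite mulrCA ler_wpM2l.
rewrite -mulr_sumr -mulr_sumr.
under eq_bigr => t _ do under eq_bigr => j _ do rewrite /x ffunE.
rewrite -(bigA_distr_bigA (fun j (t : 'I_(B.*2.+1)) =>
   (H ^+ s j)^-1 * (1 + `|((t : nat)%:Z - B%:Z)%:~R| / H ^+ s j) ^- 2)) /=.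
have le4 : \prod_(j < d) \sum_(t < B.*2.+1)
   (H ^+ s j)^-1 * (1 + `|((t : nat)%:Z - B%:Z)%:~R| / H ^+ s j) ^- 2 <= 4 ^+ d.
  rewrite -[d in leRHS]card_ord -prodr_const; apply: ler_prod => j _; apply/andP; split.
    by apply: sumr_ge0 => t _; rewrite mulr_ge0 ?invr_ge0 ?sqr_ge0 // ltW.
  by apply: box_sum1; rewrite exprn_ege1.
apply: le_trans (_ : X * (K / H ^+ r * 4 ^+ d) <= _).
  by rewrite !ler_wpM2l // mulr_ge0 ?invr_ge0 ?exprn_ge0 // ltW.
by rewrite le_eqVlt; apply/orP; left; apply/eqP; ring.
Qed.
End Heat.
End Order.

(** * The symbol of the difference operator *)

Section MultiIndex.
Variables (R : realType) (d : nat) (s : 'I_d -> nat).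
Local Notation Zd := {ffun 'I_d -> int}.
Local Notation tp := (seq (R[i] * Zd)).
Implicit Types (p q : tp) (u : Zd -> R[i]).

Definition tDb (j : 'I_d) : tp := [:: (1, 0); (-1, - unitv j)].

(** Folds in the same order as [Dmulti], so that [act_tDm] is a plain induction. *)
Definition tDm (t : 'I_d -> tp) (g : 'I_d -> nat) : tp :=
  foldr (fun j p => iter (g j) (tmul (t j)) p) [:: (1, 0)] (enum 'I_d).

Lemma act1 u : act [:: (1, 0)] u = u.
Proof. by apply/funext => y; rewrite /act lin1 mul1r addr0. Qed.

Lemma act_iter_mul n p q u : act (iter n (tmul q) p) u = iter n (act q) (act p u).
Proof.
by elim: n => //= n <-; apply/funext => y; rewrite act_mul.
Qed.

Lemma act_tDm (op : 'I_d -> (Zd -> R[i]) -> Zd -> R[i]) t g u :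
  (forall j v, op j v = act (t j) v) -> Dmulti op g u = act (tDm t g) u.
Proof.
move=> H; rewrite /Dmulti /tDm; elim: (enum 'I_d) => [|j l IH] /=.
  by rewrite act1.
by rewrite act_iter_mul -IH; apply: eq_iter => v; exact: H.
Qed.

Lemma ev_tDm t g th : ev (tDm t g) th = \prod_j ev (t j) th ^+ g j.
Proof.
rewrite -big_enum /tDm; elim: (enum 'I_d) => [|j l IH] /=.
  by rewrite big_nil /ev lin1 mul1r char0.
rewrite big_cons -IH; elim: (g j) => [|n IHn]; first by rewrite mul1r.
by rewrite iterS ev_mul IHn exprS mulrA.
Qed.

Lemma ord_tDm t g : (forall j, ord s (s j) (t j)) -> ord s (wt s g) (tDm t g).
Proof.
move=> H; rewrite /wt -big_enum /tDm; elim: (enum 'I_d) => [|j l IH] /=.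
  by rewrite big_nil; exact: ord_any.
rewrite big_cons; elim: (g j) => [|n IHn]; first by rewrite muln0.
by rewrite iterS mulnS -addnA; exact: ord_mul.
Qed.

Lemma ord_tD j : ord s (s j) (tD R j).
Proof.
by rewrite -[s j]addn0; apply: ord_eqv (tmul1 _) _; apply: ord_D; exact: ord_any.
Qed.

(** A backward difference is a forward one composed with a translation. *)
Lemma ord_tDb j : ord s (s j) (tDb j).
Proof.
rewrite -[s j]addn0.
apply: ord_eqv (ord_mul (ord_tD j) (ord_any _ [:: (1, - unitv j)])) => f.
rewrite lin_mul /lin !big_cons !big_nil /= !mul1r !addr0 add0r.
by rewrite subrr.
Qed.

Lemma fwd1E j u : fwd s 1 j u = act (tD R j) u.
Proof.
apply/funext => y; rewrite /fwd /act /lin !big_cons big_nil /= expr1n invr1 !mul1r.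
rewrite !addr0 mulN1r; congr (u _ - _); apply/ffunP => i; rewrite !ffunE.
by case: eqP.
Qed.

Lemma bwd1E j u : bwd s 1 j u = act (tDb j) u.
Proof.
apply/funext => y; rewrite /bwd /act /lin !big_cons big_nil /= expr1n invr1 !mul1r.
rewrite !addr0 mulN1r; congr (_ - u _); apply/ffunP => i; rewrite !ffunE.
by case: eqP.
Qed.

Lemma ev_tDb (th : 'I_d -> R) j : ev (tDb j) th = 1 - expi (- th j).
Proof.
rewrite /ev /lin !big_cons big_nil /= char_opp char_unitv char0 conj_expi.
by rewrite mul1r addr0 mulN1r.
Qed.

Lemma lin_bigcat I (r : seq I) (P : pred I) (F : I -> tp) f :
  lin (\big[cat/[::]]_(i <- r | P i) F i) f = \sum_(i <- r | P i) lin (F i) f.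
Proof.
by apply: (big_morph (fun p => lin p f)) => [p q|]; rewrite ?lin_cat ?lin_nil.
Qed.

Lemma ord_bigcat I (r : seq I) (P : pred I) (F : I -> tp) n :
  (forall i, P i -> ord s n (F i)) -> ord s n (\big[cat/[::]]_(i <- r | P i) F i).
Proof.
by move=> H; elim/big_rec: _ => [|i p Pi Hp]; [exact: ord_nil|apply: ord_cat => //; exact: H].
Qed.

Section Operator.
Variables (a : ('I_d -> nat) -> ('I_d -> nat) -> R[i]) (m : nat).

Definition tL : tp :=
  \big[cat/[::]]_(g : {ffun 'I_d -> 'I_m.+1})
    \big[cat/[::]]_(h : {ffun 'I_d -> 'I_m.+1} | (wt s (mi g) + wt s (mi h) == m)%N)
      tscale (a (mi g) (mi h)) (tmul (tDm (@tD R d) (mi g)) (tDm tDb (mi h))).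

Lemma ord_tL : ord s m tL.
Proof.
apply: ord_bigcat => g _; apply: ord_bigcat => h /eqP E.
by rewrite -[m in ord _ m]E; apply: ord_scale; apply: ord_mul; apply: ord_tDm => j;
  [exact: ord_tD|exact: ord_tDb].
Qed.

Lemma act_tL u : Lop s a m 1 u = act tL u.
Proof.
apply/funext => y; rewrite /act lin_bigcat; apply: eq_bigr => g _.
rewrite lin_bigcat; apply: eq_bigr => h _; rewrite lin_scale; congr (_ * _).
rewrite -/(act _ _ _) act_mul (act_tDm _ _ (@bwd1E)).
by rewrite (act_tDm _ _ (@fwd1E)).
Qed.

(** The factors i in [disc_symbol] are placed so that i xi and i conj(xi) are e^(i theta) - 1 and 1
    - e^(- i theta), the symbols of the two differences. *)
Lemma ev_tL th : ev tL th = disc_symbol s a m 1 th.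
Proof.
have I2 : ('i * 'i = -1 :> R[i])%C by rewrite -expr2 sqr_i.
rewrite /ev lin_bigcat; apply: eq_bigr => g _.
rewrite lin_bigcat; apply: eq_bigr => h _; rewrite lin_scale -mulrA; congr (_ * _).
rewrite -/(ev _ th) ev_mul !ev_tDm; congr (_ * _); apply: eq_bigr => j _; congr (_ ^+ _).
  by rewrite ev_D /xi expr1n invr1 mulr1 mul1r mulrA I2 mulN1r opprB.
rewrite ev_tDb /xi expr1n invr1 mulr1 mul1r rmorphM rmorphB /=.
by apply/eqP; rewrite /expi cosN sinN eq_complex /=; apply/andP; split; apply/eqP; ring.
Qed.

End Operator.
End MultiIndex.

(** * Continuity of complex functions and the zero of exp(i t) - 1 at the origin *)

Section Ellipticity.
Variable R : realType.

Definition ccont (T : topologicalType) (f : T -> R[i]) :=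
  continuous (fun x => complex.Re (f x)) /\ continuous (fun x => complex.Im (f x)).

Section CCont.
Variable T : topologicalType.
Implicit Types f g : T -> R[i].

Lemma ccont_cst c : @ccont T (fun=> c).
Proof. by split=> x; exact: cvg_cst. Qed.

Lemma ccontD f g : ccont f -> ccont g -> ccont (fun x => f x + g x).
Proof.
move=> [f1 f2] [g1 g2]; split=> x.
  have -> : (fun x => complex.Re (f x + g x)) = (fun x => complex.Re (f x) + complex.Re (g x)).
    by apply/funext => y; case: (f y) (g y) => ? ? [].
  by apply: cvgD; [exact: f1|exact: g1].
have -> : (fun x => complex.Im (f x + g x)) = (fun x => complex.Im (f x) + complex.Im (g x)).
  by apply/funext => y; case: (f y) (g y) => ? ? [].
by apply: cvgD; [exact: f2|exact: g2].
Qed.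

Lemma ccontM f g : ccont f -> ccont g -> ccont (fun x => f x * g x).
Proof.
move=> [f1 f2] [g1 g2]; split=> x.
  have -> : (fun x => complex.Re (f x * g x)) =
    (fun x => complex.Re (f x) * complex.Re (g x) - complex.Im (f x) * complex.Im (g x)).
    by apply/funext => y; case: (f y) (g y) => ? ? [].
  by apply: cvgB; apply: cvgM; [exact: f1|exact: g1|exact: f2|exact: g2].
have -> : (fun x => complex.Im (f x * g x)) =
  (fun x => complex.Re (f x) * complex.Im (g x) + complex.Im (f x) * complex.Re (g x)).
  by apply/funext => y; case: (f y) (g y) => ? ? [].
by apply: cvgD; apply: cvgM; [exact: f1|exact: g2|exact: f2|exact: g1].
Qed.

Lemma ccont_sum I (r : seq I) (P : pred I) (F : I -> T -> R[i]) :
  (forall i, ccont (F i)) -> ccont (fun x => \sum_(i <- r | P i) F i x).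
Proof.
move=> H; elim: r => [|i r IH].
  by under eq_fun do rewrite big_nil; exact: ccont_cst.
under eq_fun do rewrite big_cons; case: (P i) => //.
exact: ccontD.
Qed.

Lemma ccont_prod I (r : seq I) (P : pred I) (F : I -> T -> R[i]) :
  (forall i, ccont (F i)) -> ccont (fun x => \prod_(i <- r | P i) F i x).
Proof.
move=> H; elim: r => [|i r IH].
  by under eq_fun do rewrite big_nil; exact: ccont_cst.
under eq_fun do rewrite big_cons; case: (P i) => //.
exact: ccontM.
Qed.

Lemma ccontX f n : ccont f -> ccont (fun x => f x ^+ n).
Proof.
move=> H; elim: n => [|n IH].
  by under eq_fun do rewrite expr0; exact: ccont_cst.
by under eq_fun do rewrite exprS; exact: ccontM.
Qed.

Lemma ccont_real (f : T -> R) : continuous f -> ccont (fun x => (f x)%:C%C).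
Proof. by move=> H; split=> //= x; exact: cvg_cst. Qed.

Lemma ccont_expi (f : T -> R) : continuous f -> ccont (fun x => expi (f x)).
Proof.
move=> H; split=> /= x.
  by apply: (continuous_comp (H x)); exact: continuous_cos.
by apply: (continuous_comp (H x)); exact: continuous_sin.
Qed.

End CCont.

Definition sinc (t : R) : R := if t == 0 then 1 else sin t / t.

Lemma mul_sinc t : t * sinc t = sin t.
Proof.
rewrite /sinc; have [->|t0] := eqVneq; first by rewrite mul0r sin0.
by rewrite mulrC divfK.
Qed.

Lemma continuous_sinc : continuous sinc.
Proof.
move=> t; have [->|t0] := eqVneq t 0.
  apply/continuous_withinNx; rewrite /sinc eqxx.
  have [D V] := is_derive_sin (0 : R).
  have := D; rewrite /derivable => /cvg_ex [l Hl].
  have E : l = 1 by rewrite -(cos0 R) -V; apply/esym/cvg_lim.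
  rewrite E in Hl; apply: cvg_trans Hl; apply: near_eq_cvg; near=> h.
  have h0 : h != 0 by near: h; exact: nbhs_dnbhs_neq.
  rewrite (negbTE h0) /= sin0 subr0 addr0 mulrC.
  by rewrite -[h%:A]/(h * 1) mulr1.
have : {for t, continuous (fun x => sin x / x)}.
  apply: cvgM; first exact: continuous_sin.
  by apply: cvgV => //; exact: cvg_id.
move=> H; rewrite /continuous_at /sinc (negbTE t0).
apply: cvg_trans H; apply: near_eq_cvg; near=> h.
have h0 : h != 0 by near: h; apply: (@cvgr_neq0 R R R (nbhs t) _ id t _ t0); exact: cvg_id.
by rewrite (negbTE h0).
Unshelve. all: by end_near.
Qed.

(** Isolates the zero at t = 0 as a factor t whose cofactor stays continuous there; this is what
    lets [blowup] divide by r^m without a singularity. *)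
Lemma expiB1E (t : R) : expi t - 1 = 'i%C * t%:C%C * ((sinc (t / 2))%:C%C * expi (t / 2)).
Proof.
have {1}-> : t = (t / 2) *+ 2 by rewrite -mulr_natr divfK.
apply/eqP; rewrite /expi cos_mulr2n sin_mulr2n eq_complex /=; apply/andP.
have H := mul_sinc (t / 2); have H2 := cos2Dsin2 (t / 2).
have -> : t = t / 2 * 2 by rewrite divfK.
have -> : t / 2 * 2 / 2 = t / 2 by rewrite mulfK.
move: H H2; set S := sin (t / 2); set c := cos (t / 2); set x := t / 2; set z := sinc x.
move=> H H2; rewrite !mulr2n; split; apply/eqP.
  have -> : c ^+ 2 = 1 - S ^+ 2 by rewrite -H2 addrK.
  by rewrite -H; ring.
by rewrite -H; ring.
Qed.

Lemma oneBexpiE (t : R) : 1 - expi (- t) = 'i%C * t%:C%C * ((sinc (t / 2))%:C%C * expi (- (t / 2))).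
Proof.
have := congr1 (fun z : R[i] => - z^*%C) (expiB1E t).
rewrite /= => H; rewrite -conj_expi -[LHS]opprB.
apply/eqP; move/eqP: H; rewrite /expi cosN sinN !eq_complex /= => /andP[/eqP H1 /eqP H2].
by apply/andP; split; apply/eqP; [move: H1|move: H2] => H; rewrite ?H; lra.
Qed.

End Ellipticity.

(** * Lower bound of the symbol by compactness *)

Section SymbolLowerBound.
Variables (R : realType) (d : nat) (s : 'I_d -> nat).
Hypothesis s_gt0 : forall j, (0 < s j)%N.
Local Notation Zd := {ffun 'I_d -> int}.
Local Notation tp := (seq (R[i] * Zd)).
Variables (a : ('I_d -> nat) -> ('I_d -> nat) -> R[i]) (m : nat).

Definition scaled (r : R) (om : 'I_d -> R) : 'I_d -> R := fun j => r ^+ s j * om j.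

(* [blowup r om] is r^-m times the symbol at [scaled r om], extended to r = 0 by
   the continuous symbol, so that one compactness argument bounds the symbol
   from below near the origin and away from it. *)
Definition blowup (r : R) (om : 'I_d -> R) : R[i] :=
  \sum_(g : {ffun 'I_d -> 'I_m.+1})
    \sum_(h : {ffun 'I_d -> 'I_m.+1} | (wt s (mi g) + wt s (mi h) == m)%N)
      a (mi g) (mi h) *
      (\prod_j ('i%C * (om j)%:C%C * ((sinc (scaled r om j / 2))%:C%C
                  * expi (scaled r om j / 2))) ^+ mi g j *
       \prod_j ('i%C * (om j)%:C%C * ((sinc (scaled r om j / 2))%:C%C
                  * expi (- (scaled r om j / 2)))) ^+ mi h j).

Lemma blowupE r om : ev (tL s a m) (scaled r om) = (r ^+ m)%:C%C * blowup r om.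
Proof.
rewrite /ev lin_bigcat /blowup mulr_sumr; apply: eq_bigr => g _.
rewrite lin_bigcat mulr_sumr; apply: eq_bigr => h /eqP E.
rewrite lin_scale mulrCA; congr (_ * _).
rewrite -/(ev _ _) ev_mul !ev_tDm -[X in _ ^+ X]E exprD rmorphM /= mulrACA.
have W (g' : {ffun 'I_d -> 'I_m.+1}) :
    ((r ^+ wt s (mi g'))%:C)%C = \prod_j ((r ^+ s j)%:C)%C ^+ mi g' j.
  by rewrite expr_sum rmorph_prod; apply: eq_bigr => j _; rewrite exprM rmorphXn.
congr (_ * _); rewrite W -big_split /=; apply: eq_bigr => j _; rewrite -exprMn; congr (_ ^+ _).
  rewrite ev_D expiB1E {1}/scaled rmorphM /= [('i * _)%C]mulrCA.
  by rewrite -!mulrA.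
rewrite ev_tDb oneBexpiE {1}/scaled rmorphM /= [('i * _)%C]mulrCA.
by rewrite -!mulrA.
Qed.

Lemma blowup0 om : blowup 0 om = cont_symbol s a m om.
Proof.
rewrite /blowup /cont_symbol; apply: eq_bigr => g _; apply: eq_bigr => h _.
congr (_ * _); rewrite /cpow -big_split /=; apply: eq_bigr => j _.
rewrite /scaled expr0n eqn0Ngt s_gt0 /= !mul0r /sinc eqxx oppr0 expi0 !mulr1.
by rewrite -exprD.
Qed.

Hypothesis hell : discretely_elliptic s a m 1.

(** At r = 0 this is ellipticity of the continuous symbol. For r > 0 the coordinate of modulus pi is
    scaled to a modulus in (0, pi], hence is no multiple of 2 pi, and discrete ellipticity
    applies. *)
Lemma blowup_neq0 r om : 0 <= r <= 1 -> (forall j, `|om j| <= pi) ->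
  (exists j, `|om j| = pi) -> blowup r om != 0.
Proof.
move=> /andP[r0 r1] omle [j0 omj].
have pi0 : 0 < pi :> R by exact: pi_gt0.
have [->|rn] := eqVneq r 0.
  rewrite blowup0; apply: hell.2; exists j0.
  by rewrite -normr_gt0 omj.
have rp : 0 < r by rewrite lt_def rn.
have : ev (tL s a m) (scaled r om) != 0.
  rewrite ev_tL; apply: hell.1 => /(_ j0)[n E].
  have /(congr1 Num.norm) : scaled r om j0 = 2 * pi * n%:~R by rewrite E expr1n invr1 mulr1.
  have rs0 : 0 < r ^+ s j0 by rewrite exprn_gt0.
  have rs1 : r ^+ s j0 <= 1 by rewrite exprn_ile1.
  rewrite /scaled !normrM omj gtr0_norm // [`|pi|]gtr0_norm // [`|2|]gtr0_norm // => H.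
  have [n0|n0] := eqVneq n 0.
    by move: H; rewrite n0 normr0 mulr0 => /eqP; rewrite mulf_eq0 !gt_eqF.
  have : 1 <= `|n%:~R| :> R.
    by rewrite -intr_norm -[1]/(1%:~R) ler_int; lia.
  by move: H; nra.
by rewrite blowupE; apply: contra => /eqP ->; rewrite mulr0.
Qed.

Lemma blowup_bound (j0 : 'I_d) : exists2 c : R, 0 < c & forall r om,
  0 <= r <= 1 -> (forall j, `|om j| <= pi) -> `|om j0| = pi -> c <= nrm (blowup r om).
Proof.
(* Coordinate 0 of [v] carries r, the others om. Prescribing which coordinate has modulus pi makes
   [K] a product of compact sets. *)
pose f (v : 'rV[R]_d.+1) := blowup (v 0 0) (fun j => v 0 (lift 0 j)).
pose A (i : 'I_d.+1) : set R :=
  (if i == 0 then `[0, 1] else if i == lift 0 j0 then [set pi] `|` [set - pi]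
   else `[- pi, pi])%classic.
pose K := ([set v : 'rV[R]_d.+1 | forall i, A i (v 0 i)])%classic.
have cK : compact K.
  apply: rV_compact => i; rewrite /A; case: ifP => _; first exact: segment_compact.
  case: ifP => _; last exact: segment_compact.
  by apply: compactU; exact: compact_set1.
have cc : ccont f.
  have crd i : continuous (fun v : 'rV[R]_d.+1 => v 0 i) by exact: coord_continuous.
  have cX (i : 'I_d.+1) n : continuous (fun v : 'rV[R]_d.+1 => v 0 i ^+ n).
    move=> v; apply: (@continuous_comp _ _ _ (fun v : 'rV[R]_d.+1 => v 0 i) (fun x => x ^+ n)).
      exact: crd.
    exact: exprn_continuous.
  have cs j : continuous (fun v : 'rV[R]_d.+1 =>
      scaled (v 0 0) (fun j => v 0 (lift 0 j)) j / 2).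
    have c1 : continuous (fun v : 'rV[R]_d.+1 => v 0 0 ^+ s j * v 0 (lift 0 j)).
      move=> v; apply: (@continuousM _ _ (fun v : 'rV[R]_d.+1 => v 0 0 ^+ s j)).
        exact: cX.
      exact: crd.
    move=> v; apply: (@continuousM _ _ (fun v : 'rV[R]_d.+1 => v 0 0 ^+ s j * v 0 (lift 0 j))).
      exact: c1.
    exact: cst_continuous.
  have csinc j : continuous (fun v : 'rV[R]_d.+1 =>
      sinc (scaled (v 0 0) (fun j => v 0 (lift 0 j)) j / 2)).
    move=> v; apply: (@continuous_comp _ R R (fun v : 'rV[R]_d.+1 =>
      scaled (v 0 0) (fun j => v 0 (lift 0 j)) j / 2) (@sinc R)); first exact: cs.
    exact: continuous_sinc.
  apply: ccont_sum => g; apply: ccont_sum => h.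
  apply: ccontM; first exact: ccont_cst.
  apply: ccontM; apply: ccont_prod => j; apply: ccontX; apply: ccontM.
  - by apply: ccontM; [exact: ccont_cst|apply: ccont_real; exact: crd].
  - by apply: ccontM; [exact: ccont_real|exact: ccont_expi].
  - by apply: ccontM; [exact: ccont_cst|apply: ccont_real; exact: crd].
  apply: ccontM; first exact: ccont_real.
  apply: ccont_expi => v.
  apply: (@continuous_comp _ R R (fun v : 'rV[R]_d.+1 =>
      scaled (v 0 0) (fun j => v 0 (lift 0 j)) j / 2) -%R); first exact: cs.
  exact: opp_continuous.
(* The square is minimised because it is a polynomial in the real and imaginary parts, whose
   continuity is at hand. *)
pose h v := nrm (f v) ^+ 2.
have ch : continuous h.
  have sq (q : 'rV[R]_d.+1 -> R) : continuous q -> continuous (fun v => q v ^+ 2).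
    move=> cq v; apply: (@continuous_comp _ R R q (fun x => x ^+ 2)); first exact: cq.
    exact: exprn_continuous.
  case: cc => /sq c1 /sq c2 v.
  have -> : h = (fun v => complex.Re (f v) ^+ 2 + complex.Im (f v) ^+ 2).
    by apply/funext => w; exact: sqr_nrm.
  exact: (@continuousD _ R _ (fun v => complex.Re (f v) ^+ 2)
    (fun v => complex.Im (f v) ^+ 2) v (c1 v) (c2 v)).
have K_of r om : 0 <= r <= 1 -> (forall j, `|om j| <= pi) -> `|om j0| = pi ->
    exists2 v, K v & f v = blowup r om.
  move=> r01 ompi omj.
  exists (\row_i (if unlift 0 i is Some j then om j else r)).
    move=> i; rewrite mxE /A; case: unliftP => [j ->|->] /=; last first.
      by rewrite in_itv.
    rewrite (inj_eq (@lift_inj _ _)).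
    case: eqP => [->|_] /=; last by rewrite in_itv /= -ler_norml.
    by move: omj; have [_ ->|_ <-] := ger0P (om j0); [left|right; rewrite opprK].
  rewrite /f mxE unlift_none; congr (blowup _ _); apply/funext => j.
  by rewrite mxE liftK.
have Kp v : K v -> 0 < h v.
  move=> Kv; rewrite exprn_gt0 // lt_def nrm_ge0 andbT.
  have : f v != 0.
    apply: blowup_neq0; first by have := Kv 0; rewrite /A eqxx /= in_itv.
      move=> j; have := Kv (lift 0 j); rewrite /A eq_sym (negbTE (neq_lift 0 j)).
      case: ifP => _ /=; last by rewrite in_itv /= -ler_norml.
      by case=> ->; rewrite ?normrN gtr0_norm ?pi_gt0.
    exists j0; have := Kv (lift 0 j0); rewrite /A eq_sym (negbTE (neq_lift 0 j0)) eqxx.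
    by case=> /= ->; rewrite ?normrN gtr0_norm ?pi_gt0.
  by apply: contra => /eqP /Normc.eq0_normc ->.
have [K0|K0] := pselect (K !=set0)%classic; last first.
  exists 1 => // r om r01 ompi omj; have [v Kv _] := K_of r om r01 ompi omj.
  by case: K0; exists v.
have [v0 Kv0 minv] := compact_EVT_min K0 cK (continuous_subspaceT ch).
rewrite inE in Kv0.
exists (nrm (f v0)); first by rewrite lt_def nrm_ge0 andbT; have := Kp _ Kv0;
  rewrite /h; apply: contraTneq => ->; rewrite expr0n ltxx.
move=> r om r01 ompi omj; have [v Kv <-] := K_of r om r01 ompi omj.
rewrite -(@ler_pXn2r _ 2) ?nnegrE ?nrm_ge0 //.
by apply: minv; rewrite inE.
Qed.

Lemma root_ex (x : R) k : (0 < k)%N -> 0 <= x -> exists2 r, 0 <= r & r ^+ k = x.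
Proof.
move=> k0 x0; exists (powR x k%:R^-1); first exact: powR_ge0.
rewrite -powR_mulrn ?powR_ge0 // -powRrM mulVf ?powRr1 //.
by rewrite pnatr_eq0 -lt0n.
Qed.

Lemma nrm_expiB1 (t : R) : nrm (expi t - 1) <= `|t|.
Proof.
have -> : t = (t / 2) *+ 2 by rewrite -mulr_natr divfK.
rewrite nrm_expi2B1 normrMn -(mulr_natl `|_|) ler_wpM2l //.
set x := t / 2.
have [->|x0] := eqVneq x 0; first by rewrite sin0.
wlog xp : x x0 / 0 < x => [H|].
  have [xp|xn] := ltP 0 x; first exact: H.
  by rewrite -(normrN (sin x)) -sinN -(normrN x); apply: H; rewrite ?oppr_eq0 // oppr_gt0 lt_def eq_sym x0.
have D y : y \in `]0, x[ -> is_derive y 1 (@sin R) (cos y).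
  by move=> _; exact: is_derive_sin.
have Cc : ({within `[0, x], continuous (@sin R)})%classic.
  by apply: continuous_subspaceT; exact: continuous_sin.
have [c _] := MVT xp D Cc.
by rewrite sin0 !subr0 => ->; rewrite normrM ler_piMl ?cos_max.
Qed.

Lemma reduce_angle (t : R) : exists2 t', `|t'| <= pi & exists n : int, t = t' + 2 * pi * n%:~R.
Proof.
have pi0 : 0 < pi :> R by exact: pi_gt0.
pose n := Num.floor (t / (2 * pi) + 1 / 2).
exists (t - 2 * pi * n%:~R); last by exists n; rewrite subrK.
have /andP[n1 n2] := floor_itv (t / (2 * pi) + 1 / 2).
rewrite -/n in n1 n2; rewrite intrD in n2.
have tE : t = 2 * pi * (t / (2 * pi)) by rewrite mulrC divfK // mulf_neq0 ?gt_eqF.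
rewrite ler_norml {1 2}tE; move: n1 n2; set x := t / _; move=> n1 n2.
by apply/andP; split; nra.
Qed.

Lemma fin_lower_bound (I : finType) (f : I -> R) : (forall i, 0 < f i) ->
  exists2 c, 0 < c & forall i, c <= f i.
Proof.
move=> f0.
have S0 : 0 <= \sum_i (f i)^-1 by apply: sumr_ge0 => i _; rewrite invr_ge0 ltW.
exists (1 + \sum_i (f i)^-1)^-1 => [|i]; first by rewrite invr_gt0 ltr_pwDl.
rewrite -[leRHS]invrK lef_pV2 ?posrE ?invr_gt0 ?ltr_pwDl //.
rewrite (bigD1 i) //= addrCA lerDl addr_ge0 //.
by apply: sumr_ge0 => j _; rewrite invr_ge0 ltW.
Qed.

(** With the angles reduced to [- pi, pi], the point is [scaled r om] for r the largest of the (|th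
    j| / pi)^(1 / s j). Then r <= 1 and the maximising coordinate of om has modulus pi, so
    [blowup_bound] yields c r^m; the size is t = pi r. *)
Lemma symbol_ge : (0 < m)%N -> exists2 c : R, 0 < c & forall th,
  exists2 t, dom s t th & c * t ^+ m <= nrm (ev (tL s a m) th).
Proof.
move=> m0.
have pi0 : 0 < pi :> R by exact: pi_gt0.
have pi4 : pi <= 4 :> R by have := pihalf_lt2 R; lra.
have pi1 : 1 <= pi :> R by have := pi_ge2 R; lra.
have /choice[c0 Hc0] j0 : exists c, 0 < c /\ forall r om,
    0 <= r <= 1 -> (forall j, `|om j| <= pi) -> `|om j0| = pi -> c <= nrm (blowup r om).
  by have [c ? ?] := blowup_bound j0; exists c.
have [c cp cle] := fin_lower_bound (fun j => (Hc0 j).1).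
exists (c / pi ^+ m) => [|th]; first by rewrite divr_gt0 // exprn_gt0.
have /choice[th' Hth] j : exists t', `|t'| <= pi /\ exists n : int, th j = t' + 2 * pi * n%:~R.
  by have [t' ? ?] := reduce_angle (th j); exists t'.
have evE p : ev p th = ev p th' :> R[i].
  apply: eq_lin => k; rewrite /char !expi_sum; apply: eq_bigr => j _.
  have [_ [n ->]] := Hth j.
  by rewrite mulrDr expiD mulrCA -intrM expi_int2pi mulr1.
have sgE j : sg th j = sg th' j.
  by rewrite /sg; have [_ [n ->]] := Hth j; rewrite expiD expi_int2pi mulr1.
suff [t [/andP[t0 t4] sgt] ct] : exists2 t, dom s t th' &
    c / pi ^+ m * t ^+ m <= nrm (ev (tL s a m) th').
  by exists t; rewrite ?evE //; split=> [|j]; rewrite ?t0 // sgE.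
have /choice[rr Hrr] j : exists r : R, 0 <= r /\ r ^+ s j = `|th' j| / pi.
  have [||r ? ?] := @root_ex (`|th' j| / pi) (s j) => //; last by exists r.
  by rewrite divr_ge0 // ltW.
(* Without a maximiser there is no coordinate at all, and t = 0 will do. *)
have [j0 j0P|noj] := pickP (fun j => [forall i, rr i <= rr j]); last first.
  exists 0; last by rewrite expr0n eqn0Ngt m0 mulr0 nrm_ge0.
  split=> [|j]; first by rewrite lexx ler0n.
  exfalso; have [i _ im] := @arg_maxP _ _ _ j xpredT rr isT.
  by have := noj i; move/negP; apply; apply/forallP => l; exact: im.
move/forallP in j0P; set r := rr j0.
have r0 : 0 <= r by case: (Hrr j0).
have [rz|rn] := eqVneq r 0.
  exists 0; last by rewrite expr0n eqn0Ngt m0 mulr0 nrm_ge0.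
  split=> [|j]; first by rewrite lexx ler0n.
  have := j0P j; rewrite -/r rz => rj0.
  have [rj Ej] := Hrr j.
  have rjz : rr j = 0 by apply/le_anti; rewrite rj0 rj.
  apply: le_trans (nrm_expiB1 _) _; move: Ej.
  rewrite rjz expr0n eqn0Ngt s_gt0 /= => /esym/eqP.
  by rewrite mulf_eq0 invr_eq0 (gt_eqF pi0) orbF => /eqP ->.
have rp : 0 < r by rewrite lt_def rn.
have r1 : r <= 1.
  rewrite -(@ler_pXn2r _ (s j0)) ?nnegrE // expr1n (Hrr j0).2.
  by rewrite ler_pdivrMr // mul1r; case: (Hth j0).
pose om j := th' j / r ^+ s j.
have rs j : 0 < r ^+ s j by rewrite exprn_gt0.
have thE : th' = scaled r om.
  by apply/funext => j; rewrite /scaled /om mulrC divfK // gt_eqF.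
have tle j : `|th' j| <= pi * r ^+ s j.
  rewrite -ler_pdivrMl // mulrC -(Hrr j).2.
  apply: lerXn2r; rewrite ?nnegrE ?(Hrr j).1 ?j0P //.
have omle j : `|om j| <= pi.
  by rewrite normrM normfV [`|r ^+ _|]gtr0_norm // ler_pdivrMr.
have omj0 : `|om j0| = pi.
  rewrite normrM normfV [`|r ^+ _|]gtr0_norm // {1}/r (Hrr j0).2.
  have : `|th' j0| != 0 by apply: contra_neq (lt0r_neq0 (rs j0)) => E; rewrite (Hrr j0).2 E mul0r.
  by move=> tn; rewrite invf_div mulrCA divff // mulr1.
exists (pi * r).
  split=> [|j].
    rewrite mulr_ge0 ?(ltW pi0) //=; apply: le_trans pi4.
    by rewrite ler_piMr // ltW.
  apply: le_trans (nrm_expiB1 _) _; apply: le_trans (tle j) _.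
  rewrite exprMn ler_wpM2r ?(ltW (rs j)) //.
  by rewrite -[leLHS]expr1 ler_weXn2l.
rewrite thE blowupE Normc.normcM nrm_real ger0_norm ?exprn_ge0 //.
rewrite exprMn mulrA divfK ?gt_eqF ?exprn_gt0 // mulrC ler_wpM2l ?exprn_ge0 //.
by apply: le_trans (cle j0) _; apply: (Hc0 j0).2 => //; rewrite r0.
Qed.

End SymbolLowerBound.

(** * The discrete heat kernel of L^*L *)

Section HeatKernel.
Variables (R : realType) (d : nat) (s : 'I_d -> nat).
Hypothesis s_gt0 : forall j, (0 < s j)%N.
Local Notation Zd := {ffun 'I_d -> int}.
Local Notation tp := (seq (R[i] * Zd)).
Variables (L : tp) (m : nat).
Hypothesis m_gt0 : (0 < m)%N.
Hypothesis ordL : ord s m L.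
Hypothesis symL : exists2 c : R, 0 < c & forall th,
  exists2 t, dom s t th & c * t ^+ m <= nrm (ev L th).

Lemma ord_conj r (p : tp) : ord s r p -> ord s r (tconj p).
Proof.
elim=> {r p} [p|r|r j p Hp IH|r p p' _ IH _ IH'|r p p' E _ IH|r r'' p le _ IH].
- exact: ord_any.
- exact: ord_nil.
- have D : ord s (s j) (tconj (tD R j)).
    rewrite -[s j]addn0; apply: ord_eqv (ord_scale (-1) (ord_mul (ord_tD R s j)
      (ord_any s [:: (1 : R[i], - unitv j)]))) => f.
    rewrite lin_scale lin_mul lin_conj /lin !big_cons !big_nil /=.
    rewrite !mul1r !addr0 !mulN1r add0r subrr oppr0 opprB.
    by rewrite rmorphB /= !conjcK.
  apply: ord_eqv (ord_mul D IH) => f.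
  rewrite lin_mul !lin_conj lin_mul; congr (_^*%C); apply: eq_lin => k.
  rewrite lin_conj conjcK; apply: eq_lin => l; by rewrite opprD.
- by apply: ord_eqv (ord_cat IH IH') => f; rewrite lin_cat !lin_conj lin_cat -rmorphD.
- by apply: ord_eqv IH => f; rewrite !lin_conj E.
- exact: ord_weak IH.
Qed.

(* [Lam] is large enough for the symbol of [heat] to lie in [1/2, 1]. *)
Definition Lam : R := 2 * (1 + l1 L ^+ 2).
Definition heat : tp := [:: (1, 0)] ++ tscale (- Lam^-1)%:C%C (tmul (tconj L) L).
Definition Ladj : tp := tscale (Lam^-1)%:C%C (tconj L).

Lemma Lam_gt0 : 0 < Lam.
Proof. by rewrite mulr_gt0 // ltr_pwDl // sqr_ge0. Qed.

Lemma nrm_heat th : nrm (ev heat th) = 1 - nrm (ev L th) ^+ 2 / Lam /\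
  0 <= nrm (ev L th) ^+ 2 / Lam <= 1 / 2.
Proof.
have b : 0 <= nrm (ev L th) ^+ 2 / Lam <= 1 / 2.
  rewrite divr_ge0 ?sqr_ge0 ?(ltW Lam_gt0) //= ler_pdivrMr ?Lam_gt0 //.
  rewrite /Lam mulrA divfK // mul1r.
  apply: le_trans (_ : l1 L ^+ 2 <= _); last by rewrite lerDr.
  by rewrite lerXn2r ?nnegrE ?nrm_ge0 ?l1_ge0 ?nrm_ev.
split => //.
have -> : ev heat th = (1 - nrm (ev L th) ^+ 2 / Lam)%:C%C.
  rewrite /ev lin_cat lin1 lin_scale -/(ev _ _) ev_mul ev_conj.
  rewrite char0 mul1r [_^*%C * _]mulrC mulJ_nrm.
  by apply/eqP; rewrite eq_complex /=; apply/andP; split; apply/eqP; ring.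
by rewrite nrm_real ger0_norm //; lra.
Qed.

Lemma heat_ge th : 1 / 2 <= nrm (ev heat th).
Proof. by have [-> ?] := nrm_heat th; lra. Qed.

Lemma heat_le : exists2 c : R, 0 < c & forall th, exists2 t, dom s t th &
  nrm (ev heat th) <= 1 - c * t ^+ (2 * m).
Proof.
have [c c0 H] := symL; exists (c ^+ 2 / Lam) => [|th].
  by rewrite divr_gt0 ?exprn_gt0 ?Lam_gt0.
have [t D ct] := H th; exists t => //.
have [-> _] := nrm_heat th; rewrite lerD2l lerN2 mulrAC ler_pM2r ?invr_gt0 ?Lam_gt0 //.
rewrite mulnC exprM -exprMn lerXn2r ?nnegrE ?nrm_ge0 //.
by rewrite mulr_ge0 ?exprn_ge0 ?(ltW c0) //; case: D => /andP[].
Qed.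

Lemma ord_heat j : ord s (2 * m - s j) (tder j heat).
Proof.
apply: (@ord_eqv _ _ _ _ (tscale (- Lam^-1)%:C%C (tder j (tmul (tconj L) L)))) => [f|].
  rewrite lin_scale lin_der [RHS]lin_der lin_cat lin1 lin_scale.
  by rewrite ffunE mul0r mulr0 add0r.
apply: ord_scale; apply: ord_der; rewrite mul2n -addnn.
by apply: ord_mul => //; exact: ord_conj.
Qed.

Lemma act_heat (v : Zd -> R[i]) y : act heat v y = v y - act Ladj (act L v) y.
Proof.
rewrite {1}/act lin_cat lin1 mul1r addr0 lin_scale rmorphN mulNr; congr (_ - _).
rewrite {1}/act lin_scale lin_mul; congr (_ * _).
by apply: eq_lin => k; apply: eq_lin => l; rewrite addrA.
Qed.

(** Telescopes g^l - g^(l+1) = g^l L^*L / Lam. With n' = 0 it recovers f itself, with n' > 0 it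
    compares two regularisations of f. *)
Lemma heat_tele n n' (f : Zd -> R[i]) y : (n' <= n)%N ->
  act (tpow heat n') f y = act (tpow heat n) f y
    + \sum_(n' <= l < n) act (tmul Ladj (tpow heat l)) (act L f) y.
Proof.
move=> nn; rewrite -(subnKC nn); elim: (n - n')%N => [|k IH].
  by rewrite addn0 big_geq // addr0.
rewrite addnS big_nat_recr ?leq_addr //= addrA addrAC {1}IH; congr (_ + _).
set l := (n' + k)%N; 
have -> : act (tmul heat (tpow heat l)) f y =
    act (tpow heat l) f y - act (tmul Ladj (tpow heat l)) (act L f) y.
  rewrite !act_mul act_heat; congr (_ - _); apply: eq_act; exact: act_mulC.
by rewrite subrK.
Qed.

(* The length scale on which the n-th power of [heat] regularises. *)
Definition Hs (n : nat) : R := powR n.+1%:R ((2 * m)%:R)^-1.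

Lemma HsX n : Hs n ^+ (2 * m) = n.+1%:R.
Proof.
rewrite -powR_mulrn ?powR_ge0 // -powRrM mulVf ?powRr1 //.
by rewrite pnatr_eq0 muln_eq0 /= -lt0n.
Qed.

Lemma Hs_le n n' : (n <= n')%N -> Hs n <= Hs n'.
Proof.
move=> nn; apply: ge0_ler_powR; rewrite ?nnegrE ?invr_ge0 ?ler0n //.
by rewrite ler_nat.
Qed.

Lemma Hs_ge1 n : 1 <= Hs n.
Proof.
apply: le_trans (_ : Hs 0 <= _); last exact: Hs_le.
by rewrite /Hs powR1.
Qed.

Lemma bernoulli_le (z : R) k : 0 <= z -> z <= 1 -> 1 - z ^+ k <= k%:R * (1 - z).
Proof.
move=> z0 z1; elim: k => [|k IH]; first by rewrite expr0 subrr mul0r.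
rewrite -natr1 exprS.
have p0 : 0 <= z ^+ k by exact: exprn_ge0.
have p1 : z ^+ k <= 1 by exact: exprn_ile1.
have -> : 1 - z * z ^+ k = (1 - z ^+ k) + z ^+ k * (1 - z) by ring.
rewrite mulrDl mul1r lerD // ler_piMl // subr_ge0 //.
Qed.

(** A discrete form of the integral of l^(- r / 2m). With b the new scale, x b the previous one and
    q = 2m - r, the identity b^(2m) - (x b)^(2m) = 1 turns the new term into b^q (1 - x^(2m)), while
    the right side grows by 2m b^q (1 - x^q); Bernoulli's inequality compares the two. *)
Lemma sum_Hs r n : (r < 2 * m)%N ->
  \sum_(0 <= l < n) (Hs l ^+ r)^-1 <= (2 * m)%:R * Hs n ^+ (2 * m - r).
Proof.
move=> rm; set q := (2 * m - r)%N.
have m2 : 1 <= (2 * m)%:R :> R by rewrite ler1n; lia.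
have m20 : 0 <= (2 * m)%:R :> R by [].
have H n' : \sum_(0 <= l < n'.+1) (Hs l ^+ r)^-1 <= (2 * m)%:R * Hs n' ^+ q.
  elim: n' => [|k IH].
    by rewrite big_nat1 /Hs powR1 !expr1n invr1 mulr1.
  rewrite big_nat_recr //=; apply: le_trans (lerD IH (lexx _)) _.
  have a0 : 0 < Hs k by apply: lt_le_trans (Hs_ge1 k).
  have b0 : 0 < Hs k.+1 by apply: lt_le_trans (Hs_ge1 k.+1).
  have ab : Hs k <= Hs k.+1 by exact: Hs_le.
  have E : Hs k.+1 ^+ (2 * m) - Hs k ^+ (2 * m) = 1 by rewrite !HsX -[k.+2%:R]natr1 addrC addKr.
  move: a0 b0 ab E; set aa := Hs k; set b := Hs k.+1 => a0 b0 ab E.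
  pose x := aa / b.
  have x0 : 0 <= x by rewrite divr_ge0 // ltW.
  have x1 : x <= 1 by rewrite ler_pdivrMr // mul1r.
  have aE : aa = x * b by rewrite /x divfK // gt_eqF.
  have br : 0 < b ^+ r by rewrite exprn_gt0.
  have bq : 0 < b ^+ q by rewrite exprn_gt0.
  have mE : (2 * m = q + r)%N by rewrite /q subnK // ltnW.
  have -> : (b ^+ r)^-1 = b ^+ q * (1 - x ^+ (2 * m)).
    apply: (mulfI (lt0r_neq0 br)); rewrite divff ?gt_eqF // mulrA -exprD addnC -mE.
    by rewrite mulrBr mulr1 -exprMn mulrC -aE E.
  rewrite aE exprMn.
  have h1 : 1 - x ^+ (2 * m) <= 1 - (x ^+ q) ^+ (2 * m).
    rewrite lerD2l lerN2 -exprM; apply: ler_wiXn2l => //.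
    by rewrite leq_pmull // /q subn_gt0.
  have h2 := @bernoulli_le (x ^+ q) (2 * m) (exprn_ge0 _ x0) (exprn_ile1 _ x0 x1).
  have h3 : b ^+ q * (1 - x ^+ (2 * m)) <= b ^+ q * ((2 * m)%:R * (1 - x ^+ q)).
    by rewrite ler_pM2l //; apply: le_trans h2.
  apply: le_trans (lerD (lexx _) h3) _.
  by rewrite le_eqVlt; apply/orP; left; apply/eqP; ring.
case: n => [|n]; first by rewrite big_geq // mulr_ge0 ?exprn_ge0 // powR_ge0.
apply: le_trans (H n) _; rewrite ler_wpM2l // lerXn2r ?nnegrE ?powR_ge0 //.
exact: Hs_le.
Qed.

Definition hact (j0 : 'I_d) a r p Hp :=
  @heat_act R d s m heat m_gt0 s_gt0 ord_heat heat_ge heat_le j0 a r p Hp.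

Lemma sz_le (H H' : R) k : 0 < H -> H <= H' -> sz s H' k <= sz s H k.
Proof.
move=> H0 HH; rewrite lerD2l; apply: ler_sum => j _.
have H'0 : 0 < H' by apply: lt_le_trans HH.
rewrite ler_wpM2l // lef_pV2 ?posrE ?exprn_gt0 //.
by rewrite lerXn2r ?nnegrE ?(ltW H0) ?(ltW H'0).
Qed.

Lemma sz_ge1 (H : R) k : 0 < H -> 1 <= sz s H k.
Proof.
move=> H0; rewrite lerDl; apply: sumr_ge0 => j _.
by rewrite divr_ge0 ?exprn_ge0 ?(ltW H0).
Qed.

(** The factor [Ladj] adds order m, so the l-th term gains Hs l to the power -(r + m); r < m is what
    lets [sum_Hs] bound the sum by the largest scale. Growth measured at scale Hs n is admissible at
    all smaller scales because [sz] decreases in H. *)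
Lemma heat_corr (j0 : 'I_d) a r (p : tp) : ord s r p -> (r < m)%N -> exists2 C : R, 0 <= C &
  forall n' n f y X, 0 <= X ->
  (forall k, nrm (f (y + k)) <= X * sz s (Hs n) k ^+ a) ->
  nrm (\sum_(n' <= l < n) act (tmul (tmul p Ladj) (tpow heat l)) f y)
    <= C * X * Hs n ^+ (m - r).
Proof.
move=> Hp rm.
have Hadj : ord s m Ladj by apply: ord_scale; exact: ord_conj.
have [C C0 HC] := hact j0 a (ord_mul Hp Hadj).
exists (C * (2 * m)%:R) => [|n' n f y X X0 Hf]; first by rewrite mulr_ge0.
have Hs0 l : 0 < Hs l by apply: lt_le_trans (Hs_ge1 l).
apply: le_trans (nrm_sum _ _ _) _.
apply: le_trans (_ : \sum_(n' <= l < n) C * X * (Hs l ^+ (r + m))^-1 <= _).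
  rewrite big_nat [leRHS]big_nat; apply: ler_sum => l /andP[_ ln].
  apply: HC => // [||k]; [exact: Hs_ge1|exact: HsX|].
  apply: le_trans (Hf k) _; rewrite ler_wpM2l // lerXn2r ?nnegrE //.
  - by apply: le_trans (sz_ge1 k (Hs0 n)).
  - by apply: le_trans (sz_ge1 k (Hs0 l)).
  - by apply: sz_le => //; apply: Hs_le; exact: ltnW.
rewrite -mulr_sumr [leRHS](_ : _ = C * X * ((2 * m)%:R * Hs n ^+ (m - r))); last by ring.
rewrite ler_wpM2l ?mulr_ge0 //.
have -> : (m - r = 2 * m - (r + m))%N by lia.
apply: le_trans (_ : \sum_(0 <= l < n) (Hs l ^+ (r + m))^-1 <= _); last by apply: sum_Hs; lia.
have [nn|nn] := leqP n' n; last first.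
  rewrite big_geq ?(ltnW nn) //; apply: sumr_ge0 => l _.
  by rewrite invr_ge0 exprn_ge0 // ltW.
rewrite [leRHS](big_cat_nat (leq0n n') nn) /= lerDr; apply: sumr_ge0 => l _.
by rewrite invr_ge0 exprn_ge0 // ltW.
Qed.

End HeatKernel.

(** * Anisotropic geometry, Taylor expansion and averaging *)

Section Geometry.
Variables (R : realType) (d : nat) (s : 'I_d -> nat).
Hypothesis s_gt0 : forall j, (0 < s j)%N.
Local Notation Zd := {ffun 'I_d -> int}.
Local Notation tp := (seq (R[i] * Zd)).
Implicit Types (p q : tp) (f u w : Zd -> R[i]) (k l z : Zd).

Definition rho (k : Zd) : R := \sum_j powR `|(k j)%:~R| ((s j)%:R)^-1.

(** Radii of these boxes add up under sums of points, and an axis-parallel path to the origin stays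
    inside; hence supports and Taylor estimates use boxes instead of balls of [rho]. *)
Definition inB (r : R) (k : Zd) := forall j, `|(k j)%:~R| <= r ^+ s j.

Lemma powR_root (x : R) j : 0 <= x -> powR x ((s j)%:R)^-1 ^+ s j = x.
Proof.
move=> x0; rewrite -powR_mulrn ?powR_ge0 // -powRrM mulVf ?powRr1 //.
by rewrite pnatr_eq0 -lt0n.
Qed.

Lemma rho_ge0 k : 0 <= rho k.
Proof. by apply: sumr_ge0 => j _; exact: powR_ge0. Qed.

Lemma inB_rho k : inB (rho k) k.
Proof.
move=> j; rewrite -[leLHS](powR_root j) // lerXn2r ?nnegrE ?powR_ge0 ?rho_ge0 //.
by rewrite /rho (bigD1 j) //= lerDl; apply: sumr_ge0 => i _; exact: powR_ge0.
Qed.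

Lemma rho_le r k : 0 <= r -> inB r k -> rho k <= d%:R * r.
Proof.
move=> r0 H; rewrite -[d in d%:R]card_ord mulr_natl -sumr_const; apply: ler_sum => j _.
by rewrite -(@ler_pXn2r _ (s j)) ?nnegrE ?powR_ge0 // powR_root.
Qed.

Lemma inB0 r : 0 <= r -> inB r 0.
Proof. by move=> r0 j; rewrite ffunE normr0 exprn_ge0. Qed.

Lemma exprD_le (x y : R) n : 0 <= x -> 0 <= y -> (0 < n)%N ->
  x ^+ n + y ^+ n <= (x + y) ^+ n.
Proof.
move=> x0 y0; elim: n => // -[|n] IH _; first by rewrite !expr1.
rewrite exprS [y ^+ _]exprS [leRHS]exprS.
apply: le_trans (_ : (x + y) * (x ^+ n.+1 + y ^+ n.+1) <= _); last first.
  by rewrite ler_wpM2l ?addr_ge0 ?IH.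
rewrite [leRHS](_ : _ = x * x ^+ n.+1 + y * y ^+ n.+1 + (x * y ^+ n.+1 + y * x ^+ n.+1)); last by ring.
by rewrite lerDl addr_ge0 // mulr_ge0 // exprn_ge0.
Qed.

Lemma inBD r r' k l : 0 <= r -> 0 <= r' -> inB r k -> inB r' l -> inB (r + r') (k + l).
Proof.
move=> r0 r'0 H H' j; rewrite ffunE intrD; apply: le_trans (ler_normD _ _) _.
by apply: le_trans (lerD (H j) (H' j)) _; exact: exprD_le.
Qed.

(** The factor d comes from passing through boxes; only the existence of a constant matters. *)
Lemma rhoD k l : rho (k + l) <= d%:R * (rho k + rho l).
Proof.
apply: rho_le; first by rewrite addr_ge0 ?rho_ge0.
by apply: inBD; rewrite ?rho_ge0 //; exact: inB_rho.
Qed.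

Lemma rho_ge1 k : k != 0 -> 1 <= rho k.
Proof.
move=> k0; have [j kj] : exists j, k j != 0.
  apply/existsP; rewrite -negb_forall; apply: contra k0 => /forallP H.
  by apply/eqP/ffunP => j; rewrite ffunE; exact/eqP/H.
rewrite /rho (bigD1 j) //= -[leLHS]addr0; apply: lerD; last first.
  by apply: sumr_ge0 => i _; exact: powR_ge0.
rewrite -(@ler_pXn2r _ (s j)) ?nnegrE ?powR_ge0 // powR_root // expr1n.
by rewrite -intr_norm -[1]/(1%:~R) ler_int; lia.
Qed.

Lemma rho0 : rho 0 = 0.
Proof.
rewrite /rho big1 // => j _; rewrite ffunE normr0 powR0 // invr_eq0 pnatr_eq0.
by rewrite -lt0n.
Qed.

Lemma rho_sz (H : R) k : 0 < H -> rho k <= d%:R * (H * sz s H k).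
Proof.
move=> H0; have sz1 := sz_ge1 s k H0.
apply: rho_le; first by rewrite mulr_ge0 ?(ltW H0) // (le_trans _ sz1).
move=> j; rewrite exprMn mulrC -ler_pdivrMr ?exprn_gt0 //.
apply: le_trans (_ : sz s H k <= _); last first.
  by rewrite -[leLHS]expr1 ler_weXn2l.
rewrite /sz (bigD1 j) //= addrCA lerDl addr_ge0 // sumr_ge0 // => i _.
by rewrite divr_ge0 ?exprn_ge0 ?(ltW H0).
Qed.

(** Walk from z to 0 by unit steps, each lowering one coordinate in modulus: they stay in the box
    and use direction j exactly |z j| times. *)
Lemma path_bound w r (M : 'I_d -> R) : 0 <= r ->
  (forall j z, inB r z -> nrm (act (tD R j) w z) <= M j) ->
  forall z, inB r z -> nrm (w z - w 0) <= \sum_j `|(z j)%:~R| * M j.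
Proof.
move=> r0 HM z; have [n] := ubnP (\sum_j absz (z j))%N.
have actD j y : act (tD R j) w y = w (y + unitv j) - w y.
  by rewrite /act /lin !big_cons big_nil /= !mul1r addr0 mulN1r addr0.
elim: n z => // n IH z; rewrite ltnS => Hn zB.
have [z0|zn0] := eqVneq z 0.
  rewrite z0 subrr Normc.normc0 big1 // => j _.
  by rewrite ffunE normr0 mul0r.
have [j zj] : exists j, z j != 0.
  apply/existsP; rewrite -negb_forall; apply: contra zn0 => /forallP H.
  by apply/eqP/ffunP => j; rewrite ffunE; exact/eqP/H.
pose e : Zd := if 0 < z j then unitv j else - unitv j.
pose z' : Zd := z - e.
have z'j : `|z' j| = `|z j| - 1.
  by rewrite /z' /e; case: ifP => zp; rewrite !ffunE eqxx mulr1n ?opprK; move: (z j) zj zp => x; lia.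
have z'i i : i != j -> z' i = z i.
  by move=> ij; rewrite /z' /e; case: ifP => zp; rewrite !ffunE (negbTE ij) ?oppr0 ?subr0.
have z'B : inB r z'.
  move=> i; have [->|ij] := eqVneq i j; last by rewrite z'i.
  apply: le_trans (zB j); by rewrite -!intr_norm ler_int z'j gerBl.
have step : nrm (w z - w z') <= M j.
  have zE : z = z' + e by rewrite subrK.
  rewrite zE /e; case: ifP => zp; first by rewrite -actD; exact: HM.
  have -> : w (z' - unitv j) - w z' = - act (tD R j) w z.
    by rewrite actD zE /e zp subrK opprB.
  by rewrite normcN; exact: HM.
have S' : (\sum_i absz (z' i) < n)%N.
  apply: leq_trans Hn; rewrite (bigD1 j) //= [X in (_ < X)%N](bigD1 j) //=.
  rewrite (eq_bigr (fun i => absz (z i))) => [|i ij]; last by rewrite z'i.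
  rewrite ltn_add2r; lia.
rewrite (_ : w z - w 0 = (w z - w z') + (w z' - w 0)); last by rewrite addrA subrK.
apply: le_trans (nrmD _ _) _; apply: le_trans (lerD step (IH z' S' z'B)) _.
rewrite (bigD1 j) //= [leRHS](bigD1 j) //= addrA; apply: lerD.
  by rewrite -!intr_norm z'j intrD mulrBl mul1r addrC subrK.
by apply: ler_sum => i ij; rewrite z'i.
Qed.

(** Differences are indexed by words in place of multi-indices, so that one more difference is one
    more letter in the Taylor induction; [tDw_tDm] translates back. *)
Definition tDw (js : seq 'I_d) : tp := foldr (fun j p => tmul (tD R j) p) [:: (1, 0)] js.
Definition wts (js : seq 'I_d) : nat := \sum_(j <- js) s j.

Lemma ord_tDw js : ord s (wts js) (tDw js).
Proof.
rewrite /wts; elim: js => [|j js IH] /=; first by rewrite big_nil; exact: ord_any.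
by rewrite big_cons; exact: ord_D.
Qed.

Lemma size_wts js : (size js <= wts js)%N.
Proof.
rewrite /wts; elim: js => [|j js IH] //=; rewrite big_cons.
by have := s_gt0 j; lia.
Qed.

(* The low differences are only needed at the origin, the first ones beyond
   order F on the whole box. *)
Lemma discrete_taylor (F : nat) w r X : 0 < r -> 0 <= X ->
  (forall js, (wts js <= F)%N -> nrm (act (tDw js) w 0) * r ^+ wts js <= X) ->
  (forall js z, (F < wts js <= F + ssum s)%N -> inB r z ->
     nrm (act (tDw js) w z) * r ^+ wts js <= X) ->
  forall z, inB r z -> nrm (w z) <= (1 + d%:R) ^+ F.+1 * X.
Proof.
move=> r0 X0 H0 H1.
have d1 : 1 <= 1 + d%:R :> R by rewrite lerDl.
(* One Taylor step: the d directions of the path and the value at the origin give the factor 1 +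
   d. *)
have step js Y : (wts js <= F)%N -> X <= Y ->
    (forall j z, inB r z -> nrm (act (tDw (j :: js)) w z) * r ^+ wts (j :: js) <= Y) ->
    forall z, inB r z -> nrm (act (tDw js) w z) * r ^+ wts js <= (1 + d%:R) * Y.
  move=> jsF XY HY z zB.
  have rw n : 0 < r ^+ n by rewrite exprn_gt0.
  have HP : nrm (act (tDw js) w z - act (tDw js) w 0)
      <= \sum_j `|(z j)%:~R| * (Y / r ^+ wts (j :: js)).
    apply: path_bound (ltW r0) _ z zB => j z' z'B.
    by rewrite ler_pdivlMr //; rewrite -act_mul; exact: HY.
  have -> : act (tDw js) w z = (act (tDw js) w z - act (tDw js) w 0) + act (tDw js) w 0.
    by rewrite subrK.
  apply: le_trans (_ : (\sum_j `|(z j)%:~R| * (Y / r ^+ wts (j :: js))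
     + nrm (act (tDw js) w 0)) * r ^+ wts js <= _).
    rewrite ler_wpM2r ?(ltW (rw _)) //; apply: le_trans (nrmD _ _) _; exact: lerD.
  rewrite mulrDl [leRHS]mulrDl mul1r [leRHS]addrC; apply: lerD; last first.
    by apply: le_trans XY; exact: H0.
  rewrite mulr_suml -[d in d%:R]card_ord mulr_natl -sumr_const; apply: ler_sum => j _.
  have Y0 : 0 <= Y by apply: le_trans XY.
  rewrite /wts big_cons exprD -/(wts js).
  rewrite [leLHS](_ : _ = `|(z j)%:~R| / r ^+ s j * Y).
    by rewrite ler_piMl // ler_pdivrMr // mul1r.
  by field; rewrite !gt_eqF.
have key n : forall js, (wts js <= F)%N -> (F - wts js <= n)%N -> forall z, inB r z ->
    nrm (act (tDw js) w z) * r ^+ wts js <= (1 + d%:R) ^+ n.+1 * X.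
  (* One more letter takes a word of weight at most F beyond F by at most s j <= [ssum s], which is
     the range where [H1] is assumed. *)
  have child n' js j z : (wts js <= F)%N -> inB r z ->
      ((wts (j :: js) <= F)%N ->
        nrm (act (tDw (j :: js)) w z) * r ^+ wts (j :: js) <= (1 + d%:R) ^+ n' * X) ->
      nrm (act (tDw (j :: js)) w z) * r ^+ wts (j :: js) <= (1 + d%:R) ^+ n' * X.
    move=> jsF zB Hc; have [jF|jF] := leqP (wts (j :: js)) F; first exact: Hc.
    apply: le_trans (H1 _ _ _ zB) _; last by rewrite ler_peMl // exprn_ege1.
    rewrite jF /wts big_cons addnC leq_add //.
    by rewrite /ssum (bigD1 j) //= leq_addr.
  have wtsS j js : (wts js < wts (j :: js))%N.
    by rewrite /wts big_cons; have := s_gt0 j; lia.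
  elim: n => [|n IH] js jsF jsn z zB; rewrite exprS -mulrA; apply: step => //.
  - by rewrite expr0 mul1r.
  - by move=> j z' z'B; apply: child => // jF; have := wtsS j js; lia.
  - by rewrite ler_peMl // exprn_ege1.
  - by move=> j z' z'B; apply: child => // jF; apply: IH => //; have := wtsS j js; lia.
move=> z zB; have := key F [::]; rewrite /wts big_nil subn0.
move=> /(_ isT (leqnn _) z zB); rewrite expr0 mulr1.
by rewrite /act lin1 mul1r addr0.
Qed.

(** Words of bounded length are finitely many, so constants depending on the word merge into one;
    monotonicity in the constant permits summing them. *)
Lemma words_bound (P : seq 'I_d -> R -> Prop) :
  (forall js C C', C <= C' -> P js C -> P js C') ->
  (forall js, exists C, P js C) ->
  forall N, exists2 C : R, 0 <= C & forall js, (size js <= N)%N -> P js C.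
Proof.
move=> Pm PC N; elim: N P Pm PC => [|N IH] P Pm PC.
  have [C HC] := PC [::]; exists `|C| => // -[|//] _.
  by apply: Pm HC; exact: ler_norm.
have [C0 HC0] := PC [::].
have /choice[C HC] j : exists C, 0 <= C /\ forall js, (size js <= N)%N -> P (j :: js) C.
  have [||C C0' HC] := IH (fun js => P (j :: js)); last by exists C.
    by move=> js C C'; exact: Pm.
  by move=> js; exact: PC.
have S0 : 0 <= \sum_j C j by apply: sumr_ge0 => j _; case: (HC j).
exists (`|C0| + \sum_j C j) => [|js]; first by rewrite addr_ge0.
case: js => [|j js] jsN; first by apply: Pm HC0; rewrite (le_trans (ler_norm _)) // lerDl.
apply: Pm ((HC j).2 js jsN); rewrite (bigD1 j) //= addrCA lerDl addr_ge0 //.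
by apply: sumr_ge0 => i _; case: (HC i).
Qed.

(* All n-fold differences vanish: this holds for polynomials of degree < n. *)
Fixpoint is_pol (n : nat) f : Prop :=
  if n is n'.+1 then forall k, is_pol n' (fun y => f y - f (y + k)) else forall y, f y = 0.

Lemma eq_is_pol n f g : f =1 g -> is_pol n f -> is_pol n g.
Proof.
elim: n f g => [|n IH] f g E H; first by move=> y; rewrite -E.
by move=> k; apply: IH (H k) => y; rewrite !E.
Qed.

Lemma is_pol0 n f : (forall y, f y = 0) -> is_pol n f.
Proof.
elim: n f => // n IH f H k; apply: IH => y; by rewrite !H subrr.
Qed.

Lemma is_polS n f : is_pol n f -> is_pol n.+1 f.
Proof.
elim: n f => [|n IH] f H; first exact: is_pol0.
by move=> k; apply: IH; exact: H.
Qed.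

Lemma is_polW n n' f : (n <= n')%N -> is_pol n f -> is_pol n' f.
Proof.
move=> /subnKC <-; elim: (n' - n)%N => [|k IH] H; first by rewrite addn0.
by rewrite addnS; apply: is_polS; exact: IH.
Qed.

Lemma is_polD n f g : is_pol n f -> is_pol n g -> is_pol n (fun y => f y + g y).
Proof.
elim: n f g => [|n IH] f g Hf Hg.
  by move=> y; rewrite Hf Hg addr0.
by move=> k; apply: eq_is_pol (IH _ _ (Hf k) (Hg k)) => y; rewrite opprD addrACA.
Qed.

Lemma is_polZ n c f : is_pol n f -> is_pol n (fun y => c * f y).
Proof.
elim: n f => [|n IH] f Hf; first by move=> y; rewrite Hf mulr0.
by move=> k; apply: eq_is_pol (IH _ (Hf k)) => y; rewrite mulrBr.
Qed.

Lemma is_pol_sum n I (r : seq I) (Q : pred I) (f : I -> Zd -> R[i]) :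
  (forall i, Q i -> is_pol n (f i)) -> is_pol n (fun y => \sum_(i <- r | Q i) f i y).
Proof.
move=> H; elim: r => [|i r IH].
  by apply: is_pol0 => y; rewrite big_nil.
case Qi: (Q i).
  apply: eq_is_pol (is_polD (H i Qi) IH) => y; by rewrite big_cons Qi.
by apply: eq_is_pol IH => y; rewrite big_cons Qi.
Qed.

Lemma is_pol_shift n k f : is_pol n f -> is_pol n (fun y => f (y + k)).
Proof.
elim: n f => [|n IH] f H; first by move=> y; exact: H.
by move=> l; apply: eq_is_pol (IH _ (H l)) => y; rewrite addrAC.
Qed.

(** The index n.+1 stands for degree at most n, so degrees add. The difference of the product splits
    as (f - f(. + k)) g + f(. + k) (g - g(. + k)), which lowers one of the two degrees. *)
Lemma is_polM n n' f g : is_pol n.+1 f -> is_pol n'.+1 g ->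
  is_pol (n + n').+1 (fun y => f y * g y).
Proof.
have [N] := ubnP (n + n')%N; elim: N n n' f g => // N IH n n' f g Hn Hf Hg k.
have E y : (f y - f (y + k)) * g y + f (y + k) * (g y - g (y + k))
    = f y * g y - f (y + k) * g (y + k) by ring.
apply: eq_is_pol E _; apply: is_polD.
  case: n Hf Hn => [|n] Hf Hn; first by apply: is_pol0 => y; rewrite (Hf k) mul0r.
  by apply: IH => //; exact: Hf.
case: n' Hg Hn => [|n'] Hg Hn; first by apply: is_pol0 => y; rewrite (Hg k) mulr0.
rewrite -[(n + _)%coq_nat]/(n + n'.+1)%N addnS.
by apply: IH; [lia|exact: is_pol_shift|exact: Hg].
Qed.

Lemma is_pol_cst c : is_pol 1 (fun=> c).
Proof. by move=> k y; rewrite subrr. Qed.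

Lemma is_pol_prod (I : Type) (r : seq I) (f : I -> Zd -> R[i]) (b : I -> nat) :
  (forall i, is_pol (b i).+1 (f i)) ->
  is_pol (\sum_(i <- r) b i).+1 (fun y => \prod_(i <- r) f i y).
Proof.
move=> H; elim: r => [|i r IH].
  by rewrite big_nil; apply: eq_is_pol (is_pol_cst 1) => y; rewrite big_nil.
rewrite big_cons; apply: eq_is_pol (is_polM (H i) IH) => y.
by rewrite big_cons.
Qed.

Lemma is_polX n f (k : nat) : is_pol n.+1 f -> is_pol (k * n).+1 (fun y => f y ^+ k).
Proof.
move=> H; elim: k => [|k IH].
  by apply: eq_is_pol (is_pol_cst 1) => y; rewrite expr0.
by rewrite mulSn; apply: eq_is_pol (is_polM H IH) => y; rewrite exprS.
Qed.

Lemma is_pol_coord (c : R[i]) j : is_pol 2 (fun y => c * (y j)%:~R).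
Proof.
by move=> k l y; rewrite !ffunE !intrD !mulrDr; ring.
Qed.

Section Averaging.
Variable A : tp.
Hypothesis A1 : lin A (fun=> 1) = 1.

(* 1 - (1 - A)^n = A Q_n averages and yet fixes polynomials of degree < n;
   [tavg] is 1 - A and [tavgQ n] is Q_n. *)
Definition tavg : tp := [:: (1, 0)] ++ tscale (-1) A.
Fixpoint tavgQ (n : nat) : tp := if n is n'.+1 then [:: (1, 0)] ++ tmul tavg (tavgQ n') else [::].

Lemma act_avg f y : act tavg f y = f y - act A f y.
Proof. by rewrite /act lin_cat lin1 lin_scale mul1r addr0 mulN1r. Qed.

(** As the weights of [A] sum to 1, (1 - A) f is a combination of the differences f - f(. + k). *)
Lemma is_pol_avg n f : is_pol n.+1 f -> is_pol n (act tavg f).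
Proof.
move=> H.
have E y : \sum_(x <- A) x.1 * (f y - f (y + x.2)) = act tavg f y.
  rewrite act_avg -[f y in RHS]mul1r -A1 -lin_mulfr /act /lin -sumrB.
  by apply: eq_bigr => x _; rewrite mul1r mulrBr.
by apply: eq_is_pol E _; apply: is_pol_sum => x _; apply: is_polZ; exact: H.
Qed.

Lemma avg_kills n f y : is_pol n f -> act (tpow tavg n) f y = 0.
Proof.
elim: n f y => [|n IH] f y H.
  by rewrite /act lin1 mul1r addr0.
rewrite -[tpow tavg n.+1]/(tmul tavg (tpow tavg n)) /act tmulC -/(act _ _ _) act_mul.
by apply: IH; exact: is_pol_avg.
Qed.

Lemma avg_split n f y : f y = act (tpow tavg n) f y + act A (act (tavgQ n) f) y.
Proof.
elim: n y => [|n IH] y.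
  by rewrite /act lin1 mul1r addr0 /lin [X in _ + X]big1 ?addr0 // => x _; rewrite big_nil mulr0.
rewrite -[tpow tavg n.+1]/(tmul tavg (tpow tavg n)) act_mul.
have E : act tavg (act (tpow tavg n) f) y = f y - act A (act (tavgQ n) f) y
   - act A (act (tpow tavg n) f) y.
  by rewrite act_avg {1}(IH y) addrK.
have E2 : act A (act (tavgQ n.+1) f) y
    = act A f y + act A (act (tavgQ n) f) y - act A (act A (act (tavgQ n) f)) y.
  rewrite -addrA -[X in _ + (_ - X)]mul1r -mulNr -!act_mulf -!act_addf.
  apply: eq_act => z; rewrite {1}/act lin_cat lin1 mul1r addr0 -/(act (tmul tavg (tavgQ n)) f z).
  by rewrite act_mul act_avg mulN1r addrA.
rewrite E E2.
have -> : act A f y = act A (act (tpow tavg n) f) y + act A (act A (act (tavgQ n) f)) y.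
  by rewrite -act_addf; apply: eq_act => z; exact: IH.
by ring.
Qed.

End Averaging.

Definition tsupp (r : R) p := forall x, x \in p -> inB r x.2.

Lemma l1_cat p q : l1 (p ++ q) = l1 p + l1 q.
Proof. exact: big_cat. Qed.

Lemma l1_scale c p : l1 (tscale c p) = nrm c * l1 p.
Proof.
rewrite /l1 big_map mulr_sumr; apply: eq_bigr => x _; exact: Normc.normcM.
Qed.

Lemma l1_mul p q : l1 (tmul p q) = l1 p * l1 q.
Proof.
rewrite /l1 big_allpairs_dep mulr_suml; apply: eq_bigr => x _.
rewrite mulr_sumr; apply: eq_bigr => y _; exact: Normc.normcM.
Qed.

Lemma l1_1 : l1 ([:: (1, 0)] : tp) = 1.
Proof. by rewrite /l1 big_seq1 Normc.normc1. Qed.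

Lemma tsupp_mul r r' p q : 0 <= r -> 0 <= r' -> tsupp r p -> tsupp r' q ->
  tsupp (r + r') (tmul p q).
Proof.
move=> r0 r'0 H H' x /allpairsP[[y z] /= [yp zq ->]] /=.
by apply: inBD => //; [exact: (H y yp)|exact: (H' z zq)].
Qed.

Lemma tsupp_cat r p q : tsupp r p -> tsupp r q -> tsupp r (p ++ q).
Proof. by move=> H H' x; rewrite mem_cat => /orP[/H|/H']. Qed.

Lemma tsupp_scale r c p : tsupp r p -> tsupp r (tscale c p).
Proof. by move=> H x /mapP[y yp ->]; exact: (H y yp). Qed.

Lemma tsupp1 r : 0 <= r -> tsupp r [:: (1, 0)].
Proof. by move=> r0 x; rewrite inE => /eqP ->; exact: inB0. Qed.

Section AveragingSupport.
Variables (A : tp) (h : R).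
Hypotheses (h0 : 0 <= h) (A1 : l1 A = 1) (Ah : tsupp h A).

Lemma l1_avg : l1 (tavg A) = 2.
Proof. by rewrite l1_cat l1_1 l1_scale A1 mulr1 normcN Normc.normc1. Qed.

Lemma tsupp_avg : tsupp h (tavg A).
Proof. by apply: tsupp_cat; [exact: tsupp1|exact: tsupp_scale]. Qed.

Lemma avg_pow n : l1 (tpow (tavg A) n) = 2 ^+ n /\ tsupp (n%:R * h) (tpow (tavg A) n).
Proof.
elim: n => [|n [IH1 IH2]]; first by rewrite l1_1; split=> //; rewrite mul0r; exact: tsupp1.
rewrite /= l1_mul IH1 l1_avg exprS; split => //.
rewrite -nat1r mulrDl mul1r; apply: tsupp_mul => //; first by rewrite mulr_ge0.
exact: tsupp_avg.
Qed.

Lemma avg_Q n : l1 (tavgQ A n) = 2 ^+ n - 1 /\ tsupp (n%:R * h) (tavgQ A n).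
Proof.
elim: n => [|n [IH1 IH2]]; first by rewrite /l1 big_nil expr0 subrr; split.
rewrite -[tavgQ A n.+1]/([:: (1, 0)] ++ tmul (tavg A) (tavgQ A n)).
rewrite l1_cat l1_mul l1_1 l1_avg; split.
  by rewrite IH1 exprS; ring.
apply: tsupp_cat; first by apply: tsupp1; rewrite mulr_ge0.
rewrite -nat1r mulrDl mul1r; apply: tsupp_mul => //; first by rewrite mulr_ge0.
exact: tsupp_avg.
Qed.

End AveragingSupport.
End Geometry.

(** * Test functions *)

Section SmoothBump.
Variable R : realType.
Implicit Types f g : R -> R.

Fixpoint smn (n : nat) f : Prop :=
  if n is n'.+1 then exists2 f' : R -> R, (forall x : R, is_derive x 1 f (f' x)) & smn n' f' else True.

Lemma smnD n f g : smn n f -> smn n g -> smn n (fun x => f x + g x).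
Proof.
elim: n f g => // n IH f g [f' Hf sf] [g' Hg sg].
exists (fun x => f' x + g' x) => [x|]; last exact: IH.
exact: is_deriveD.
Qed.

Lemma smnW n f : smn n.+1 f -> smn n f.
Proof.
by elim: n f => // n IH f [f' Hf sf]; exists f' => //; exact: IH.
Qed.

Lemma smnM n f g : smn n f -> smn n g -> smn n (fun x => f x * g x).
Proof.
elim: n f g => // n IH f g Sf Sg; have [f' Hf sf] := Sf; have [g' Hg sg] := Sg.
exists (fun x => f x * g' x + g x * f' x) => [x|]; first exact: is_deriveM.
by apply: smnD; apply: IH => //; exact: smnW.
Qed.

Lemma smn_cst n c : smn n (fun=> c).
Proof.
elim: n c => // n IH c; exists (fun=> 0) => [x|]; last exact: IH.
exact: is_derive_cst.
Qed.

Lemma smn_affine n f (a b : R) : smn n f -> smn n (fun x => f (a * x + b)).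
Proof.
elim: n f => // n IH f [f' Hf sf].
exists (fun x => f' (a * x + b) * a) => [x|]; last by apply: smnM; [exact: IH|exact: smn_cst].
apply: (@is_derive1_comp _ f (fun x => a * x + b) x (f' (a * x + b)) a).
have D : is_derive x 1 (fun x => a * x + b) (a *: 1 + 0).
  apply: is_deriveD; apply: is_deriveZ.
by apply: is_derive_eq D _; rewrite addr0 -[a *: _]/(a * 1) mulr1.
Qed.

Lemma smn_derive f : (forall n, smn n f) ->
  (forall x : R, is_derive x 1 f (derive1 f x)) /\ forall n, smn n (derive1 f).
Proof.
move=> H.
have D (x : R) : is_derive x 1 f (derive1 f x).
  have [f' Hf _] := H 1%N; have [Df Vf] := Hf x.
  by apply: DeriveDef => //; rewrite derive1E.
split=> // n; have [f' Hf sf] := H n.+1.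
suff -> : derive1 f = f' by [].
by apply/funext => x; rewrite derive1E; have [_ ->] := Hf x.
Qed.

Lemma smn_derive1n f i : (forall n, smn n f) ->
  (forall x : R, is_derive x 1 (derive1n i f) (derive1n i.+1 f x)) /\ forall n, smn n (derive1n i f).
Proof.
move=> H; elim: i => [|i [_ IH]]; first by split; [exact: (smn_derive H).1|exact: H].
have [_ S] := smn_derive IH.
by split; [exact: (smn_derive S).1|exact: S].
Qed.

(* The span of these functions is closed under differentiation. *)
Definition flat k (t : R) : R := if 0 < t then (t^-1) ^+ k * expR (- t^-1) else 0.

Lemma flat_ge0 k t : 0 <= flat k t.
Proof.
rewrite /flat; case: ifP => // t0.
by rewrite mulr_ge0 ?expR_ge0 // exprn_ge0 // invr_ge0 ltW.
Qed.

Lemma flat_bound k : exists2 C, 0 <= C & forall t, `|flat k t| <= C * `|t|.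
Proof.
have [C C0 HC] := @exp_beats_power1 R 1 k.+1 ltr01.
exists C => // t; rewrite ger0_norm ?flat_ge0 // /flat; case: ifP => t0; last by rewrite mulr_ge0.
rewrite gtr0_norm // -ler_pdivrMr //.
have x0 : 0 <= t^-1 by rewrite invr_ge0 ltW.
apply: le_trans (HC _ x0); rewrite mul1r mulrAC -exprSr.
by rewrite ler_wpM2r ?expR_ge0 // lerXn2r ?nnegrE ?addr_ge0 // lerDr.
Qed.

(** At 0 the difference quotient of [flat k] is [flat k.+1], which tends to 0 by [flat_bound];
    Caratheodory's criterion makes this the derivative. *)
Lemma flat_derive k (t : R) : is_derive t 1 (flat k) (flat k.+2 t + (- k%:R) * flat k.+1 t).
Proof.
have [t0|t0|<-] := ltgtP 0 t.
- apply: (@near_eq_is_derive R R R (fun t : R => (t^-1) ^+ k * expR (- t^-1))).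
    near=> x; rewrite /flat ifT //; near: x; exact: lt_nbhsr.
  have tn : t != 0 by rewrite gt_eqF.
  have DV : is_derive t 1 (fun x : R => x^-1) (- t ^- 2 *: 1).
    exact: (@is_deriveV _ id).
  have D1 : is_derive t 1 (fun x : R => (x^-1) ^+ k) ((k%:R * (t^-1) ^+ k.-1) *: (- t ^- 2 *: 1)).
    have := @is_deriveX R R (fun x : R => x^-1) k t 1 _ DV; by rewrite exprfctE.
  have D2 : is_derive t 1 (fun x : R => expR (- x^-1)) (expR (- t^-1) * - (- t ^- 2 *: 1)).
    exact: (@is_derive1_comp _ expR (fun x => - x^-1) t _ _ (is_derive_expR _)
      (@is_deriveN R R R (fun x : R => x^-1) t 1 _ DV)).
  have D := is_deriveM D1 D2.
  apply: is_derive_eq D _.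
  rewrite /flat t0 /GRing.scale /= !mulr1 -exprVn.
  case: k {D1} => [|k]; first by rewrite !mul0r mulr0 expr0 oppr0 !mul0r !addr0; ring.
  by rewrite /= !exprS; ring.
- apply: (@near_eq_is_derive R R R (fun=> 0)).
    near=> x; rewrite /flat ifF //; apply/negbTE; rewrite -leNgt ltW //.
    near: x; exact: lt_nbhsl.
  rewrite /flat ltNge (ltW t0) /= mulr0 addr0; exact: is_derive_cst.
apply/is_derive1_caratheodory; exists (flat k.+1); split.
- move=> z; rewrite /flat ltxx subr0 subr0; case: ifP => z0; last by rewrite mul0r.
  by rewrite exprS; move: (z^-1 ^+ k) (expR _) => A B; field; rewrite gt_eqF.
- have [C C0 HC] := flat_bound k.+1.
  have F0 : flat k.+1 0 = 0 by rewrite /flat ltxx.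
  rewrite /prop_for /continuous_at F0; apply/cvgr0Pnorm_lt => e e0.
  have C1 : 0 < C + 1 by rewrite ltr_pwDr.
  near=> z; apply: le_lt_trans (HC z) _.
  apply: le_lt_trans (_ : (C + 1) * `|z| < _); first by rewrite ler_wpM2r // lerDl.
  rewrite -ltr_pdivlMl // mulrC.
  near: z; apply: (@cvgr0_norm_lt _ _ R (nbhs 0) _ id); first exact: cvg_id.
  by rewrite divr_gt0.
- by rewrite /flat ltxx mulr0 addr0.
Unshelve. all: by end_near. Qed.

Lemma smn_flat n k : smn n (flat k).
Proof.
elim: n k => // n IH k; exists (fun t => flat k.+2 t + (- k%:R) * flat k.+1 t).
  exact: flat_derive.
by apply: smnD => //; apply: smnM => //; exact: smn_cst.
Qed.

Definition bump (t : R) : R := flat 0 (1 / 2 - t) * flat 0 (1 / 2 + t).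

Lemma smn_bump n : smn n bump.
Proof.
rewrite /bump; apply: smnM.
  have := @smn_affine n _ (-1) (1 / 2) (smn_flat n 0).
  by congr (smn n _); apply/funext => x; congr flat; ring.
have := @smn_affine n _ 1 (1 / 2) (smn_flat n 0).
by congr (smn n _); apply/funext => x; congr flat; ring.
Qed.

Lemma bump_ge0 t : 0 <= bump t.
Proof. by rewrite mulr_ge0 ?flat_ge0. Qed.

Lemma bump_out t : 1 / 2 <= `|t| -> bump t = 0.
Proof.
move=> t2; rewrite /bump /flat; have [tp|tn] := ger0P t.
  by rewrite ger0_norm // in t2; rewrite ltNge (_ : 1 / 2 - t <= 0) ?mul0r //; lra.
rewrite ltr0_norm // in t2.
by rewrite [X in _ * X]ifF ?mulr0 //; apply/negbTE; rewrite -leNgt; lra.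
Qed.

Lemma bump_in : exists2 c, 0 < c & forall t, `|t| <= 1 / 4 -> c <= bump t.
Proof.
exists (expR (-4) ^+ 2) => [|t]; first by rewrite exprn_gt0 ?expR_gt0.
rewrite ler_norml => /andP[t1 t2]; rewrite expr2 /bump.
have key x : 1 / 4 <= x -> expR (-4) <= flat 0 x.
  move=> x4; rewrite /flat ifT; last lra.
  rewrite expr0 mul1r ler_expR lerN2 -[4]invrK lef_pV2 ?posrE //; lra.
by apply: ler_pM; rewrite ?expR_ge0 ?key //; lra.
Qed.

Definition dbump (i : nat) : R -> R := derive1n i (bump : R -> R).

Lemma dbump_derive i (x : R) : is_derive x 1 (dbump i) (dbump i.+1 x).
Proof. by have [] := smn_derive1n i smn_bump. Qed.

Lemma dbump_out i t : 1 / 2 < `|t| -> dbump i t = 0.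
Proof.
elim: i t => [|i IH] t t2; first by apply: bump_out; exact: ltW.
have [_ <-] := dbump_derive i t.
rewrite (@near_eq_derive R R R _ (fun=> 0)); first by rewrite derive_cst.
near=> x; apply: IH; near: x.
have : (`|x| @[x --> t] --> `|t|)%classic by exact: norm_continuous.
by move/cvgr_gt; apply.
Unshelve. all: by end_near. Qed.

Lemma dbump_bounded i : exists2 C, 0 <= C & forall t, `|dbump i t| <= C.
Proof.
have c : continuous (fun t => `|dbump i t|).
  move=> t; apply: (@continuous_comp _ R R (dbump i) Num.norm); last exact: norm_continuous.
  apply: differentiable_continuous; apply/derivable1_diffP.
  by have [] := dbump_derive i t.
have le1 : (-1 : R) <= 1 by lra.
have [x xI Hx] := EVT_max le1 (continuous_subspaceT c).
exists `|dbump i x| => // t.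
have [t1|t1] := leP `|t| 1; last by rewrite dbump_out ?normr0 //; lra.
by apply: Hx; rewrite in_itv /= -ler_norml.
Qed.

End SmoothBump.

(** * Anisotropic test functions and averages *)

Section TestFunctions.
Variables (R : realType) (d : nat) (s : 'I_d -> nat).
Hypothesis s_gt0 : forall j, (0 < s j)%N.
Local Notation Zd := {ffun 'I_d -> int}.
Local Notation tp := (seq (R[i] * Zd)).

(** A family closed under partial derivatives, [n j] counting those taken in direction j; smoothness
    and the derivative bounds of [testB] thereby become explicit. *)
Definition tfun (c : R) (al be : 'I_d -> R) (n : 'I_d -> nat) (x : 'rV[R]_d) : R :=
  c * \prod_j (al j ^+ n j * dbump (n j) (al j * x 0 j + be j)).

Definition incr (n : 'I_d -> nat) (j : 'I_d) : 'I_d -> nat :=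
  fun i => ((i == j) + n i)%N.

Lemma partial_tfun c al be n j : partial j (tfun c al be n) = tfun c al be (incr n j).
Proof.
apply/funext => x.
pose P := c * \prod_(i | i != j) (al i ^+ n i * dbump (n i) (al i * x 0 i + be i)).
pose G t := P * (al j ^+ n j * dbump (n j) (al j * t + be j)).
have E h : tfun c al be n (h *: delta_mx 0 j + x) = G (h * 1 + x 0 j).
  rewrite /tfun /G /P (bigD1 j) //= !mxE !eqxx /= mulr1 -mulrA [X in c * X]mulrC.
  congr (c * (_ * _)); apply: eq_bigr => i ij.
  by rewrite !mxE (negbTE ij) andbF mulr0 add0r.
have -> : partial j (tfun c al be n) x = derive G (x 0 j) 1.
  rewrite /partial /derive; set F1 := (fun _ : R => _); set F2 := (fun _ : R => _).
  suff -> : F1 = F2 by [].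
  apply/funext => h; rewrite /F1 /F2 /= E; congr (_ *: (_ - _)).
  by have := E 0; rewrite scale0r add0r mul0r add0r.
have D1 : is_derive (x 0 j) 1 (fun t : R => al j * t + be j) (al j).
  have D : is_derive (x 0 j) 1 (fun t : R => al j * t + be j) (al j *: 1 + 0).
    apply: is_deriveD; apply: is_deriveZ.
  by apply: is_derive_eq D _; rewrite addr0 -[al j *: _]/(al j * 1) mulr1.
have D2 := @is_derive1_comp _ (dbump (n j)) _ _ _ _ (dbump_derive (n j) _) D1.
have D3 := @is_deriveZ _ _ _ _ (P * al j ^+ n j) _ _ _ D2.
have -> : G = (P * al j ^+ n j) \*: (dbump (n j) \o (fun t => al j * t + be j)).
  by apply/funext => t; rewrite /G mulrA.
rewrite (@derive_val _ _ _ _ _ _ _ D3) /tfun (bigD1 j) //= /incr eqxx add1n exprS.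
rewrite (eq_bigr (fun i => al i ^+ n i * dbump (n i) (al i * x 0 i + be i))) => [|i ij].
  by rewrite /P /GRing.scale /=; ring.
by rewrite (negbTE ij).
Qed.

Lemma differentiable_prod (I : Type) (r : seq I) (F : I -> 'rV[R]_d -> R) x :
  (forall i, differentiable (F i) x) -> differentiable (fun y => \prod_(i <- r) F i y) x.
Proof.
move=> H; elim: r => [|i r IH].
  by under eq_fun do rewrite big_nil; exact: differentiable_cst.
under eq_fun do rewrite big_cons.
exact: (@differentiableM _ _ (F i) (fun y => \prod_(i <- r) F i y)).
Qed.

Lemma differentiable_tfun c al be n x : differentiable (tfun c al be n) x.
Proof.
rewrite /tfun; apply: (@differentiableM _ _ (fun=> c)); first exact: differentiable_cst.
apply: differentiable_prod => j.
have D1 : is_derive (x 0 j) 1 (fun t : R => al j * t + be j) (al j).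
  have D : is_derive (x 0 j) 1 (fun t : R => al j * t + be j) (al j *: 1 + 0).
    apply: is_deriveD; apply: is_deriveZ.
  by apply: is_derive_eq D _; rewrite addr0 -[al j *: _]/(al j * 1) mulr1.
have D2 := @is_derive1_comp _ (dbump (n j)) _ _ _ _ (dbump_derive (n j) _) D1.
have D3 := @is_deriveZ _ _ _ _ (al j ^+ n j) _ _ _ D2.
have [D4 _] := D3; move/derivable1_diffP in D4.
exact: (@differentiable_comp _ _ _ _ (fun y : 'rV[R]_d => y 0 j) _ x
  (differentiable_coord _ _ _) D4).
Qed.

Lemma iterp_tfun c al be js n :
  iterp js (tfun c al be n) = tfun c al be (foldr (fun j n => incr n j) n js).
Proof. by elim: js => //= j js ->; rewrite partial_tfun. Qed.

Lemma smooth_tfun c al be n : smooth (tfun c al be n).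
Proof. by move=> js x; rewrite iterp_tfun; exact: differentiable_tfun. Qed.

Lemma multipartial_tfun c al be b :
  multipartial b (tfun c al be (fun=> 0%N)) = tfun c al be b.
Proof.
rewrite /multipartial.
have H l : uniq l -> foldr (fun j g => iter (b j) (partial j) g) (tfun c al be (fun=> 0%N)) l
    = tfun c al be (fun j => if j \in l then b j else 0%N).
  elim: l => [|j l IH] //= /andP[jl ul]; rewrite IH //.
  have it k n : iter k (partial j) (tfun c al be n)
      = tfun c al be (fun i => ((i == j) * k + n i)%N).
    elim: k => [|k /= ->]; first by congr tfun; apply/funext => i; rewrite muln0.
    rewrite partial_tfun; congr tfun; apply/funext => i.
    by rewrite /incr mulnS addnA.
  rewrite it; congr tfun; apply/funext => i; rewrite inE.
  by case: eqP => [->|_] /=; rewrite ?(negbTE jl) ?mul1n ?addn0 ?mul0n ?add0n.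
rewrite H ?enum_uniq //; congr tfun; apply/funext => j.
by rewrite mem_enum.
Qed.

Lemma dbump_bound_upto (k : nat) : exists2 C : R, 1 <= C &
  forall i t, (i <= k)%N -> `|dbump i t| <= C.
Proof.
have /choice[f Hf] i : exists C : R, 0 <= C /\ forall t, `|dbump i t| <= C.
  by have [C ? ?] := dbump_bounded R i; exists C.
have S0 : 0 <= \sum_(i < k.+1) f i by apply: sumr_ge0 => i _; case: (Hf i).
exists (1 + \sum_(i < k.+1) f i) => [|i t ik]; first by rewrite lerDl.
apply: le_trans ((Hf i).2 t) _; rewrite (bigD1 (inord i)) //= inordK //.
by rewrite addrCA lerDl addr_ge0 // sumr_ge0 // => l _; case: (Hf l).
Qed.

Definition chi (h : R) (k : Zd) : R := \prod_j bump ((k j)%:~R / h ^+ s j).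

Lemma chi_ge0 h k : 0 <= chi h k.
Proof. by apply: prodr_ge0 => j _; exact: bump_ge0. Qed.

Lemma chi_supp h k : 0 < h -> chi h k != 0 -> forall j, `|(k j)%:~R| < h ^+ s j / 2.
Proof.
move=> h0 nz j; rewrite ltNge; apply: contra nz => kj.
have hs : 0 < h ^+ s j by rewrite exprn_gt0.
rewrite /chi (bigD1 j) //= bump_out ?mul0r //.
by rewrite normrM normfV [`|_ ^+ _|]gtr0_norm // ler_pdivlMr // mulrC mulrA mulr1.
Qed.

Definition avgB (h : R) : nat := \max_j Num.truncn (h ^+ s j).
Local Notation idx h := {ffun 'I_d -> 'I_((avgB h).*2.+1)}.

Definition avgZ (h : R) : R := \sum_(t : idx h) chi h (bx t).

(** Zero weights are dropped because [tsupp] constrains every entry of the list, while the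
    enumerated cube may exceed the anisotropic support of [chi]. *)
Definition avg (h : R) : tp :=
  [seq ((chi h (bx t) / avgZ h)%:C%C, bx t) | t : idx h <- enum {: idx h} & chi h (bx t) != 0].

Lemma chi_inbox h k : 1 <= h -> chi h k != 0 -> inbox (avgB h) k.
Proof.
move=> h1 nz; have h0 : 0 < h by apply: lt_le_trans h1.
apply/forallP => j; have := chi_supp h0 nz j => kj.
apply: leq_trans (_ : Num.truncn (h ^+ s j) <= _)%N; last first.
  exact: (leq_bigmax (F := fun j => Num.truncn (h ^+ s j))).
rewrite -(ler_nat R); have hs : 0 < h ^+ s j by rewrite exprn_gt0.
have : `|k j|%N%:R < h ^+ s j.
  rewrite natr_absz intr_norm; apply: lt_le_trans kj _; lra.
move=> lt; rewrite ler_nat -ltnS -(ltr_nat R).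
by apply: lt_trans lt _; exact: truncnS_gt.
Qed.

Lemma lin_avg h f : lin (avg h) f =
  (avgZ h)^-1%:C%C * \sum_(t : idx h) (chi h (bx t))%:C%C * f (bx t).
Proof.
rewrite /lin big_map big_filter big_enum_cond /= mulr_sumr.
rewrite big_mkcond /=; apply: eq_bigr => t _.
case: eqP => [->|_] /=; first by rewrite mul0r mulr0.
by rewrite rmorphM /= mulrAC mulrC.
Qed.

Lemma avgZ_ge : exists2 c : R, 0 < c & forall h, 1 <= h -> c * h ^+ ssum s <= avgZ h.
Proof.
have [c c0 Hc] := bump_in R.
exists ((c / 4) ^+ d) => [|h h1]; first by rewrite exprn_gt0 // divr_gt0.
have h0 : 0 < h by apply: lt_le_trans h1.
have -> : avgZ h = \prod_j \sum_(t < (avgB h).*2.+1)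
    bump (((t : nat)%:Z - (avgB h)%:Z)%:~R / h ^+ s j).
  by rewrite bigA_distr_bigA; apply: eq_bigr => t _; apply: eq_bigr => j _; rewrite ffunE.
rewrite -[d in _ ^+ d]card_ord -prodr_const /ssum expr_sum -big_split /=.
apply: ler_prod => j _; apply/andP; split.
  by rewrite mulr_ge0 ?exprn_ge0 ?divr_ge0 ?(ltW c0) ?(ltW h0).
have hs : 0 < h ^+ s j by rewrite exprn_gt0.
set B := avgB h; pose N := Num.truncn (h ^+ s j / 4).
have hB : h ^+ s j < B.+1%:R.
  apply: lt_le_trans (truncnS_gt _) _; rewrite ler_nat ltnS.
  exact: (leq_bigmax (F := fun j => Num.truncn (h ^+ s j))).
have N1 : N%:R <= h ^+ s j / 4 by rewrite truncn_le // divr_ge0 // ltW.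
have NB : (N <= B)%N.
  rewrite -ltnS -(ltr_nat R); apply: le_lt_trans hB; apply: le_trans N1 _; lra.
have N2 : h ^+ s j / 4 < N.+1%:R by exact: truncnS_gt.
(* The middle block consists of the lattice coordinates 0, ..., N with N <= h^(s j) / 4, where the
   bump is at least c; there are N + 1 > h^(s j) / 4 of them. *)
have -> : B.*2.+1 = (B + (N.+1 + (B - N)))%N by rewrite addSn subnKC //; lia.
rewrite !big_split_ord /=.
apply: le_trans (_ : \sum_(i < N.+1) c <= _).
  rewrite sumr_const card_ord -[leRHS]mulr_natr mulrAC -mulrA ler_pM2l //.
  exact: ltW.
rewrite -[leLHS]add0r; apply: lerD; first by apply: sumr_ge0 => i _; exact: bump_ge0.
rewrite -[leLHS]addr0; apply: lerD; last by apply: sumr_ge0 => i _; exact: bump_ge0.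
apply: ler_sum => i _; apply: Hc.
rewrite PoszD addrC addKr normrM normfV [`|h ^+ _|]gtr0_norm // ler_pdivrMr //.
rewrite -pmulrn normr_nat; apply: le_trans (_ : N%:R <= _); last lra.
by rewrite ler_nat -ltnS.
Qed.

Lemma avgZ_gt0 h : 1 <= h -> 0 < avgZ h.
Proof.
move=> h1; have [c c0 Hc] := avgZ_ge; apply: lt_le_trans (Hc h h1).
by rewrite mulr_gt0 // exprn_gt0 // (lt_le_trans _ h1).
Qed.

Lemma lin_avg1 h : 1 <= h -> lin (avg h) (fun=> 1) = 1.
Proof.
move=> h1; rewrite lin_avg; under eq_bigr do rewrite mulr1.
rewrite -rmorph_sum /= -/(avgZ h) -rmorphM /= mulVf //.
by rewrite gt_eqF // avgZ_gt0.
Qed.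

Lemma l1_avgE h : 1 <= h -> l1 (avg h) = 1.
Proof.
move=> h1; rewrite /l1 big_map big_filter big_enum_cond /= big_mkcond /=.
have Z0 := avgZ_gt0 h1.
transitivity (\sum_(t : idx h) chi h (bx t) / avgZ h); last first.
  by rewrite -mulr_suml divff // gt_eqF.
apply: eq_bigr => t _; case: eqP => [->|_] /=; first by rewrite mul0r.
by rewrite nrm_real ger0_norm // divr_ge0 ?chi_ge0 // ltW.
Qed.

Lemma tsupp_avgE h : 1 <= h -> tsupp s h (avg h).
Proof.
move=> h1 x /mapP[t]; rewrite mem_filter => /andP[nz _] -> j /=.
have h0 : 0 < h by apply: lt_le_trans h1.
have hs : 0 < h ^+ s j by rewrite exprn_gt0.
apply: le_trans (ltW (chi_supp h0 nz j)) _; lra.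
Qed.

(* At scale 1 the bump only sees the centre of its support. *)
Lemma act_avg_one f : act (avg 1) f =1 f.
Proof.
move=> y; rewrite /act.
transitivity (lin (avg 1) (fun=> 1) * f y); last by rewrite lin_avg1 ?mul1r.
rewrite -lin_mulfr /lin big_seq [RHS]big_seq; apply: eq_bigr => x.
move=> /mapP[t]; rewrite mem_filter => /andP[nz _] -> /=.
suff -> : bx t = 0 by rewrite addr0 mul1r.
apply/ffunP => j; rewrite [RHS]ffunE; apply/eqP; apply: contraT => tj.
have := chi_supp ltr01 nz j; rewrite expr1n -intr_norm.
have : 1 <= `|bx t j|%:~R :> R.
  by rewrite -[1]/(1%:~R) ler_int; move: (bx t j) tj => x0; lia.
by move: (`|bx t j|%:~R : R) => X l1 l2; exfalso; lra.
Qed.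

(** What the seminorm of L U says about a single U_x after recentring and rescaling: test functions
    sit at 0 only, at scales at least 1. *)
Definition tested (k : nat) (K gam : R) (V : Zd -> R[i]) := forall phi lam,
  testB s k phi -> 1 <= lam ->
  nrm (\sum_(y \in [set: Zd]) (V y * (rescaled s phi lam (pos s 1 0) (pos s 1 y))%:C%C))%R
    <= K * powR lam gam.

(** The average around z at scale h is one test function centred at 0 of scale lam. Squeezing the
    bump by q = lam / h costs q^k in the derivatives of weight up to k, and another q^(ssum s)
    because the average is normalised at scale h and the test function at scale lam. *)
Lemma avg_tested k : exists2 C : R, 0 <= C & forall K gam V h z lam, 0 <= K ->
  tested k K gam V -> 1 <= h -> 2 * (1 + d%:R) * (rho R s z + h) <= lam ->
  nrm (act (avg h) V z) <= C * (lam / h) ^+ (k + ssum s) * (K * powR lam gam).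
Proof.
have [cZ cZ0 HZ] := avgZ_ge.
have [Cb Cb1 HCb] := dbump_bound_upto k.
have Cb0 : 0 < Cb by apply: lt_le_trans Cb1.
have C10 : 0 < Cb ^+ d by rewrite exprn_gt0.
exists (Cb ^+ d / cZ) => [|K gam V h z lam K0 HV h1 laml]; first by rewrite divr_ge0 // ltW.
have h0 : 0 < h by apply: lt_le_trans h1.
have d0 : 0 <= d%:R :> R by [].
have rh : h <= rho R s z + h by rewrite lerDr rho_ge0.
have lamh : h <= lam by apply: le_trans laml; nra.
have lam1 : 1 <= lam by apply: le_trans lamh.
have lam0 : 0 < lam by apply: lt_le_trans lam1.
pose q := lam / h.
have q1 : 1 <= q by rewrite ler_pdivlMr // mul1r.
have q0 : 0 < q by apply: lt_le_trans q1.
(* Normalises [phi] for [testB]: a derivative of weight at most k costs at most q^k, and each of the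
   d bump factors at most [Cb]. *)
pose c0 := (q ^+ k * Cb ^+ d)^-1.
have c00 : 0 < c0 by rewrite invr_gt0 mulr_gt0 // exprn_gt0.
pose al j := q ^+ s j.
pose be j := - (z j)%:~R / h ^+ s j.
pose phi := tfun c0 al be (fun=> 0%N).
have hs j : 0 < h ^+ s j by rewrite exprn_gt0.
have phiE x : phi x = c0 * \prod_j bump (al j * x 0 j + be j).
  by rewrite /phi /tfun; congr (_ * _); apply: eq_bigr => j _; rewrite expr0 mul1r.
have Bphi : testB s k phi.
  split; first exact: smooth_tfun.
  split.
    exists (1 / 2); split; first lra.
    move=> y; apply: contraTeq => nz; rewrite -ltNge.
    (* The d coordinates of a support point then contribute less than 1/2 in total; the factor 2 (1
       + d) in the lower bound on lam is made for this. *)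
    have small j : powR `|y 0 j| (s j)%:R^-1 <= (2 * (1 + d%:R))^-1.
      have b : `|al j * y 0 j + be j| < 1 / 2.
        rewrite ltNge; apply: contra nz => b.
        by rewrite phiE (bigD1 j) //= bump_out // mul0r mulr0.
      rewrite -(@ler_pXn2r _ (s j)) ?nnegrE ?powR_ge0 ?invr_ge0 ?mulr_ge0 ?addr_ge0 //.
      rewrite powR_root //.
      apply: le_trans (_ : ((rho R s z + h) / lam) ^+ s j <= _); last first.
        rewrite lerXn2r ?nnegrE ?divr_ge0 ?addr_ge0 ?rho_ge0 ?(ltW h0) ?(ltW lam0) //.
        rewrite ler_pdivrMr // ler_pdivlMl // mulr_gt0 // ltr_pwDl //.
      rewrite expr_div_n ler_pdivlMr ?exprn_gt0 //.
      apply: le_trans (_ : rho R s z ^+ s j + h ^+ s j <= _); last first.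
        by apply: exprD_le; rewrite ?rho_ge0 ?(ltW h0).
      have E : y 0 j * lam ^+ s j = (al j * y 0 j + be j) * h ^+ s j + (z j)%:~R.
        by rewrite /al /be /q expr_div_n; field; rewrite gt_eqF.
      rewrite -[lam ^+ s j]gtr0_norm ?exprn_gt0 // -normrM E.
      apply: le_trans (ler_normD _ _) _; rewrite addrC; apply: lerD.
        exact: inB_rho.
      rewrite normrM [`|h ^+ _|]gtr0_norm // ler_piMl ?(ltW (hs j)) //; lra.
    rewrite /sdist; apply: le_lt_trans (_ : \sum_(j < d) (2 * (1 + d%:R))^-1 < _).
      by apply: ler_sum => j _; rewrite subr0 /rowfun; exact: small.
    rewrite sumr_const card_ord -[_ *+ d]mulr_natr ltr_pdivrMl; last first.
      by rewrite mulr_gt0 // ltr_pwDl.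
    lra.
  move=> b bk y; rewrite multipartial_tfun /tfun normrM gtr0_norm // normr_prod.
  rewrite ler_pdivrMl ?mulr_gt0 ?exprn_gt0 // mulr1.
  apply: le_trans (_ : \prod_j (q ^+ (s j * b j) * Cb) <= _).
    apply: ler_prod => j _; rewrite normr_ge0 /= normrM; apply: ler_pM => //.
      by rewrite ger0_norm ?exprn_ge0 ?(ltW q0) // -exprM.
    apply: HCb; apply: leq_trans bk; rewrite /wt (bigD1 j) //=.
    by apply: leq_trans (leq_addr _ _); rewrite leq_pmull.
  rewrite big_split /= prodr_const card_ord -expr_sum.
  by rewrite ler_wpM2r ?(ltW C10) // ler_weXn2l.
have := HV phi lam Bphi lam1.
have resc y : rescaled s phi lam (pos s 1 0) (pos s 1 y)
    = (lam ^+ ssum s)^-1 * (c0 * chi h (y - z)).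
  rewrite /rescaled phiE; congr (_ * (_ * _)); apply: eq_bigr => j _; congr bump.
  rewrite !mxE /pos expr1n !ffunE !mul1r subr0 intrD mulrNz /al /be /q expr_div_n.
  by field; rewrite !gt_eqF // exprn_gt0.
pose r := [seq z + bx t | t : idx h <- enum {: idx h}].
have ur : uniq r.
  rewrite map_inj_uniq ?enum_uniq // => t t' /addrI; exact: bx_inj.
rewrite (fsbigE r) //; last first.
  move=> y _ yr; rewrite resc.
  have [->|nz] := eqVneq (chi h (y - z)) 0; first by rewrite !mulr0.
  have [t E] := inboxP (chi_inbox h1 nz).
  case/negP: yr; apply/mapP; exists t; first by rewrite mem_enum.
  by rewrite -E addrC subrK.
rewrite big_mkcond /= big_map big_enum /=.
rewrite (eq_bigr (fun t : idx h => ((lam ^+ ssum s)^-1 * c0)%:C%C *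
    ((chi h (bx t))%:C%C * V (z + bx t)))) => [|t _]; last first.
  rewrite in_setT resc [z + _]addrC addrK mulrA !rmorphM /= -!mulrA mulrC -!mulrA.
  by congr (_ * (_ * _)); rewrite mulrC addrC.
rewrite -mulr_sumr; set S := \sum_(t : idx h) _ => HS.
rewrite /act lin_avg -/S Normc.normcM nrm_real.
have Zp := avgZ_gt0 h1.
rewrite Normc.normcM nrm_real ger0_norm in HS; last first.
  by rewrite mulr_ge0 ?(ltW c00) // invr_ge0 exprn_ge0 // ltW.
have HS' : nrm S <= lam ^+ ssum s * (q ^+ k * Cb ^+ d) * (K * powR lam gam).
  rewrite -ler_pdivrMl ?mulr_gt0 ?exprn_gt0 //; apply: le_trans HS.
  by rewrite invfM.
rewrite gtr0_norm ?invr_gt0 // ler_pdivrMl //.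
apply: le_trans HS' _.
apply: le_trans (_ : cZ * h ^+ ssum s * (Cb ^+ d / cZ * q ^+ (k + ssum s) *
   (K * powR lam gam)) <= _); last first.
  by rewrite ler_wpM2r ?HZ // !mulr_ge0 ?powR_ge0 ?exprn_ge0 ?invr_ge0 ?(ltW q0) ?(ltW Cb0) ?(ltW cZ0).
rewrite le_eqVlt; apply/orP; left; apply/eqP.
rewrite exprD {3}/q [(lam / h) ^+ _]expr_div_n.
by field; rewrite !gt_eqF // exprn_gt0.
Qed.

End TestFunctions.

(** * The estimate on the unit lattice *)

Section Core.
Variables (R : realType) (d : nat) (s : 'I_d -> nat).
Hypothesis s_gt0 : forall j, (0 < s j)%N.
Local Notation Zd := {ffun 'I_d -> int}.
Local Notation tp := (seq (R[i] * Zd)).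
Variables (L : tp) (m F : nat) (alpha eta : R).
Hypothesis m_gt0 : (0 < m)%N.
Hypothesis ordL : ord s m L.
Hypothesis symL : exists2 c : R, 0 < c & forall th,
  exists2 t, dom s t th & c * t ^+ m <= nrm (ev L th).
Hypotheses (alpha_gt0 : 0 < alpha) (alpha_eta : alpha < eta).
Hypotheses (F_eta : F%:R < eta) (eta_F : eta < F.+1%:R) (eta_m : eta < m%:R).
Variable j0 : 'I_d.

Local Notation heatL := (heat L).
Local Notation Hm := (Hs R m).
Local Notation rho := (rho R s).

Lemma eta_gt0 : 0 < eta. Proof. exact: lt_trans alpha_eta. Qed.
Lemma eta_ge0 : 0 <= eta. Proof. exact/ltW/eta_gt0. Qed.
Lemma F_lt_m : (F < m)%N. Proof. by rewrite -(ltr_nat R); exact: lt_trans eta_m. Qed.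

Lemma powR_le (x y r : R) : 0 <= r -> 0 <= x -> x <= y -> powR x r <= powR y r.
Proof.
by move=> r0 x0 xy; apply: ge0_ler_powR => //; rewrite nnegrE // (le_trans x0).
Qed.

Lemma powR_add (x r t : R) : 0 < x -> powR x (r + t) = powR x r * powR x t.
Proof. by move=> x0; rewrite powRD // (gt_eqF x0) implybT. Qed.

Lemma powR_sub (x r t : R) : 0 < x -> powR x (r - t) = powR x r / powR x t.
Proof. by move=> x0; rewrite powRB // (gt_eqF x0) implybT. Qed.

Definition growth (N : R) (u : Zd -> R[i]) := forall z, nrm (u z) <= N * powR (rho z) eta.

(** The index F + 1 makes u - [smoothed h u] equal to (1 - A)^(F+1) u, which vanishes for
    polynomials of degree at most F. *)
Definition smoothed (h : R) (u : Zd -> R[i]) : Zd -> R[i] :=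
  act (avg s h) (act (tavgQ (avg s h) F.+1) u).

Lemma smoothed_bound : exists2 C : R, 0 <= C & forall u N h z, 0 <= N -> 1 <= h ->
  growth N u -> nrm (smoothed h u z) <= C * N * powR (rho z + h) eta.
Proof.
pose D : R := d%:R + d%:R * (d%:R * F.+2%:R).
have D0 : 0 <= D by rewrite addr_ge0 // !mulr_ge0.
exists (2 ^+ F.+1 * powR D eta) => [|u N h z N0 h1 Hu].
  by rewrite mulr_ge0 ?exprn_ge0 ?powR_ge0.
have h0 : 0 <= h by apply: le_trans h1.
have [Q1 Q2] := avg_Q s_gt0 h0 (l1_avgE s h1) (tsupp_avgE h1) F.+1.
set p := tmul (avg s h) (tavgQ (avg s h) F.+1).
have p1 : l1 p <= 2 ^+ F.+1.
  by rewrite l1_mul (l1_avgE s h1) Q1 mul1r gerBl.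
have ps : tsupp s (h + F.+1%:R * h) p.
  by apply: tsupp_mul => //; rewrite ?mulr_ge0 //; exact: tsupp_avgE.
have -> : smoothed h u z = act p u z by rewrite act_mul.
apply: le_trans (_ : l1 p * (N * powR (D * (rho z + h)) eta) <= _).
  apply: nrm_lin => x xp; apply: le_trans (Hu _) _; rewrite ler_wpM2l //.
  apply: powR_le; rewrite ?eta_ge0 ?rho_ge0 //.
  apply: le_trans (rhoD R s_gt0 _ _) _.
  have := rho_le s_gt0 (addr_ge0 h0 (mulr_ge0 (ler0n _ F.+1) h0)) (ps x xp) => rx.
  apply: le_trans (_ : d%:R * (rho z + d%:R * (h + F.+1%:R * h)) <= _).
    by rewrite ler_wpM2l // lerD2l.
  rewrite (_ : h + F.+1%:R * h = F.+2%:R * h); last by rewrite -[F.+2%:R]nat1r mulrDl mul1r.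
  rewrite /D mulrDr [leRHS]mulrDl mulrDr -!addrA lerD2l.
  have rz : 0 <= rho z by exact: rho_ge0.
  have A1 : 0 <= d%:R * h by rewrite mulr_ge0.
  have A2 : 0 <= d%:R * (d%:R * F.+2%:R) * rho z by rewrite !mulr_ge0.
  rewrite mulrDr (_ : d%:R * (d%:R * (F.+2%:R * h)) = d%:R * (d%:R * F.+2%:R) * h); last by ring.
  by rewrite addrA lerDr addr_ge0.
rewrite powRM ?addr_ge0 ?rho_ge0 //.
rewrite [leRHS](_ : _ = 2 ^+ F.+1 * (N * (powR D eta * powR (rho z + h) eta))); last by ring.
by rewrite ler_wpM2r // !mulr_ge0 ?powR_ge0.
Qed.

Lemma smoothed_sz : exists2 C : R, 0 <= C & forall u N h H z k, 0 <= N -> 1 <= h ->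
  h <= H -> rho z <= d%:R * H -> growth N u ->
  nrm (smoothed h u (z + k)) <= C * N * powR H eta * sz s H k ^+ m.
Proof.
have [C C0 HC] := smoothed_bound.
pose D : R := d%:R * (d%:R + d%:R) + 1.
have D0 : 0 <= D by rewrite !addr_ge0 // mulr_ge0 // addr_ge0.
exists (C * powR D eta) => [|u N h H z k N0 h1 hH zH Hu].
  by rewrite mulr_ge0 ?powR_ge0.
apply: le_trans (HC u N h _ N0 h1 Hu) _.
have H0 : 0 < H by apply: lt_le_trans hH; apply: lt_le_trans h1.
have S1 := sz_ge1 s k H0.
have S0 : 0 <= sz s H k by apply: le_trans S1.
have le : rho (z + k) + h <= D * (H * sz s H k).
  have rk := rho_sz s_gt0 k H0.
  have HS : H <= H * sz s H k by rewrite ler_peMr // ltW.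
  apply: le_trans (lerD (rhoD R s_gt0 z k) hH) _.
  rewrite /D mulrDl mul1r; apply: lerD => //.
  rewrite -mulrA ler_wpM2l // mulrDl; apply: lerD => //.
  by apply: le_trans zH _; rewrite ler_wpM2l.
apply: le_trans (_ : C * N * powR (D * (H * sz s H k)) eta <= _).
  rewrite ler_wpM2l ?mulr_ge0 //; apply: powR_le => //; first exact: eta_ge0.
  by rewrite addr_ge0 ?rho_ge0 // (le_trans _ h1).
rewrite !powRM ?mulr_ge0 ?(ltW H0) //.
(* [sz] is at least 1 and eta < m, so the real power is bounded by an integer one, as [heat_act]
   requires. *)
have Sm : powR (sz s H k) eta <= sz s H k ^+ m.
  by rewrite -powR_mulrn //; apply: ler_powR => //; exact: ltW.
rewrite [leLHS](_ : _ = C * powR D eta * N * powR H eta * powR (sz s H k) eta); last by ring.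
by rewrite ler_wpM2l // !mulr_ge0 ?powR_ge0.
Qed.

Lemma smooth_part js : exists2 C : R, 0 <= C & forall u N h n z, 0 <= N -> 1 <= h ->
  h <= Hm n -> rho z <= d%:R * Hm n -> growth N u ->
  nrm (act (tmul (tDw R js) (tpow heatL n)) (smoothed h u) z)
    <= C * N * (powR (Hm n) eta / Hm n ^+ wts s js).
Proof.
have [C C0 HC] := smoothed_sz.
have [C' C'0 HC'] := hact s_gt0 m_gt0 ordL symL j0 m (ord_tDw R s js).
exists (C' * C) => [|u N h n z N0 h1 hH zH Hu]; first exact: mulr_ge0.
apply: le_trans (HC' (Hm n) n (smoothed h u) z (C * N * powR (Hm n) eta) _ _ _ _) _.
- exact: Hs_ge1.
- exact: HsX.
- by rewrite !mulr_ge0 ?powR_ge0.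
- by move=> k; exact: HC.
by rewrite le_eqVlt; apply/orP; left; apply/eqP; ring.
Qed.

Variable k0 : nat.

(** This is L applied to [smoothed h u], commuted so that [avg] meets L u directly and [avg_tested]
    applies. *)
Definition corrf (h : R) (u : Zd -> R[i]) : Zd -> R[i] :=
  act (tavgQ (avg s h) F.+1) (act (avg s h) (act L u)).

Lemma corrf_bound (tau : R) : 0 < tau -> tau <= 1 -> exists2 C : R, 0 <= C &
  forall K u h H z k r, 0 <= K -> tested s k0 K (eta - m%:R) (act L u) ->
  1 <= h -> tau * r <= h -> h <= r -> r <= H -> tau * H <= r -> rho z <= r ->
  nrm (corrf h u (z + k)) <= C * K * powR r (eta - m%:R) * sz s H k ^+ (k0 + ssum s).
Proof.
move=> tau0 tau1.
have [C C0 HC] := @avg_tested R d s s_gt0 k0.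
pose D : R := d%:R * (d%:R * (1 + d%:R) + d%:R * F.+1%:R).
pose E : R := 2 * (1 + d%:R) * (D + 1) / tau ^+ 2.
have D0 : 0 <= D by rewrite mulr_ge0 // addr_ge0 // mulr_ge0 // addr_ge0.
have E0 : 0 <= E by rewrite divr_ge0 ?exprn_ge0 ?(ltW tau0) // !mulr_ge0 ?addr_ge0.
set e := eta - m%:R.
have e0 : e <= 0 by rewrite subr_le0 ltW.
exists (2 ^+ F.+1 * (C * E ^+ (k0 + ssum s) * powR tau e)) => [|K u h H z k r K0 HV h1 rh hr rH Hr zr].
  by rewrite !mulr_ge0 ?exprn_ge0 ?powR_ge0.
have h0 : 0 < h by apply: lt_le_trans h1.
have r0 : 0 < r by apply: lt_le_trans hr.
have H0 : 0 < H by apply: lt_le_trans rH.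
have S1 := sz_ge1 s k H0; set S := sz s H k in S1 *.
have S0 : 0 <= S by apply: le_trans S1.
have HV' z' lam := HC K e (act L u) h z' lam K0 HV h1.
have [Q1 Q2] := avg_Q s_gt0 (ltW h0) (l1_avgE s h1) (tsupp_avgE h1) F.+1.
apply: le_trans (_ : l1 (tavgQ (avg s h) F.+1) *
    (C * (E * S) ^+ (k0 + ssum s) * (K * powR (tau * r) e)) <= _).
  apply: nrm_lin => x xQ; set z' := z + k + x.2.
  pose lam := 2 * (1 + d%:R) * (rho z' + h).
  apply: le_trans (HV' z' lam (lexx _)) _.
  have rk := rho_sz s_gt0 k H0.
  have rx := rho_le s_gt0 (mulr_ge0 (ler0n _ F.+1) (ltW h0)) (Q2 x xQ).
  have rz' : rho z' <= D * (H * S).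
    apply: le_trans (rhoD R s_gt0 _ _) _; rewrite /D -mulrA ler_wpM2l //.
    have rS : r <= H * S by apply: le_trans rH _; rewrite ler_peMr // ltW.
    rewrite mulrDl; apply: lerD.
      apply: le_trans (rhoD R s_gt0 _ _) _; rewrite -mulrA ler_wpM2l // mulrDl mul1r.
      by apply: lerD => //; apply: le_trans zr _.
    apply: le_trans rx _; rewrite -mulrA ler_wpM2l // ler_wpM2l //.
    exact: le_trans hr _.
  have lamh : h <= lam.
    have d0 : 0 <= d%:R :> R by [].
    have := rho_ge0 R s z' => p0; rewrite /lam; nra.
  have lam0 : 0 < lam by apply: lt_le_trans lamh.
  have lr : lam / h <= E * S.
    rewrite ler_pdivrMr // /lam /E.
    have -> : 2 * (1 + d%:R) * (D + 1) / tau ^+ 2 * S * h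
       = 2 * (1 + d%:R) * ((D + 1) * (h / tau ^+ 2 * S)) by ring.
    rewrite ler_wpM2l ?mulr_ge0 ?addr_ge0 // mulrDl mul1r.
    (* One factor tau leads from H to r, the other from r to h. *)
    have hH : H <= h / tau ^+ 2.
      rewrite ler_pdivlMr ?exprn_gt0 // expr2 mulrCA.
      by apply: le_trans rh; rewrite ler_wpM2l ?(ltW tau0) // mulrC.
    have HSh : H * S <= h / tau ^+ 2 * S by rewrite ler_wpM2r.
    apply: lerD; first by apply: le_trans rz' _; rewrite ler_wpM2l.
    by apply: le_trans hr _; apply: le_trans rH _; apply: le_trans HSh; rewrite ler_peMr // ltW.
  have q0 : 0 <= lam / h by rewrite divr_ge0 ?(ltW lam0) ?(ltW h0).
  have es0 : 0 <= E * S by rewrite mulr_ge0.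
  apply: ler_pM; rewrite ?mulr_ge0 ?exprn_ge0 ?powR_ge0 //.
    by rewrite ler_wpM2l // lerXn2r ?nnegrE.
  rewrite ler_wpM2l //.
  have tr0 : 0 < tau * r by rewrite mulr_gt0.
  have [b b0 ->] : exists2 b, 0 <= b & e = - b by exists (- e); rewrite ?oppr_ge0 ?opprK.
  rewrite !powRN lef_pV2 ?posrE ?powR_gt0 //.
  by apply: powR_le; rewrite ?(ltW tr0) //; exact: le_trans lamh.
have Q3 : l1 (tavgQ (avg s h) F.+1) <= 2 ^+ F.+1 by rewrite Q1 gerBl.
rewrite powRM ?(ltW tau0) ?(ltW r0) // exprMn.
set G := _ ^+ (k0 + ssum s); set G' := S ^+ _.
rewrite [leRHS](_ : _ = 2 ^+ F.+1 * (C * (G * G') * (K * (powR tau e * powR r e)))); last by ring.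
by rewrite ler_wpM2r // !mulr_ge0 ?powR_ge0 ?exprn_ge0.
Qed.

Lemma corr_part (tau : R) js : 0 < tau -> tau <= 1 -> (wts s js < m)%N ->
  exists2 C : R, 0 <= C &
  forall K u h n n' z r, 0 <= K -> tested s k0 K (eta - m%:R) (act L u) ->
  1 <= h -> tau * r <= h -> h <= r -> r <= Hm n -> tau * Hm n <= r -> rho z <= r ->
  nrm (\sum_(n' <= l < n)
     act (tmul (tmul (tDw R js) (Ladj L)) (tpow heatL l)) (corrf h u) z)
    <= C * K * (powR r eta / r ^+ wts s js).
Proof.
move=> tau0 tau1 jsm.
have [C C0 HC] := corrf_bound tau0 tau1.
have [C' C'0 HC'] := heat_corr s_gt0 m_gt0 ordL symL j0 (k0 + ssum s) (ord_tDw R s js) jsm.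
set q := (m - wts s js)%N.
exists (C' * C / tau ^+ q) => [|K u h n n' z r K0 HV h1 rh hr rH Hr zr].
  by rewrite !mulr_ge0 ?invr_ge0 ?exprn_ge0 ?(ltW tau0).
have r0 : 0 < r by apply: lt_le_trans hr; apply: lt_le_trans h1.
apply: le_trans (HC' n' n _ z (C * K * powR r (eta - m%:R)) _ _) _.
- by rewrite !mulr_ge0 ?powR_ge0.
- by move=> k; exact: (HC K u h (Hm n) z k r).
have Hq : Hm n ^+ q <= (r / tau) ^+ q.
  rewrite lerXn2r ?nnegrE ?powR_ge0 ?divr_ge0 ?(ltW r0) ?(ltW tau0) //.
  by rewrite ler_pdivlMr // mulrC.
apply: le_trans (ler_wpM2l _ Hq) _; first by rewrite !mulr_ge0 ?powR_ge0.
rewrite powR_sub // powR_mulrn ?(ltW r0) // expr_div_n.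
have -> : r ^+ m = r ^+ q * r ^+ wts s js by rewrite -exprD subnK // ltnW.
rewrite le_eqVlt; apply/orP; left; apply/eqP.
by field; rewrite !gt_eqF ?exprn_gt0.
Qed.


(** The operator annihilates P, so u may be replaced by v + (u - v - P). Here v plays the role of
    the germ based at y: around y it is only of size N h^eta, and this is where a small h beats
    N. *)
Lemma local_part : exists2 C : R, 0 <= C & forall u v P N K y h, 0 <= N -> 0 <= K ->
  1 <= h -> h <= rho y -> is_pol F.+1 P ->
  (forall z, nrm (v z) <= N * powR (rho (z - y)) eta) ->
  (forall z, nrm (u z - v z - P z) <= K * powR (rho (z - y)) alpha
     * powR (rho y + rho (z - y)) (eta - alpha)) ->
  nrm (act (tpow (tavg (avg s h)) F.+1) u y) <= C * (N * powR h eta + K * powR (rho y) eta).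
Proof.
pose D : R := 1 + d%:R * F.+1%:R.
have dF0 : 0 <= d%:R * F.+1%:R :> R by rewrite mulr_ge0.
have D1 : 1 <= D by rewrite lerDl.
have D0 : 0 < D by apply: lt_le_trans D1.
exists (2 ^+ F.+1 * powR D eta) => [|u v P N K y h N0 K0 h1 hy HP Hv HuvP].
  by rewrite mulr_ge0 ?exprn_ge0 ?powR_ge0.
have h0 : 0 < h by apply: lt_le_trans h1.
have r0 : 0 < rho y by apply: lt_le_trans hy.
have [Q1 Q2] := avg_pow s_gt0 (ltW h0) (l1_avgE s h1) (tsupp_avgE h1) F.+1.
set p := tpow _ _ in Q1 Q2 *.
have -> : act p u y = act p (fun z => u z - P z) y.
  have := act_addf p (fun z => u z - P z) P y.
  rewrite (avg_kills (lin_avg1 s h1) y HP) addr0 => <-.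
  by apply: eq_act => z; rewrite subrK.
apply: le_trans (_ : l1 p * (powR D eta * (N * powR h eta + K * powR (rho y) eta)) <= _); last first.
  by rewrite Q1 mulrA.
apply: nrm_lin => x xp; rewrite /=.
have rx : rho x.2 <= d%:R * F.+1%:R * h.
  by rewrite -mulrA; apply: rho_le; rewrite ?mulr_ge0 ?(ltW h0) //; exact: Q2.
have -> : u (y + x.2) - P (y + x.2)
    = v (y + x.2) + (u (y + x.2) - v (y + x.2) - P (y + x.2)) by ring.
apply: le_trans (nrmD _ _) _; rewrite mulrDr; apply: lerD.
  apply: le_trans (Hv _) _; rewrite mulrCA ler_wpM2l // -powRM ?(ltW D0) ?(ltW h0) //.
  apply: powR_le; rewrite ?eta_ge0 ?rho_ge0 // [y + _]addrC addrK.
  by apply: le_trans rx _; rewrite ler_wpM2r ?(ltW h0) // lerDr.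
apply: le_trans (HuvP _) _; rewrite [y + _]addrC addrK.
have b1 : powR (rho x.2) alpha <= powR (D * rho y) alpha.
  apply: powR_le; rewrite ?(ltW alpha_gt0) ?rho_ge0 //; apply: le_trans rx _.
  by apply: ler_pM => //; rewrite ?(ltW h0) // lerDr.
have b2 : powR (rho y + rho x.2) (eta - alpha) <= powR (D * rho y) (eta - alpha).
  apply: powR_le; rewrite ?subr_ge0 ?(ltW alpha_eta) ?addr_ge0 ?rho_ge0 //.
  rewrite /D mulrDl mul1r lerD2l; apply: le_trans rx _.
  by rewrite ler_wpM2l.
apply: le_trans (_ : K * (powR (D * rho y) alpha * powR (D * rho y) (eta - alpha)) <= _).
  rewrite -mulrA; apply: (ler_wpM2l K0).
  exact: (ler_pM (powR_ge0 _ _) (powR_ge0 _ _) b1 b2).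
rewrite -powR_add ?mulr_gt0 // addrC subrK powRM ?(ltW D0) ?(ltW r0) //.
by rewrite mulrCA.
Qed.

Lemma powR_small (A p : R) : 0 <= A -> 0 < p -> exists2 t, 0 < t &
  forall x, 0 < x -> x <= t -> A * powR x p <= 1 / 4.
Proof.
move=> A0 p0; pose b : R := (4 * (A + 1))^-1.
have b0 : 0 < b by rewrite invr_gt0 mulr_gt0 // ltr_pwDr.
exists (powR b p^-1) => [|x x0 xt]; first by rewrite powR_gt0.
have : powR x p <= b.
  apply: le_trans (_ : powR (powR b p^-1) p <= _); first by apply: powR_le; rewrite ?(ltW p0) ?(ltW x0).
  by rewrite -powRrM mulVf ?powRr1 ?(ltW b0) // gt_eqF.
move=> xb; apply: le_trans (ler_wpM2l A0 xb) _.
rewrite ler_pdivrMr ?mulr_gt0 ?ltr_pwDr //; lra.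
Qed.

(** n = floor(h^(2m)) gives h^(2m) < n + 1 <= 2 h^(2m), and 2 <= 2^(2m). *)
Lemma Hs_pick (h : R) : 1 <= h -> h <= Hm (Num.truncn (h ^+ (2 * m))) <= 2 * h.
Proof.
move=> h1; have h0 : 0 < h by apply: lt_le_trans h1.
set n := Num.truncn _.
have m2 : (0 < 2 * m)%N by rewrite muln_gt0.
have hm : 0 <= h ^+ (2 * m) by rewrite exprn_ge0 // ltW.
apply/andP; split.
  rewrite -(@ler_pXn2r _ (2 * m)) ?nnegrE ?powR_ge0 ?(ltW h0) // HsX //.
  exact/ltW/truncnS_gt.
rewrite -(@ler_pXn2r _ (2 * m)) ?nnegrE ?powR_ge0 ?mulr_ge0 ?(ltW h0) // HsX //.
have nh : n%:R <= h ^+ (2 * m) by rewrite truncn_le.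
have hm1 : 1 <= h ^+ (2 * m) by exact: exprn_ege1.
rewrite -natr1 exprMn; apply: le_trans (_ : 2 * h ^+ (2 * m) <= _).
  by rewrite mulr_natl mulr2n lerD.
apply: ler_wpM2r => //; rewrite -[leLHS]expr1; apply: ler_weXn2l => //.
by rewrite ler1n.
Qed.

(** A statement about a single u = U_x recentred at 0; v and P stand for U_y and the polynomial of
    the three-point seminorm. As C does not depend on N, the improvement from N to N / 2 can be
    absorbed. *)
Theorem core_estimate : exists2 C : R, 0 <= C & forall u N K K', 0 <= N -> 0 <= K -> 0 <= K' ->
  growth N u -> tested s k0 K (eta - m%:R) (act L u) ->
  (forall y, exists v P, [/\ is_pol F.+1 P,
     forall z, nrm (v z) <= N * powR (rho (z - y)) eta &
     forall z, nrm (u z - v z - P z) <= K' * powR (rho (z - y)) alpha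
       * powR (rho y + rho (z - y)) (eta - alpha)]) ->
  (forall js, (wts s js <= F)%N -> act (tDw R js) u 0 = 0) ->
  forall y, nrm (u y) <= (N / 2 + C * (K + K')) * powR (rho y) eta.
Proof.
have [C1 C10 HC1] := local_part.
have [|//|CS CS0 HCS] := @words_bound R d (fun js C => forall u N h n z, 0 <= N -> 1 <= h ->
  h <= Hm n -> rho z <= d%:R * Hm n -> growth N u ->
  nrm (act (tmul (tDw R js) (tpow heatL n)) (smoothed h u) z)
    <= C * N * (powR (Hm n) eta / Hm n ^+ wts s js)) _ _ (F + ssum s).
- move=> js C C' CC' H u N h n z N0 h1 hH zH Hu; apply: le_trans (H u N h n z N0 h1 hH zH Hu) _.
  by rewrite ler_wpM2r ?ler_wpM2r // mulr_ge0 ?powR_ge0 // invr_ge0 exprn_ge0 // powR_ge0.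
- by move=> js; have [C _ HC] := smooth_part js; exists C.
pose Td : R := (1 + d%:R) ^+ F.+1.
have Td0 : 0 <= Td by rewrite exprn_ge0 // addr_ge0.
have p1 : 0 < eta - F%:R by rewrite subr_gt0.
have p2 : 0 < F.+1%:R - eta by rewrite subr_gt0.
have [t1 t10 Ht1] := powR_small (addr_ge0 C10 (mulr_ge0 Td0 CS0)) p1.
have [t2 t20 Ht2] := powR_small (mulr_ge0 Td0 CS0) p2.
(* kappa is t / 2. The halving matches the factor 2 lost in [Hs_pick]: from r / t <= Hm n <= 2 r / t
   one gets (t / 2) Hm n <= r, and at scale h one gets Hm n' <= 2 h = t r. *)
pose t := Num.min (1 / 2) (Num.min t1 t2).
have t0 : 0 < t by rewrite !lt_min t10 t20 !andbT divr_gt0.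
have th : t <= 1 / 2 by rewrite ge_min lexx.
have {Ht1} Ht1 := Ht1 t t0 (_ : t <= t1).
have {Ht2} Ht2 := Ht2 t t0 (_ : t <= t2).
have {Ht1} Ht1 : (C1 + Td * CS) * powR t (eta - F%:R) <= 1 / 4.
  by apply: Ht1; rewrite !ge_min lexx /= orbT.
have {Ht2} Ht2 : Td * CS * powR t (F.+1%:R - eta) <= 1 / 4.
  by apply: Ht2; rewrite !ge_min lexx /= !orbT.
have tau0 : 0 < t / 2 by rewrite divr_gt0.
have tau1 : t / 2 <= 1 by lra.
have tle1 : t <= 1 by lra.
have [|//|CT CT0 HCT] := @words_bound R d (fun js C => (wts s js < m)%N ->
  forall K u h n n' z r, 0 <= K -> tested s k0 K (eta - m%:R) (act L u) ->
  1 <= h -> t / 2 * r <= h -> h <= r -> r <= Hm n -> t / 2 * Hm n <= r -> rho z <= r ->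
  nrm (\sum_(n' <= l < n)
     act (tmul (tmul (tDw R js) (Ladj L)) (tpow heatL l)) (corrf h u) z)
    <= C * K * (powR r eta / r ^+ wts s js)) _ _ F.
- move=> js C C' CC' H jsm K u h n n' z r K0 HV h1 rh hr rH Hr zr.
  apply: le_trans (H jsm K u h n n' z r K0 HV h1 rh hr rH Hr zr) _.
  have r0 : 0 <= r by apply: le_trans hr; apply: le_trans h1.
  by rewrite ler_wpM2r ?ler_wpM2r // mulr_ge0 ?powR_ge0 // invr_ge0 exprn_ge0.
- move=> js; have [jsm|jsm] := ltnP (wts s js) m; last by exists 0.
  by have [C _ HC] := corr_part tau0 tau1 jsm; exists C.
exists (C1 + CT + Td * CT) => [|u N K K' N0 K0 K'0 Hu HV Hloc Hcen y].
  by rewrite !addr_ge0 // mulr_ge0.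
have [->|yn0] := eqVneq y 0.
  apply: le_trans (Hu 0) _; rewrite rho0 // powR0 ?mulr0 //.
  by rewrite gt_eqF // eta_gt0.
pose r := rho y.
have r1 : 1 <= r by exact: rho_ge1.
have r0 : 0 < r by apply: lt_le_trans r1.
(* Clipped at 1 because tests exist at scales at least 1 only. When the clip is active, [avg] acts
   as the identity. *)
pose h := Num.max 1 (t / 2 * r).
have h1 : 1 <= h by rewrite le_max lexx.
have h0 : 0 < h by apply: lt_le_trans h1.
have rh : t / 2 * r <= h by rewrite le_max lexx orbT.
have hr : h <= r by rewrite ge_max r1 ler_piMl // ltW.
have rt : r <= r / t by rewrite ler_pdivlMr // ler_piMr // ltW.
have rt1 : 1 <= r / t by exact: le_trans rt.
pose n := Num.truncn ((r / t) ^+ (2 * m)).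
have /andP[Hn1 Hn2] := Hs_pick rt1; rewrite -/n in Hn1 Hn2.
have rH : r <= Hm n by exact: le_trans Hn1.
have H0 : 0 < Hm n by apply: lt_le_trans rH.
have tH : t / 2 * Hm n <= r.
  apply: le_trans (ler_wpM2l (ltW tau0) Hn2) _.
  rewrite (_ : t / 2 * (2 * (r / t)) = r) //.
  by field; rewrite gt_eqF.
pose w := act (tpow heatL n) (smoothed h u).
have AC p q (f : Zd -> R[i]) : act p (act q f) = act q (act p f).
  by apply/funext => z; exact: act_mulC.
have AM p q (f : Zd -> R[i]) : act (tmul p q) f = act p (act q f).
  by apply/funext => z; exact: act_mul.
(* [D^js] of the smoothed function splits into its heat regularisation and a
   correction that only involves [L u]. *)
have TS p k : tpow p k.+1 = tmul p (tpow p k) :> tp by [].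
have avg_id f : t / 2 * r <= 1 -> act (tavg (avg s h)) f =1 fun=> 0.
  move=> ts z; have -> : h = 1 by rewrite /h /Num.max ltNge ts.
  by rewrite act_avg act_avg_one // subrr.
have smoothed_id : t / 2 * r <= 1 -> smoothed h u = u.
  move=> ts; apply/funext => z; rewrite [RHS](avg_split (avg s h) F.+1).
  by rewrite TS AM avg_id // add0r.
have tele js n' z : (n' <= n)%N ->
    act (tmul (tDw R js) (tpow heatL n')) (smoothed h u) z = act (tDw R js) w z
     + \sum_(n' <= l < n) act (tmul (tmul (tDw R js) (Ladj L)) (tpow heatL l)) (corrf h u) z.
  move=> nn; rewrite AM AC (heat_tele L _ _ nn) /w [act (tDw R js) (act _ _)]AC.
  congr (_ + _); apply: eq_bigr => l _.
  rewrite /smoothed /corrf !AM.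
  rewrite [act (avg s h) (act _ u)]AC [act L (act _ _)]AC [act L (act _ _)]AC [act L (act _ _)]AC.
  by rewrite [act (tpow _ _) (act (tDw R js) _)]AC [act (Ladj L) (act (tDw R js) _)]AC.
pose re := powR r eta.
have re0 : 0 <= re by exact: powR_ge0.
have reF : re = powR r F%:R * powR r (eta - F%:R) by rewrite -powR_add // addrC subrK.
have rw a : 0 < r ^+ a by exact: exprn_gt0.
pose X := (CS * N * powR t (eta - F%:R) + CS * N * powR t (F.+1%:R - eta) + CT * K) * re.
have XS1 : 0 <= CS * N * powR t (eta - F%:R) by rewrite !mulr_ge0 ?powR_ge0.
have XS2 : 0 <= CS * N * powR t (F.+1%:R - eta) by rewrite !mulr_ge0 ?powR_ge0.
have XT : 0 <= CT * K by rewrite mulr_ge0.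
have X0 : 0 <= X by rewrite mulr_ge0 // !addr_ge0.
have wbound : forall z, inB s r z -> nrm (w z) <= Td * X.
  apply: discrete_taylor => //.
  - move=> js jsF.
    have jsm : (wts s js < m)%N by apply: leq_ltn_trans jsF F_lt_m.
    have sj : (size js <= F)%N by apply: leq_trans jsF; exact: size_wts.
    have cor n' : nrm (\sum_(n' <= l < n) act (tmul (tmul (tDw R js) (Ladj L)) (tpow heatL l)) (corrf h u) 0)
        <= CT * K * (re / r ^+ wts s js).
      by apply: (HCT js sj jsm) => //; rewrite rho0 // ltW.
    (* In the clipped case [smoothed] is u itself, so by centering the difference at 0 vanishes for
       n' = 0 and only the correction remains. *)
    have [ts|ts] := leP (t / 2 * r) 1.
      have := tele js 0%N 0 (leq0n n).
      rewrite AM [act (tpow _ 0) _]act1 (smoothed_id ts) Hcen // => /esym/eqP.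
      rewrite addr_eq0 => /eqP ->; rewrite normcN -ler_pdivlMr //.
      apply: le_trans (cor 0%N) _; rewrite /X -[leRHS]mulrA [leRHS]mulrDl.
      by rewrite lerDr mulr_ge0 ?addr_ge0 // divr_ge0 // ltW.
    have hE : h = t / 2 * r by rewrite /h /Num.max ts.
    (* Otherwise the difference at 0 is computed at the small scale Hm n' <= t r. The exponent eta -
       wts js is positive there and at least eta - F, which yields the factor t^(eta - F). *)
    have [/andP[Hn'1 Hn'2]] := Hs_pick h1; set n' := Num.truncn _ in Hn'1 Hn'2.
    have nn : (n' <= n)%N.
      rewrite truncn_ge_nat ?exprn_ge0 ?divr_ge0 ?(ltW r0) ?(ltW t0) //.
      apply: le_trans (_ : h ^+ (2 * m) <= _); first by rewrite truncn_le // exprn_ge0 // ltW.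
      rewrite lerXn2r ?nnegrE ?(ltW h0) ?divr_ge0 ?(ltW r0) ?(ltW t0) //.
      exact: le_trans hr rt.
    have H'0 : 0 < Hm n' by apply: lt_le_trans Hn'1.
    have -> : act (tDw R js) w 0 = act (tmul (tDw R js) (tpow heatL n')) (smoothed h u) 0
       - \sum_(n' <= l < n) act (tmul (tmul (tDw R js) (Ladj L)) (tpow heatL l)) (corrf h u) 0.
      by rewrite tele // addrK.
    have sm : nrm (act (tmul (tDw R js) (tpow heatL n')) (smoothed h u) 0)
        <= CS * N * (powR (Hm n') eta / Hm n' ^+ wts s js).
      apply: HCS => //; first by apply: leq_trans sj _; exact: leq_addr.
      by rewrite rho0 //; exact: mulr_ge0 (ler0n _ _) (ltW H'0).
    apply: le_trans (ler_wpM2r (ltW (rw _)) (nrmB _ _)) _.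
    rewrite mulrDl /X mulrDl; apply: lerD; last first.
      apply: le_trans (ler_wpM2r (ltW (rw _)) (cor n')) _.
      by rewrite -!mulrA mulVf ?mulr1 // gt_eqF.
    apply: le_trans (ler_wpM2r (ltW (rw _)) sm) _.
    apply: le_trans (_ : CS * N * powR t (eta - F%:R) * re <= _); last first.
      by rewrite ler_wpM2r // lerDl.
    rewrite -!mulrA ler_wpM2l // ler_wpM2l // !mulrA.
    have ww : (wts s js)%:R <= F%:R :> R by rewrite ler_nat.
    rewrite -powR_mulrn ?(ltW H'0) // -powR_sub //.
    have b0 : 0 <= eta - (wts s js)%:R by rewrite subr_ge0 (le_trans ww) // ltW.
    apply: le_trans (_ : powR (t * r) (eta - (wts s js)%:R) * r ^+ wts s js <= _).
      apply: (ler_wpM2r (ltW (rw _))); apply: (powR_le b0 (ltW H'0)).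
      apply: le_trans Hn'2 _; rewrite hE (_ : 2 * (t / 2 * r) = t * r) //; by field.
    rewrite powRM ?(ltW t0) ?(ltW r0) // -mulrA -powR_mulrn ?(ltW r0) // -powR_add // subrK.
    rewrite -/re ler_wpM2r //; apply: ger_powR; last by rewrite lerD2l lerN2.
    by rewrite t0.
  - move=> js z /andP[js1 js2] zB.
    have sj : (size js <= F + ssum s)%N by apply: leq_trans js2; exact: size_wts.
    have zH : rho z <= d%:R * Hm n.
      apply: le_trans (rho_le s_gt0 (ltW r0) zB) _; by rewrite ler_wpM2l.
    rewrite /w -AM.
    apply: le_trans (ler_wpM2r (ltW (rw _)) (HCS js sj u N h n z N0 h1 (le_trans hr rH) zH Hu)) _.
    apply: le_trans (_ : CS * N * powR t (F.+1%:R - eta) * re <= _); last first.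
      by rewrite /X ler_wpM2r // -addrA addrCA lerDl addr_ge0.
    rewrite -!mulrA ler_wpM2l // ler_wpM2l // !mulrA.
    have ww : F.+1%:R <= (wts s js)%:R :> R by rewrite ler_nat.
    (* Beyond order F the exponent eta - wts js is negative, so now the large scale Hm n >= r / t
       helps and yields t^(F + 1 - eta). *)
    have b0 : 0 <= (wts s js)%:R - eta by rewrite subr_ge0 (le_trans _ ww) // ltW.
    rewrite -powR_mulrn ?(ltW H0) // -powR_sub // -opprB powRN.
    apply: le_trans (_ : (powR (r / t) ((wts s js)%:R - eta))^-1 * r ^+ wts s js <= _).
      rewrite ler_wpM2r ?(ltW (rw _)) // lef_pV2 ?posrE ?powR_gt0 ?divr_gt0 //.
      by apply: powR_le => //; rewrite (le_trans _ rt1).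
    rewrite -powRN opprB powRM ?invr_ge0 ?(ltW r0) ?(ltW t0) //.
    rewrite [X in X * _]mulrC -mulrA -powR_mulrn ?(ltW r0) // -powR_add // subrK.
    rewrite -/re ler_wpM2r // -powR_inv1 ?(ltW t0) // -powRrM mulN1r opprB.
    by apply: ger_powR; rewrite ?lerD2r // t0.
have yB : inB s r y by exact: inB_rho.
have E : u y = act (tpow (tavg (avg s h)) F.+1) u y + (w y
   + \sum_(0 <= l < n) act (tmul (tmul (tDw R [::]) (Ladj L)) (tpow heatL l)) (corrf h u) y).
  rewrite {1}(avg_split (avg s h) F.+1 u y); congr (_ + _).
  transitivity (act (tmul (tDw R [::]) (tpow heatL 0)) (smoothed h u) y).
    by rewrite AM !act1.
  by rewrite tele // act1.
have [v [P [HP Hv HuvP]]] := Hloc y.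
have e1 : nrm (act (tpow (tavg (avg s h)) F.+1) u y)
    <= C1 * (N * powR t (eta - F%:R) + K') * re.
  have [ts|ts] := leP (t / 2 * r) 1.
    rewrite TS AM avg_id // Normc.normc0.
    by rewrite !mulr_ge0 // addr_ge0 // mulr_ge0 ?powR_ge0.
  apply: le_trans (HC1 u v P N K' y h N0 K'0 h1 hr HP Hv HuvP) _.
  rewrite -mulrA ler_wpM2l // mulrDl -/r -/re lerD2r -mulrA ler_wpM2l //.
  have hE : h = t / 2 * r by rewrite /h /Num.max ts.
  rewrite hE powRM ?(ltW tau0) ?(ltW r0) // -/re ler_wpM2r //.
  apply: le_trans (_ : powR t eta <= _).
    by apply: (powR_le eta_ge0 (ltW tau0)); lra.
  by apply: ger_powR; rewrite ?t0 /= ?gerBl.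
have e2 := wbound y yB.
have e3 : nrm (\sum_(0 <= l < n) act (tmul (tmul (tDw R [::]) (Ladj L)) (tpow heatL l)) (corrf h u) y)
    <= CT * K * re.
  have := HCT [::] isT; rewrite /wts big_nil => /(_ m_gt0 K u h n 0%N y r K0 HV h1 rh hr rH tH (lexx _)).
  by rewrite expr0 divr1.
rewrite E; apply: le_trans (nrmD _ _) _.
apply: le_trans (lerD e1 (le_trans (nrmD _ _) (lerD e2 e3))) _.
rewrite /X -/re [leLHS](_ : _ = (N * ((C1 + Td * CS) * powR t (eta - F%:R)
    + Td * CS * powR t (F.+1%:R - eta)) + (C1 * K' + (Td * CT + CT) * K)) * re); last by ring.
rewrite ler_wpM2r //; apply: lerD.
  rewrite ler_wpM2l //; apply: le_trans (lerD Ht1 Ht2) _; lra.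
rewrite mulrDr addrC; apply: lerD; rewrite ler_wpM2r //.
  by rewrite [Td * CT + CT]addrC -addrA lerDr.
by rewrite -addrA lerDl addr_ge0 // mulr_ge0.
Qed.

End Core.

(** * Reduction to the unit lattice *)

Section Rescaling.
Variables (R : realType) (d : nat) (s : 'I_d -> nat).
Hypothesis s_gt0 : forall j, (0 < s j)%N.
Local Notation Zd := {ffun 'I_d -> int}.
Local Notation tp := (seq (R[i] * Zd)).
Local Notation rho := (rho R s).
Implicit Types (p q : tp) (u : Zd -> R[i]).

Lemma rhoN k : rho (- k) = rho k.
Proof. by apply: eq_bigr => j _; rewrite ffunE intrN normrN. Qed.

Lemma ldistE (eps : R) k l : 0 < eps -> ldist s eps k l = eps * rho (l - k).
Proof.
move=> e0; rewrite -rhoN opprB /ldist /sdist mulr_sumr; apply: eq_bigr => j _.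
rewrite /pos -mulrBr normrM gtr0_norm ?exprn_gt0 // !ffunE -intrN -intrD.
rewrite powRM ?exprn_ge0 ?(ltW e0) //; congr (_ * _).
rewrite -powR_mulrn ?(ltW e0) // -powRrM divff ?powRr1 ?(ltW e0) //.
by rewrite pnatr_eq0 -lt0n.
Qed.

Lemma tDm_scale (t : 'I_d -> tp) (c : 'I_d -> R[i]) g :
  eqv (tDm (fun j => tscale (c j) (t j)) g) (tscale (\prod_j c j ^+ g j) (tDm t g)).
Proof.
rewrite -big_enum /tDm; elim: (enum 'I_d) => [|j l IH] f.
  by rewrite big_nil lin_scale mul1r.
rewrite big_cons /=; elim: (g j) f => [|n IHn] f.
  by rewrite expr0 mul1r; exact: IH.
rewrite !iterS lin_mul lin_scale.
under eq_lin => k do rewrite IHn lin_scale.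
rewrite lin_mulf [in RHS]lin_scale lin_mul exprS; ring.
Qed.

Lemma scale_prod (eps : R) (g : 'I_d -> nat) :
  \prod_j ((eps ^+ s j)^-1)%:C%C ^+ g j = ((eps ^+ wt s g)^-1)%:C%C :> R[i].
Proof.
rewrite /wt expr_sum -prodfV rmorph_prod; apply: eq_bigr => j _.
by rewrite -rmorphXn exprVn -exprM.
Qed.

Lemma fwdE eps j u : fwd s eps j u = act (tscale ((eps ^+ s j)^-1)%:C%C (tD R j)) u.
Proof.
apply/funext => y; rewrite /act lin_scale -/(act (tD R j) u y) -(fwd1E s) /fwd.
by rewrite expr1n invr1 mul1r.
Qed.

Lemma bwdE eps j u : bwd s eps j u = act (tscale ((eps ^+ s j)^-1)%:C%C (tDb R j)) u.
Proof.
apply/funext => y; rewrite /act lin_scale -/(act (tDb R j) u y) -(bwd1E s) /bwd.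
by rewrite expr1n invr1 mul1r.
Qed.

Lemma act_eqv p q u : eqv p q -> act p u = act q u.
Proof. by move=> E; apply/funext => y; exact: E. Qed.

Lemma act_scale c p u : act (tscale c p) u = (fun y => c * act p u y).
Proof. by apply/funext => y; rewrite /act lin_scale. Qed.

Lemma Dmulti_fwd eps g u : Dmulti (fwd s eps) g u
  = (fun y => ((eps ^+ wt s g)^-1)%:C%C * act (tDm (@tD R d) g) u y).
Proof.
rewrite (act_tDm g u (@fwdE eps)) (act_eqv _ (tDm_scale _ _ _)) scale_prod.
exact: act_scale.
Qed.

Lemma Dmulti_bwd eps g u : Dmulti (bwd s eps) g u
  = (fun y => ((eps ^+ wt s g)^-1)%:C%C * act (tDm (@tDb R d) g) u y).
Proof.
rewrite (act_tDm g u (@bwdE eps)) (act_eqv _ (tDm_scale _ _ _)) scale_prod.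
exact: act_scale.
Qed.

Lemma LopE a m eps u y : Lop s a m eps u y = ((eps ^+ m)^-1)%:C%C * act (tL s a m) u y.
Proof.
rewrite -act_tL mulr_sumr; apply: eq_bigr => g _.
rewrite mulr_sumr; apply: eq_bigr => h /eqP E; rewrite mulrCA; congr (_ * _).
rewrite !Dmulti_bwd !Dmulti_fwd !act_mulf !expr1n invr1 !mul1r mulrA; congr (_ * _).
by rewrite -rmorphM /= -invfM -exprD E.
Qed.

Lemma tDw_tDm js : eqv (tDw R js) (tDm (@tD R d) (fun j => count_mem j js)).
Proof.
have comm (l : seq 'I_d) j (g : 'I_d -> nat) : uniq l -> j \in l ->
    eqv (tmul (tD R j) (foldr (fun i p => iter (g i) (tmul (tD R i)) p) [:: (1, 0)] l))
        (foldr (fun i p => iter ((i == j) + g i)%N (tmul (tD R i)) p) [:: (1, 0)] l).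
  have swap n i (p : tp) : eqv (tmul (tD R j) (iter n (tmul (tD R i)) p))
      (iter n (tmul (tD R i)) (tmul (tD R j) p)).
    elim: n => [|n IH] //=; apply: eqv_trans (tmulA _ _ _) _.
    apply: eqv_trans (eqv_mul (tmulC _ _) (fun=> erefl)) _.
    by apply: eqv_trans (eqv_sym (tmulA _ _ _)) _; exact: eqv_mul.
  have it n i (p q : tp) : eqv p q -> eqv (iter n (tmul (tD R i)) p) (iter n (tmul (tD R i)) q).
    by move=> E; elim: n => //= n IH; exact: eqv_mul.
  elim: l => // i l IH /= /andP[il ul]; rewrite inE.
  have [->|ji] := eqVneq j i => [_|/= jl].
    rewrite /= => f; congr lin; congr tmul; congr iter.
    elim: l il {ul IH} => //= i' l IH'; rewrite inE negb_or => /andP[ii' il].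
    by rewrite -IH' // eq_sym (negbTE ii').
  rewrite add0n; apply: eqv_trans (swap _ _ _) _.
  by apply: it; exact: IH.
elim: js => [|j js IH] /=.
  move=> f; rewrite /tDm; congr lin.
  by elim: (enum 'I_d) => //= i l <-.
apply: eqv_trans (eqv_mul (fun=> erefl) IH) _; rewrite /tDm.
have := comm (enum 'I_d) j (fun i => count_mem i js) (enum_uniq _) (mem_enum _ _).
move=> H; apply: eqv_trans H _ => f; congr lin.
by elim: (enum 'I_d) => //= i l ->; rewrite eq_sym.
Qed.

Lemma wt_count js : wt s (fun j => count_mem j js) = wts s js.
Proof.
rewrite /wt /wts; elim: js => [|j js IH].
  by rewrite big_nil big1 // => i _; rewrite muln0.
rewrite big_cons -IH /=; under eq_bigr do rewrite mulnDr.
rewrite big_split /=; congr (_ + _)%N.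
rewrite (bigD1 j) //= eqxx muln1 big1 ?addn0 // => i ij.
by rewrite eq_sym (negbTE ij) muln0.
Qed.

(** As every s i is at least 1, the ordinary degree of a monomial is at most its weight. *)
Lemma is_poly_pol F (eps : R) P (x : Zd) : is_poly s F P -> is_pol F.+1 (fun z : Zd => P (pos s eps (x + z))).
Proof.
move=> [c HP].
apply: (@eq_is_pol _ _ _ (fun z : Zd => \sum_(b : {ffun 'I_d -> 'I_F.+1} | (wt s (mi b) <= F)%N)
   c b * \prod_(i <- enum 'I_d) (((eps ^+ s i)%:C%C * ((z + x) i)%:~R) ^+ mi b i))) => [z|].
  rewrite HP; apply: eq_bigr => b _; congr (_ * _).
  rewrite rmorph_prod big_enum; apply: eq_bigr => i _; rewrite [RHS]rmorphXn /=; congr (_ ^+ _).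
  by rewrite /pos addrC rmorphM /= rmorph_int.
apply: is_pol_sum => b bF; apply: is_polZ.
apply: (@is_polW _ _ (\sum_(i <- enum 'I_d) mi b i).+1).
  rewrite ltnS; apply: leq_trans bF; rewrite /wt big_enum.
  by apply: leq_sum => i _; rewrite leq_pmull.
apply: (@is_pol_prod _ _ _ (enum 'I_d) (fun i (z : Zd) =>
  ((eps ^+ s i)%:C%C * ((z + x) i)%:~R) ^+ mi b i) (mi b)) => i.
have := @is_polX R d 1 (fun z : Zd => (eps ^+ s i)%:C%C * ((z + x) i)%:~R) (mi b i).
rewrite muln1; apply.
exact: (is_pol_shift x (is_pol_coord (eps ^+ s i)%:C%C i)).
Qed.

Lemma fsum_box (B : nat) (x : Zd) (f : Zd -> R[i]) : (forall y, f y != 0 -> inbox B (y - x)) ->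
  (\sum_(y \in [set: Zd]) f y)%R = \sum_(t : {ffun 'I_d -> 'I_(B.*2.+1)}) f (x + bx t).
Proof.
move=> H; pose r := [seq x + bx t | t : {ffun 'I_d -> 'I_(B.*2.+1)} <- enum {: {ffun 'I_d -> 'I_(B.*2.+1)}}].
have ur : uniq r.
  rewrite map_inj_uniq ?enum_uniq // => t t' /addrI; exact: bx_inj.
rewrite (fsbigE r) //; last first.
  move=> y _ yr; apply/eqP; apply: contraNT yr => /H/inboxP[t E].
  by apply/mapP; exists t; rewrite ?mem_enum // -E addrC subrK.
rewrite big_mkcond /= big_map big_enum /=; apply: eq_bigr => t _.
by rewrite in_setT.
Qed.

Lemma rescaledE phi (lam eps : R) (x y : Zd) : 0 < eps ->
  rescaled s phi (eps * lam) (pos s eps x) (pos s eps y)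
   = (eps ^+ ssum s)^-1 * rescaled s phi lam (pos s 1 0) (pos s 1 (y - x)).
Proof.
move=> e0; rewrite /rescaled exprMn invfM -mulrA; congr (_ * (_ * phi _)).
apply/rowP => j; rewrite !mxE /pos !expr1n !ffunE !mul1r subr0 -mulrBr exprMn invfM mulrACA.
by rewrite mulVf ?mul1r ?intrD ?intrN // gt_eqF // exprn_gt0.
Qed.

Lemma rescaled_inbox k phi (lam : R) : testB s k phi -> 1 <= lam -> exists B : nat,
  forall y : Zd, rescaled s phi lam (pos s 1 0) (pos s 1 y) != 0 -> inbox B y.
Proof.
move=> [_ [[r [r1 Hr]] _]] l1; have l0 : 0 < lam by apply: lt_le_trans l1.
exists (\max_j (Num.truncn (lam ^+ s j)).+1)%N => y nz; apply/forallP => j.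
apply: leq_trans (leq_bigmax (F := fun j => (Num.truncn (lam ^+ s j)).+1) j).
rewrite -(ler_nat R); apply: le_trans (ltW (truncnS_gt _)).
rewrite natr_absz intr_norm.
set w : 'rV[R]_d := \row_i ((lam ^+ s i)^-1 * (pos s 1 y i - pos s 1 0 i)).
have : sdist s (rowfun w) (fun=> 0) < r.
  rewrite ltNge; apply: contra nz => /Hr; rewrite /rescaled -/w => ->.
  by rewrite mulr0.
have wj : w 0 j = (lam ^+ s j)^-1 * (y j)%:~R.
  by rewrite mxE /pos expr1n !ffunE !mul1r subr0.
move=> sd; have : powR `|w 0 j| (s j)%:R^-1 <= 1.
  apply: le_trans (ltW (lt_trans sd r1)); rewrite /sdist (bigD1 j) //= /rowfun subr0 lerDl.
  by apply: sumr_ge0 => i _; exact: powR_ge0.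
move=> p1; have : `|w 0 j| <= 1.
  by rewrite -(powR_root s_gt0 j (normr_ge0 _)) exprn_ile1 ?powR_ge0.
by rewrite wj normrM normfV [`|lam ^+ _|]gtr0_norm ?exprn_gt0 // ler_pdivrMl ?exprn_gt0 // mulr1.
Qed.

(** The volume factor of [pairing] cancels the one from [rescaledE]; only eps^-m from the
    homogeneity of the operator remains. *)
Lemma pairing_rescaled a m (eps : R) (U : Zd -> R[i]) x k phi lam :
  0 < eps -> testB s k phi -> 1 <= lam ->
  pairing s eps (Lop s a m eps U) (rescaled s phi (eps * lam) (pos s eps x))
  = ((eps ^+ m)^-1)%:C%C * (\sum_(y \in [set: Zd]) (act (tL s a m) (fun z => U (x + z)) y
       * (rescaled s phi lam (pos s 1 0) (pos s 1 y))%:C%C))%R.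
Proof.
move=> e0 tphi l1; have [B HB] := rescaled_inbox tphi l1.
have en : 0 < eps ^+ ssum s by rewrite exprn_gt0.
rewrite /pairing (@fsum_box B x) => [|y]; last first.
  apply: contraNT => nB; rewrite rescaledE //.
  have -> : rescaled s phi lam (pos s 1 0) (pos s 1 (y - x)) = 0.
    by apply/eqP; apply: contraNT nB; exact: HB.
  by rewrite mulr0 mulr0.
rewrite (@fsum_box B 0) => [|y]; last first.
  apply: contraNT; rewrite subr0 => nB.
  have -> : rescaled s phi lam (pos s 1 0) (pos s 1 y) = 0.
    by apply/eqP; apply: contraNT nB; exact: HB.
  by rewrite mulr0.
rewrite !mulr_sumr; apply: eq_bigr => t _.
rewrite rescaledE // LopE add0r [x + _ - x]addrC addKr rmorphM /=.
have -> : act (tL s a m) U (x + bx t) = act (tL s a m) (fun z => U (x + z)) (bx t).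
  by apply: eq_lin => k'; rewrite addrA.
have ec : (eps ^+ ssum s)%:C%C * ((eps ^+ ssum s)^-1)%:C%C = 1 :> R[i].
  by rewrite -rmorphM /= mulfV // gt_eqF.
by rewrite -[LHS]mulr1 -[RHS]mulr1 -{2}ec; ring: ec.
Qed.

End Rescaling.

(** * Passage from the unit lattice to germs *)

Section Reduction.
Variables (R : realType) (d : nat) (s : 'I_d -> nat).
Hypothesis s_gt0 : forall j, (0 < s j)%N.
Variables (m : nat) (a : ('I_d -> nat) -> ('I_d -> nat) -> R[i]).
Hypothesis hell : discretely_elliptic s a m 1.
Variables (alpha eta : R).
Hypotheses (ha : 0 < alpha) (hae : alpha < eta) (hem : eta < m%:R).
Hypothesis henat : forall n : nat, eta != n%:R.
Local Notation Zd := {ffun 'I_d -> int}.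
Local Notation k0 := (absz (Num.ceil `|eta - m%:R|)).

Lemma raw_estimate : exists2 C : R, 0 <= C & forall eps (U : germ R d) N K K',
  0 < eps -> centered s eps eta U -> 0 <= N -> 0 <= K -> 0 <= K' ->
  (forall x y, nrm (U x y) <= N * powR (ldist s eps x y) eta) ->
  (forall phi x lam, testB s k0 phi -> eps <= lam ->
     powR lam (- (eta - m%:R)) * nrm (pairing s eps (Lgerm s a m eps U x)
       (rescaled s phi lam (pos s eps x))) <= K) ->
  (forall x y, exists P, is_poly s (Num.truncn eta) P /\
     forall z, nrm (U x z - U y z - P (pos s eps z))
        <= K' * powR (ldist s eps y z) alpha
             * powR (ldist s eps x y + ldist s eps y z) (eta - alpha)) ->
  forall x y, nrm (U x y) <= (N / 2 + C * (K + K')) * powR (ldist s eps x y) eta.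
Proof.
have eta0 : 0 < eta by exact: lt_trans hae.
pose F := Num.truncn eta.
have F1 : F%:R < eta by rewrite lt_def henat truncn_le ltW.
have F2 : eta < F.+1%:R by exact: truncnS_gt.
have m0 : (0 < m)%N by rewrite -(ltr_nat R); exact: lt_trans hem.
(* In dimension 0 the lattice is a single point, where centering at order 0 forces U x x = 0. *)
have [j0 _|nj] := pickP (fun _ : 'I_d => true); last first.
  exists 0 => // eps U N K K' e0 cen N0 _ _ _ _ _ x y.
  have -> : y = x by apply/ffunP => j; have := nj j.
  have w0 : (wt s (fun=> 0%N))%:R <= eta.
    by rewrite /wt big1 ?(ltW eta0) // => j; have := nj j.
  have := cen x _ w0; rewrite /Dmulti; have -> : enum 'I_d = [::].
    by apply/eqP; rewrite -size_eq0 -cardE; apply/eqP/eq_card0 => j; have := nj j.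
  move=> /= ->; rewrite Normc.normc0 mulr_ge0 ?powR_ge0 // mul0r addr0.
  by rewrite divr_ge0.
have [C C0 HC] := core_estimate s_gt0 m0 (ord_tL s a m) (symbol_ge s_gt0 hell m0)
  ha hae F1 F2 hem j0 k0.
exists C => // eps U N K K' e0 cen N0 K0 K'0 HN HK HK' x y.
(* After recentring at x distances scale by eps, so all three constants pick up the same factor
   eps^eta, which is restored to the distance at the end. *)
pose u : Zd -> R[i] := fun z => U x (x + z).
pose ee := powR eps eta.
have ee0 : 0 <= ee by exact: powR_ge0.
have rge k : 0 <= rho R s k by exact: rho_ge0.
have pe k r : powR (eps * rho R s k) r = powR eps r * powR (rho R s k) r.
  by rewrite powRM // ltW.
have main := HC u (N * ee) (K * ee) (K' * ee).
have -> : nrm (U x y) = nrm (u (y - x)) by rewrite /u addrC subrK.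
rewrite ldistE // pe mulrA.
apply: le_trans (main _ _ _ _ _ _ _ (y - x)) _.
- by rewrite mulr_ge0.
- by rewrite mulr_ge0.
- by rewrite mulr_ge0.
- move=> z; apply: le_trans (HN x (x + z)) _.
  by rewrite ldistE // [x + z - x]addrC addKr pe mulrA.
- move=> phi lam tphi l1.
  have l0 : 0 < lam by apply: lt_le_trans l1.
  have := HK phi x (eps * lam) tphi; rewrite ler_peMr ?(ltW e0) // => /(_ isT).
  rewrite /Lgerm (@pairing_rescaled R d s s_gt0 a m eps (U x) x _ _ _ e0 tphi l1) -/u.
  set S := nrm (\sum_(y \in _) _).
  rewrite Normc.normcM nrm_real gtr0_norm ?invr_gt0 ?exprn_gt0 // -/S.
  have -> : powR (eps * lam) (- (eta - m%:R)) = powR eps m%:R / ee * (powR lam (eta - m%:R))^-1.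
    rewrite powRM ?(ltW e0) ?(ltW l0) //; congr (_ * _); last by rewrite powRN.
    by rewrite opprB powR_sub.
  rewrite powR_mulrn ?(ltW e0) // => le.
  have P1 : 0 < powR lam (eta - m%:R) by rewrite powR_gt0.
  rewrite -ler_pdivrMr // mulrC -ler_pdivrMr ?powR_gt0 //.
  apply: le_trans le; rewrite le_eqVlt; apply/orP; left; apply/eqP.
  by field; rewrite !gt_eqF // ?exprn_gt0 // powR_gt0.
- move=> y'; have [P [HP HPz]] := HK' x (x + y').
  exists (fun z => U (x + y') (x + z)), (fun z => P (pos s eps (x + z))); split.
  + exact: is_poly_pol.
  + move=> z; apply: le_trans (HN _ _) _.
    by rewrite ldistE // opprD addrACA subrr add0r pe mulrA.
  + move=> z; apply: le_trans (HPz (x + z)) _.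
    rewrite !ldistE // [x + z - _](_ : _ = z - y'); last by rewrite opprD addrACA subrr add0r.
    rewrite [x + y' - x]addrC addKr -mulrDr pe powRM ?addr_ge0 ?(ltW e0) //.
    rewrite le_eqVlt; apply/orP; left; apply/eqP.
    have -> : ee = powR eps alpha * powR eps (eta - alpha).
      by rewrite -powR_add // addrC subrK.
    by ring.
- move=> js jsF.
  have wF : (wt s (fun j => count_mem j js))%:R <= eta.
    by rewrite wt_count; apply: le_trans (ltW F1); rewrite ler_nat.
  have := cen x _ wF; rewrite Dmulti_fwd => /eqP; rewrite mulf_eq0 => /orP[|/eqP H].
    rewrite -(rmorph0 (real_complex R)) (inj_eq (@complexI R)) invr_eq0.
    by rewrite gt_eqF // exprn_gt0.
  rewrite (act_eqv _ (tDw_tDm js)) -[RHS]H; apply: eq_lin => k.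
  by rewrite /u add0r.
by rewrite -/ee le_eqVlt; apply/orP; left; apply/eqP; ring.
Qed.

End Reduction.

Theorem theorem3p11 (R : realType) (d : nat) (s : 'I_d -> nat)
  (hs : forall i, (0 < s i)%N)
  (m : nat) (a : ('I_d -> nat) -> ('I_d -> nat) -> R[i])
  (hell : forall eps : R, 0 < eps -> discretely_elliptic s a m eps)
  (alpha eta : R) (ha : 0 < alpha) (hae : alpha < eta) (hem : eta < m%:R)
  (hanat : forall n : nat, alpha != n%:R) (henat : forall n : nat, eta != n%:R) :
  exists C : R, 0 < C /\
    forall eps : R, 0 < eps ->
    forall U : germ R d, centered s eps eta U ->
      (Gnorm s eps eta U < +oo)%E ->
      (Gnorm s eps eta U <= C%:E * (negnorm s eps (eta - m%:R) (Lgerm s a m eps U)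
                                    + holder s eps eta alpha U))%E.
Proof.
have [C C0 HC] := raw_estimate hs (hell 1 ltr01) ha hae hem henat.
exists (2 * C + 1); split; first by rewrite ltr_wpDl // mulr_ge0.
have D0 : 0 < 2 * C + 1 by rewrite ltr_wpDl // mulr_ge0.
move=> eps e0 U cen Gfin.
have G0 : (0 <= Gnorm s eps eta U)%E.
  by apply: le_ereal_inf_tmp => _ [M [M0 _] <-]; rewrite lee_fin ltW.
have H0 : (0 <= holder s eps eta alpha U)%E.
  by apply: le_ereal_inf_tmp => _ [M [M0 _] <-]; rewrite lee_fin ltW.
(* The zero test function shows that the supremum is nonnegative. This excludes -oo, so in the
   infinite cases the right side is +oo. *)
have N0 : (0 <= negnorm s eps (eta - m%:R) (Lgerm s a m eps U))%E.
  have test0 k : testB s k (fun=> 0 : R).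
    have p0 j : partial j (fun=> 0 : R) = (fun=> 0) :> ('rV[R]_d -> R).
      by apply/funext => x; rewrite /partial derive_cst.
    split.
      move=> js x; have -> : iterp js (fun=> 0 : R) = (fun=> 0).
        by elim: js => //= j js ->.
      exact: differentiable_cst.
    split; first by exists 0; split=> //; exact: ltr01.
    move=> b _ y; have -> : multipartial b (fun=> 0 : R) = (fun=> 0).
      rewrite /multipartial; elim: (enum 'I_d) => //= j l ->.
      by elim: (b j) => //= n ->.
    by rewrite normr0.
  apply: ereal_sup_ubound; exists 0 => //.
  exists (fun=> 0), 0, eps; split; first exact: test0.
  split=> //; rewrite /pairing fsbig1 ?mulr0 ?Normc.normc0 ?mulr0 // => y _.
  by rewrite /rescaled mulr0 mulr0.
case EN: (negnorm s eps (eta - m%:R) (Lgerm s a m eps U)) N0 => [K| |] // K0; last first.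
  case EH: (holder s eps eta alpha U) H0 => [K'| |] // K'0.
    by rewrite addye // gt0_muley ?lte_fin // leey.
  by rewrite addye // gt0_muley ?lte_fin // leey.
case EH: (holder s eps eta alpha U) H0 => [K'| |] // K'0; last first.
  by rewrite addey // gt0_muley ?lte_fin // leey.
case EG: (Gnorm s eps eta U) G0 Gfin => [G| |] // G0 _.
rewrite -EFinD -EFinM lee_fin.
rewrite lee_fin in K0; rewrite lee_fin in K'0; rewrite lee_fin in G0.
apply/ler_addgt0Pr => e e_gt0.
(* The infima need not be attained, so N and M are taken within f of them; the slack left after
   absorbing N / 2 is f (1 + 2 C) = e. *)
pose f := e / (1 + 2 * C).
have f0 : 0 < f by rewrite divr_gt0 // addrC.
have [_ [N [Np HN] <-] Ne] : exists2 x, ((fun M : R => M%:E) @`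
    [set M : R | 0 < M /\ forall x y : pt d,
       nrm (U x y) <= M * powR (ldist s eps x y) eta])%classic x & (x < (G + f)%:E)%E.
  apply/ereal_inf_lt; rewrite -/(Gnorm s eps eta U) EG lte_fin; lra.
have [_ [M [Mp HM] <-] Me] : exists2 x, ((fun M : R => M%:E) @`
    [set M : R | 0 < M /\ forall x y : pt d, exists P, is_poly s (Num.truncn eta) P /\
       forall z : pt d, nrm (U x z - U y z - P (pos s eps z))
          <= M * powR (ldist s eps y z) alpha
               * powR (ldist s eps x y + ldist s eps y z) (eta - alpha)])%classic x
    & (x < (K' + f)%:E)%E.
  apply/ereal_inf_lt; rewrite -/(holder s eps eta alpha U) EH lte_fin; lra.
rewrite lte_fin in Ne; rewrite lte_fin in Me.
have HK phi x lam : testB s (absz (Num.ceil `|eta - m%:R|)) phi -> eps <= lam ->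
    powR lam (- (eta - m%:R)) * nrm (pairing s eps (Lgerm s a m eps U x)
       (rescaled s phi lam (pos s eps x))) <= K.
  move=> tphi el; rewrite -lee_fin -EN; apply: ereal_sup_ubound.
  by exists (powR lam (- (eta - m%:R)) * nrm (pairing s eps (Lgerm s a m eps U x)
       (rescaled s phi lam (pos s eps x)))) => //; exists phi, x, lam.
have main := HC eps U N K M e0 cen (ltW Np) K0 (ltW Mp) HN HK HM.
(* The new constant is itself admissible in the infimum, hence bounds the finite number G from
   above; together with N < G + f this absorbs N / 2. *)
have : (Gnorm s eps eta U <= (N / 2 + C * (K + M))%:E)%E.
  apply: ereal_inf_lbound; exists (N / 2 + C * (K + M)) => //.
  by split=> //; rewrite ltr_pwDl ?divr_gt0 // mulr_ge0 // addr_ge0 // ltW.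
rewrite EG lee_fin => GN.
have fe : f * (1 + 2 * C) = e by rewrite divfK // gt_eqF // addrC.
have CM : C * (K + M) <= C * (K + K' + f).
  by rewrite ler_wpM2l // -addrA lerD2l ltW.
have KK : 0 <= K + K' by rewrite addr_ge0.
have CK : C * (K + K' + f) = C * (K + K') + C * f by rewrite mulrDr.
move: GN CM; rewrite CK => GN CM.
have -> : e = f + 2 * (C * f) by rewrite -fe; ring.
rewrite mulrDl mul1r -mulrA.
move: (C * (K + K')) (C * f) (C * (K + M)) GN CM => x1 x2 x3 GN CM; lra.
Qed.
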